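(* Let $k,j$ be positive integers with $j\le k$, and let $0<p<p_c$. For $n\ge1$ let $\mathbb{T}$ be the finite rooted tree consisting of the first $n$ levels (counting the root) of $\bar{\mathbb{T}}^k$, and let $T_1,T_2$ be the mixing times (defined in the context) of the OFA-jf model on $\mathbb{T}$ at density $p$. Then there exists a constant $c>0$, independent of $n$, such that for all $n\ge 1$ $$c^{-1}n\le T_1\le T_2\le c\,n.$$
   Context: $\mathbb{T}^k$ is the infinite regular unrooted tree in which every vertex has exactly $k+1$ neighbors. $\bar{\mathbb{T}}^k$ is the infinite rooted $k$-ary tree: the root $r$ has $k$ children (and no ancestor), and every other vertex has $k$ children and one ancestor (parent). For a vertex $x$, $\mathcal{N}_x$ is the set of its neighbors and, in the rooted case, $\mathcal{K}_x$ is the set of its children. Let $V$ be the vertex set of the tree under consideration, $\Omega=\{0,1\}^V$ (value $1$ = occupied, $0$ = empty). For $p\in[0,1]$ let $\mu=\bigotimes_{x\in V}\mu_x$ be the product measure with $\mu_x(1)=p$, $\mu_x(0)=q=1-p$. $\mu_x(f)(\omega)$ denotes the average of $f$ over the variable at $x$ with respect to $\mu_x$, the other variables being fixed equal to those of $\omega$. The FA-jf model on $\mathbb{T}^k$ and the OFA-jf model on $\bar{\mathbb{T}}^k$ at density $p$ are the continuous time Markov processes reversible with respect to $\mu$ whose generators act on local functions (functions of finitely many variables) as $$\mathcal{L}f(\omega)=\sum_{x\in\mathbb{T}^k}c_x(\omega)[\mu_x(f)(\omega)-f(\omega)],\qquad \bar{\mathcal{L}}f(\omega)=\sum_{x\in\bar{\mathbb{T}}^k}\bar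 c_x(\omega)[\mu_x(f)(\omega)-f(\omega)],$$ where $c_x(\omega)=1$ if $\sum_{y\in\mathcal{N}_x}(1-\omega_y)\ge j$ and $0$ otherwise, and $\bar c_x(\omega)=1$ if $\sum_{y\in\mathcal{K}_x}(1-\omega_y)\ge j$ and $0$ otherwise; they extend to non-positive self-adjoint operators on $L^2(\Omega,\mu)$. The critical densities are $p_c=\sup\{p\in[0,1): 0\text{ is a simple eigenvalue of }\mathcal{L}\}$ and $\bar p_c=\sup\{p\in[0,1): 0\text{ is a simple eigenvalue of }\bar{\mathcal{L}}\}$; for given $k,j$ they coincide, $p_c=\bar p_c$. Finite oriented model: for a finite subtree $\mathbb{T}$ of $\bar{\mathbb{T}}^k$, let $\Omega_{\mathbb{T}}=\{0,1\}^{\mathbb{T}}$ and $\mu_{\mathbb{T}}=\bigotimes_{x\in\mathbb{T}}\mu_x$. For $\eta\in\Omega_{\mathbb{T}}$ let $\eta^0\in\Omega$ be the extension of $\eta$ equal to $0$ outside $\mathbb{T}$, and set $\bar c_{\mathbb{T},x}(\eta)=\bar c_x(\eta^0)$ for $x\in\mathbb{T}$. The OFA-jf model on $\mathbb{T}$ is the continuous time Markov chain on $\Omega_{\mathbb{T}}$ with generator $$\bar{\mathcal{L}}_{\mathbb{T}}f(\eta)=\sum_{x\in\mathbb{T}}\bar c_{\mathbb{T},x}(\eta)[\mu_x(f)(\eta)-f(\eta)].$$ Mixing times: for $\eta\in\Omega_{\mathbb{T}}$ let $\nu_t^\eta$ be the law at time $t$ of the chain with generator $\bar{\mathcal{L}}_{\mathbb{T}}$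 started from $\eta$, and $h_t^\eta(\sigma):=\nu_t^\eta(\sigma)/\mu_{\mathbb{T}}(\sigma)$. For $a\ge1$, $$T_a:=\inf\Big\{t\ge0:\ \max_{\eta}\ \mu_{\mathbb{T}}\big(|h_t^\eta-1|^a\big)^{1/a}\le 1/4\Big\}.$$ *)

(* Defs.v *)
From HB Require Import structures.
From mathcomp Require Import all_boot all_order all_algebra.
From mathcomp Require Import all_classical all_reals all_analysis.
Set Implicit Arguments.
Unset Strict Implicit.
Unset Printing Implicit Defensive.
Import Order.TTheory GRing.Theory Num.Theory.
Import numFieldNormedType.Exports.
Local Open Scope classical_set_scope.
Local Open Scope ring_scope.

(* A vertex of the rooted k-ary tree is the list of child indices on the path
   from the vertex up to the root [::]; the last move comes first. *)
Definition kids (k : nat) (s : seq 'I_k) : seq (seq 'I_k) :=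
  [seq i :: s | i <- enum 'I_k].

(* The (k+1)-regular tree is two copies (b = true, false) of the rooted k-ary
   tree with their roots joined by an edge. *)
Definition regular_tree (k : nat) : Type := (bool * seq 'I_k)%type.

Definition parent (k : nat) (v : regular_tree k) : regular_tree k :=
  if v.2 is _ :: s then (v.1, s) else (~~ v.1, [::]).

Definition nbrs (k : nat) (v : regular_tree k) : seq (bool * seq 'I_k) :=
  parent v :: [seq (v.1, s) | s <- kids v.2].

Lemma size_nbrs (k : nat) (v : regular_tree k) : size (nbrs v) = k.+1.
Proof. by rewrite /nbrs /= !size_map -enumT size_enum_ord. Qed.

Lemma uniq_nbrs (k : nat) (v : regular_tree k) : uniq (nbrs v).
Proof.
case: v => b s; rewrite /nbrs /= /kids -map_comp map_inj_uniq ?enum_uniq ?andbT.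
  apply/mapP => -[i _ /=]; case: s => [|a s] /= [].
    by case: b.
  by move=> /(congr1 size)/eqP; rewrite /= -addn2 -{1}[size s]addn0 eqn_add2l.
by move=> i i' [].
Qed.

Lemma nbrs_sym (k : nat) (v w : regular_tree k) :
  (w \in nbrs v) = (v \in nbrs w).
Proof.
suff sub : forall v w : regular_tree k, w \in nbrs v -> v \in nbrs w.
  by apply/idP/idP; exact: sub.
move=> {v w} [b s] w; rewrite /nbrs in_cons => /orP[/eqP -> | ].
  rewrite /parent; case: s => [|a s] /=.
    by rewrite /parent /= negbK mem_head.
  by rewrite in_cons -map_comp; apply/orP; right; apply/mapP; exists a;
    rewrite ?mem_enum.
rewrite /= /kids -map_comp => /mapP[i _ ->].
by rewrite /parent /= mem_head.
Qed.

Definition cylinder1 (V : Type) : set (set (V -> bool)) :=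
  [set A | exists x b, A = [set omega | omega x = b]].

(* {0,1}^V with the product sigma-algebra; true = occupied *)
Notation config V := (g_sigma_algebraType (@cylinder1 V)).

Section Kinetic.
Variables (R : realType) (V : choiceType) (N : V -> seq V) (j : nat) (p : R).

(* c_x, with N x the list of vertices that may unblock x *)
Definition facilitated (omega : V -> bool) (x : V) : bool :=
  (j <= count (fun y => ~~ omega y) (N x))%N.

Definition bern (b : bool) : R := if b then p else 1 - p.

(* By Kolmogorov extension exactly one such mu exists when 0 <= p <= 1. *)
Definition bernoulli_product (mu : probability (config V) R) : Prop :=
  forall (S : seq V) (b : V -> bool), uniq S ->
    mu [set omega : config V | forall x, x \in S -> (omega : V -> bool) x = b x]
      = (\prod_(x <- S) bern (b x))%:E.

Definition is_local (f : config V -> R) : Prop :=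
  exists S : seq V, forall omega omega' : V -> bool,
    {in S, omega =1 omega'} -> f omega = f omega'.

Definition upd (omega : V -> bool) (x : V) (b : bool) : V -> bool :=
  fun y => if y == x then b else omega y.

Definition site_mean (x : V) (f : config V -> R) (omega : config V) : R :=
  \sum_(b : bool) bern b * f (upd omega x b).

(* For local f only finitely many terms of the sum are nonzero. *)
Definition local_generator (f : config V -> R) (omega : config V) : R :=
  \sum_(x \in [set: V])
    (facilitated omega x)%:R * (site_mean x f omega - f omega).

Definition L2dist (mu : probability (config V) R) (f g : config V -> R) : \bar R :=
  'N[mu]_2%:E[EFin \o (f \- g)%R]%E.

(* The graph of the generator on L^2(mu), i.e. of the L^2-closure of
   local_generator: local functions are a core, so that this closure is the
   self-adjoint extension. *)
Definition generator (mu : probability (config V) R) (f g : config V -> R) : Prop :=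
  [/\ f \in Lfun mu 2%:E, g \in Lfun mu 2%:E &
   exists phi : nat -> config V -> R,
    [/\ forall n, is_local (phi n),
        L2dist mu (phi n) f @[n --> \oo] --> 0%E &
        L2dist mu (local_generator (phi n)) g @[n --> \oo] --> 0%E]].

Definition eigenspace (mu : probability (config V) R) (lambda : R)
    : set (config V -> R) :=
  [set f | generator mu f (fun omega => lambda * f omega)].

Definition simple_eigenvalue (mu : probability (config V) R) (lambda : R) : Prop :=
  exists f, [/\ eigenspace mu lambda f, ~ ae_eq mu setT f (cst 0) &
    forall g, eigenspace mu lambda g ->
      exists c : R, ae_eq mu setT g (fun omega => c * f omega)].

End Kinetic.

Definition critical_density (R : realType) (V : choiceType) (N : V -> seq V)
    (j : nat) : R :=
  sup [set p : R | 0 <= p < 1 /\ exists mu : probability (config V) R,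
    bernoulli_product p mu /\ simple_eigenvalue N j p mu 0].

Definition pc (R : realType) (k j : nat) : R :=
  critical_density R (@nbrs k) j.

Section FiniteVolume.
Variables (R : realType) (V : choiceType) (N : V -> seq V) (j : nat) (p : R).
Variables (P : pred V) (T : subFinType P).

Implicit Types (eta sigma : {ffun T -> bool}) (f : {ffun T -> bool} -> R).

Definition ext0 eta : V -> bool := fun v => oapp eta false (insub v).

Definition updT eta (x : T) (b : bool) : {ffun T -> bool} :=
  [ffun y => if y == x then b else eta y].

Definition site_meanT (x : T) f eta : R :=
  \sum_(b : bool) bern p b * f (updT eta x b).

Definition generatorT f eta : R :=
  \sum_(x : T)
    (facilitated N j (ext0 eta) (val x))%:R * (site_meanT x f eta - f eta).

(* e^{t L} f *)
Definition semigroupT (t : R) f eta : R :=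
  limn (series (fun m => t ^+ m / m`!%:R * iter m generatorT f eta)).

Definition lawT (t : R) eta sigma : R :=
  semigroupT t (fun xi => (xi == sigma)%:R) eta.

Definition muT sigma : R := \prod_(x : T) bern p (sigma x).

Definition densityT (t : R) eta sigma : R := lawT t eta sigma / muT sigma.

Definition distT (a t : R) eta : R :=
  (\sum_sigma muT sigma * `|densityT t eta sigma - 1| `^ a) `^ a^-1.

(* +oo if the threshold 1/4 is never reached *)
Definition mixing_time (a : R) : \bar R :=
  ereal_inf [set t%:E | t in
    [set t : R | 0 <= t /\ \big[Order.max/0]_eta distT a t eta <= 4^-1]].

End FiniteVolume.

(* The first n >= 1 levels are the words of length at most n.-1. *)
Definition level_mixing_time (R : realType) (k j : nat) (p : R) (n : nat)
    (a : R) : \bar R :=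
  mixing_time (@kids k) j p {bseq n.-1 of 'I_k} a.

(* Main.v *)
Require Import Defs.
From HB Require Import structures.
From mathcomp Require Import all_boot all_order all_algebra.
From mathcomp Require Import all_classical all_reals all_analysis measurable_realfun.
From mathcomp Require Import ring lra zify.
Set Implicit Arguments.
Unset Strict Implicit.
Unset Printing Implicit Defensive.
Import Order.TTheory GRing.Theory Num.Theory.
Import numFieldNormedType.Exports.

Local Open Scope ring_scope.

(* Write G(a) = tail a k (k+1-j) for the probability that a vertex having k
   independent children, each of them blocked with probability a, has fewer
   than j unblocked ones.

   If p < p_c, then p2 G(a) <= a on [0, 1] for some p2 > p. Otherwise, for some
   density (again called p) in the set that defines p_c, the probability lamb n
   that a root survives n rounds of emptying decreases to a limit w in ]0, 1[
   with p G'(w) < 1. The event that both roots of the regular tree survive for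
   ever is then a second null vector of the generator: applied to the event of
   surviving n rounds, the generator only sees the pivotal vertices at depth n,
   and their number tends to 0 in L^2 because its moments contract by p G'(w).

   Hence lamb decays geometrically, so that a vertex is cleared by its first n
   levels of descendants with probability close to 1, and the variance is at
   most a constant times the Dirichlet form, uniformly in the finite tree. For
   the bound on T2, the L^2 norm of the density of the law is controlled
   recursively: at time d * level_time it is close to 1 on subtrees of height d,
   since it factorizes over the subtrees of the children and the spectral gap
   absorbs the loss incurred on adding their parent. For T1, started from the
   full configuration, vacancies travel from the leaves at bounded speed. *)

(** * Finite product measures *)

(** A spectral gap alone bounds [T_2] only through the logarithm of the smallest weight of [muT],
    which is of order k^n; hence the recursion over levels, which loses a bounded factor per level.
    The gap itself is reached through a relaxed constraint. The number of emptying rounds is fixed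
    so large that its product with the probability of not being cleared is small; the variance is
    then controlled by long moves, and breaking these into legal ones costs a factor exponential in
    that number, which does not depend on the tree. The critical density is defined by the
    unoriented model, in which a vertex may also be freed through its parent. Requiring both roots
    to survive removes this: all ancestors of a pivotal vertex, and the opposite root, are occupied.
    The strict inequality p < p2 matters twice: p / p2 < 1 is the ratio of the geometric decay, and
    in the contrapositive the room between p2 and the density of the simple eigenvalue excludes a
    slope equal to 1 at the fixed point. *)

Section ProductSpace.
Variables (R : realType) (V : choiceType) (P : pred V) (T : subFinType P).
Variable p : R.
Hypotheses (p0 : 0 < p) (p1 : p < 1).

Local Notation conf := {ffun T -> bool}.
Local Notation Es := (@site_meanT R V p P T).
Implicit Types (f g h : conf -> R) (s t : conf) (x y : T) (A B : {set T}).

Lemma bern_gt0 b : 0 < bern p b.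
Proof. by case: b; rewrite /= ?subr_gt0. Qed.

Lemma bern_sum : bern p true + bern p false = 1.
Proof. by rewrite /= addrC subrK. Qed.

Lemma sum_bern_cst (c : R) : \sum_(b : bool) bern p b * c = c.
Proof. by rewrite -mulr_suml big_bool /= addrC subrK mul1r. Qed.

Lemma muT_gt0 s : 0 < muT p s.
Proof. by apply: prodr_gt0 => x _; exact: bern_gt0. Qed.

Lemma muT_ge0 s : 0 <= muT p s. Proof. exact/ltW/muT_gt0. Qed.

Definition Ex f : R := \sum_s muT p s * f s.

Definition indep (A : Type) x (f : conf -> A) := forall s b, f (updT s x b) = f s.

Lemma updT_id s x : updT s x (s x) = s.
Proof. by apply/ffunP => y; rewrite ffunE; case: eqP => // ->. Qed.

Lemma updT_upd s x b c : updT (updT s x b) x c = updT s x c.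
Proof. by apply/ffunP => y; rewrite !ffunE; case: eqP. Qed.

Lemma updTC s x y b c : x != y ->
  updT (updT s x b) y c = updT (updT s y c) x b.
Proof.
move=> xy; apply/ffunP => z; rewrite !ffunE; case: (eqVneq z x) => // ->.
by rewrite (negbTE xy).
Qed.

Lemma muT_flip s x : muT p (updT s x (~~ s x)) * bern p (s x)
  = muT p s * bern p (~~ s x).
Proof.
rewrite /muT (bigD1 x) //= [in RHS](bigD1 x) //= ffunE eqxx.
rewrite mulrAC [RHS]mulrAC [X in X * _ = _]mulrC; congr (_ * _).
by apply: eq_bigr => y /negbTE yx; rewrite ffunE yx.
Qed.

(** The flip [fl] at [x] is an involution, and [muT_flip] is detailed balance for it; reindexing the
    flipped half of the sum by [fl] gives the identity. *)
Lemma Ex_site x f : Ex (Es x f) = Ex f.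
Proof.
pose fl s : conf := updT s x (~~ s x).
have flK : involutive fl.
  by move=> s; rewrite /fl updT_upd ffunE eqxx negbK updT_id.
have E s : Es x f s = bern p (s x) * f s + bern p (~~ s x) * f (fl s).
  rewrite /site_meanT big_bool /fl.
  have -> : f s = f (updT s x (s x)) by rewrite updT_id.
  by case: (s x) => //=; rewrite addrC.
rewrite /Ex; under eq_bigr do rewrite E mulrDr.
rewrite big_split /= [X in _ + X](reindex_inj (inv_inj flK)) /= -big_split /=.
apply: eq_bigr => s _; rewrite flK !mulrA {1}/fl.
have -> : fl s x = ~~ s x by rewrite ffunE eqxx.
rewrite negbK muT_flip -mulrDl -mulrDr.
by case: (s x) => /=; rewrite ?subrK ?(addrC p) ?subrK mulr1.
Qed.

Lemma sum_muT : \sum_(s : conf) muT p s = 1.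
Proof.
rewrite /muT -(bigA_distr_bigA (fun (_ : T) b => bern p b)) /=.
by rewrite big1 // => x _; rewrite big_bool; exact: bern_sum.
Qed.

Lemma Ex_cst c : Ex (fun=> c) = c.
Proof. by rewrite /Ex -mulr_suml sum_muT mul1r. Qed.

Lemma Ex_ge0 f : (forall s, 0 <= f s) -> 0 <= Ex f.
Proof. by move=> f0; apply: sumr_ge0 => s _; rewrite mulr_ge0 ?muT_ge0. Qed.

Lemma Ex_le f g : (forall s, f s <= g s) -> Ex f <= Ex g.
Proof. by move=> fg; apply: ler_sum => s _; rewrite ler_wpM2l ?muT_ge0. Qed.

Lemma ExD f g : Ex (fun s => f s + g s) = Ex f + Ex g.
Proof. by rewrite /Ex -big_split; apply: eq_bigr => s _; rewrite mulrDr. Qed.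

Lemma ExZ c f : Ex (fun s => c * f s) = c * Ex f.
Proof. by rewrite /Ex mulr_sumr; apply: eq_bigr => s _; rewrite mulrCA. Qed.

Lemma ExB f g : Ex (fun s => f s - g s) = Ex f - Ex g.
Proof. by rewrite /Ex -sumrB; apply: eq_bigr => s _; rewrite mulrBr. Qed.

Lemma Ex_sum (I : Type) (r : seq I) (Q : pred I) (F : I -> conf -> R) :
  Ex (fun s => \sum_(i <- r | Q i) F i s) = \sum_(i <- r | Q i) Ex (F i).
Proof.
by rewrite /Ex exchange_big; apply: eq_bigr => s _; rewrite mulr_sumr.
Qed.

Lemma eq_Ex f g : f =1 g -> Ex f = Ex g.
Proof. by move=> fg; apply: eq_bigr => s _; rewrite fg. Qed.

Lemma Ex_sqr_eq0 f : Ex (fun s => f s ^+ 2) = 0 -> forall s, f s = 0.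
Proof.
move/eqP; rewrite psumr_eq0 => [/allP H s|s _]; last first.
  by rewrite mulr_ge0 ?muT_ge0 ?sqr_ge0.
have := H s (mem_index_enum _); rewrite /= mulf_eq0 gt_eqF ?muT_gt0 //=.
by rewrite sqrf_eq0 => /eqP.
Qed.

Lemma site_indep x f s : indep x f -> Es x f s = f s.
Proof.
by move=> xf; rewrite /site_meanT; under eq_bigr do rewrite xf; exact: sum_bern_cst.
Qed.

Lemma indep_site x f : indep x (Es x f).
Proof.
by move=> s b; rewrite /site_meanT; under eq_bigr do rewrite updT_upd.
Qed.

Lemma indep_siteW x y f : indep x f -> indep x (Es y f).
Proof.
case: (eqVneq x y) => [->|xy xf s b]; first by move=> _; exact: indep_site.
by rewrite /site_meanT; under eq_bigr do rewrite updTC // xf.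
Qed.

Lemma siteZ x f g s : indep x g -> Es x (fun s => g s * f s) s = g s * Es x f s.
Proof.
move=> xg; rewrite /site_meanT mulr_sumr.
by apply: eq_bigr => b _; rewrite xg mulrCA.
Qed.

Lemma siteB x f g s : Es x (fun s => f s - g s) s = Es x f s - Es x g s.
Proof. by rewrite /site_meanT -sumrB; apply: eq_bigr => b _; rewrite mulrBr. Qed.

Lemma site_ge0 x f s : (forall s, 0 <= f s) -> 0 <= Es x f s.
Proof.
by move=> f0; apply: sumr_ge0 => b _; rewrite mulr_ge0 // ltW // bern_gt0.
Qed.

Lemma indep_eq f s t : (forall x, s x != t x -> indep x f) -> f s = f t.
Proof.
move=> H; pose u (r : seq T) : conf := [ffun x => if x \in r then t x else s x].
have step r : f (u r) = f s.
  elim: r => [|x r IH]; first by congr f; apply/ffunP => y; rewrite ffunE.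
  have -> : u (x :: r) = updT (u r) x (t x).
    by apply/ffunP => y; rewrite !ffunE in_cons; case: eqP => // ->.
  have [E|ne] := eqVneq (s x) (t x); last by rewrite (H _ ne).
  rewrite -IH; congr f; apply/ffunP => y; rewrite !ffunE.
  by case: eqP => // ->; rewrite -E if_same.
rewrite -(step (enum T)); congr f; apply/ffunP => y; rewrite ffunE.
by rewrite mem_enum.
Qed.

Definition mix A t s : conf := [ffun x => if x \in A then t x else s x].

(** Conditional expectation given the sites outside [A]. Resampling [A] from an independent copy [t]
    makes it an [Ex] for each fixed [s], so that linearity and Cauchy-Schwarz are inherited
    directly. *)
Definition EA A f s : R := Ex (fun t => f (mix A t s)).

Lemma site_EA x A f : Es x (EA A f) = EA (x |: A) f.
Proof.
apply/funext => s; rewrite {1}/site_meanT /EA.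
have [xA|xA] := boolP (x \in A).
  have -> : x |: A = A by apply/finset.setUidPr; rewrite finset.sub1set.
  have E b t : mix A t (updT s x b) = mix A t s.
    by apply/ffunP => y; rewrite !ffunE; case: ifP => // /negbT; case: eqP => // ->; rewrite xA.
  under eq_bigr => b _ do under [Ex _]eq_Ex => t do rewrite E.
  exact: sum_bern_cst.
rewrite -[RHS](Ex_site x) /site_meanT Ex_sum; apply: eq_bigr => b _.
rewrite ExZ; congr (_ * _).
rewrite -[LHS](Ex_site x) -[RHS](Ex_site x); apply: eq_Ex => t.
apply: eq_bigr => c _; congr (_ * f _); apply/ffunP => y; rewrite !ffunE in_setU1.
by case: (eqVneq y x) => [->|//]; rewrite (negbTE xA).
Qed.

Lemma EA_site x A f : EA A (Es x f) = EA (x |: A) f.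
Proof.
apply/funext => s; rewrite /EA -[RHS](Ex_site x) /site_meanT.
apply: eq_Ex => t; apply: eq_bigr => b _; congr (_ * f _).
by apply/ffunP => y; rewrite !ffunE in_setU1; case: (eqVneq y x).
Qed.

Lemma EA0 f : EA finset.set0 f = f.
Proof.
apply/funext => s; rewrite /EA -[RHS]Ex_cst; apply: eq_Ex => t.
by congr f; apply/ffunP => y; rewrite ffunE inE.
Qed.

Lemma EA1 x f : EA [set x] f = Es x f.
Proof. by rewrite -(finset.setU0 [set x]) -site_EA EA0. Qed.

Lemma EAT f s : EA finset.setT f s = Ex f.
Proof.
by apply: eq_Ex => t; congr f; apply/ffunP => y; rewrite ffunE inE.
Qed.

Lemma EA_EA A B f : EA A (EA B f) = EA (A :|: B) f.
Proof.
have [n] := ubnP #|B|; elim: n B f => // n IH B f; rewrite ltnS => Bn.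
have [->|[x xB]] := set_0Vmem B; first by rewrite EA0 finset.setU0.
rewrite -(finset.setD1K xB) -EA_site IH; last first.
  by rewrite (leq_trans _ Bn) // (cardsD1 x B) xB.
by rewrite EA_site finset.setUCA.
Qed.

Lemma EAC A B f : EA A (EA B f) = EA B (EA A f).
Proof. by rewrite !EA_EA finset.setUC. Qed.

Lemma Ex_EA A f : Ex (EA A f) = Ex f.
Proof.
by have := EA_EA finset.setT A f; move/(congr1 (fun F => F [ffun=> true])); rewrite finset.setTU !EAT.
Qed.

Lemma EA_indep x A f : x \in A -> indep x (EA A f).
Proof.
by move=> xA; rewrite -(finset.setD1K xA) -site_EA; exact: indep_site.
Qed.

Lemma indep_EAW x A f : indep x f -> indep x (EA A f).
Proof.
move=> xf s b; have [xA|xA] := boolP (x \in A); first exact: EA_indep.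
rewrite /EA; apply: eq_Ex => t.
rewrite -(xf (mix A t s) b); congr f; apply/ffunP => y; rewrite !ffunE.
by case: (eqVneq y x) => [->|//]; rewrite (negbTE xA).
Qed.

Lemma EAZ A f g s : (forall x, x \in A -> indep x g) ->
  EA A (fun s => g s * f s) s = g s * EA A f s.
Proof.
move=> Ag; rewrite /EA -ExZ; apply: eq_Ex => t; congr (_ * _).
apply: indep_eq => x; rewrite ffunE; case: ifP => [xA _|]; first exact: Ag.
by rewrite eqxx.
Qed.

Lemma EA_id A g s : (forall x, x \in A -> indep x g) -> EA A g s = g s.
Proof.
move=> Ag; rewrite -[RHS]mulr1 -[in RHS](Ex_cst 1) -[RHS](EAZ (fun=> 1) s Ag).
by rewrite /EA; apply: eq_Ex => t; rewrite mulr1.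
Qed.

Lemma EA_const A f s : (forall x, x \notin A -> indep x f) -> EA A f s = Ex f.
Proof.
move=> Af; rewrite -[RHS](Ex_EA A) -[RHS](EAT _ s) [RHS]EA_id // => x _.
by have [xA|/Af xf] := boolP (x \in A); [exact: EA_indep|exact: indep_EAW].
Qed.

(** With [A] the set of sites on which [f] depends, averaging over [A] replaces [f] by its mean and
    leaves [g] unchanged. *)
Lemma Ex_indepM f g : (forall x, indep x f \/ indep x g) ->
  Ex (fun s => f s * g s) = Ex f * Ex g.
Proof.
move=> H; pose A : {set T} := [set x | ~~ `[< indep x f >]].
have Af x : x \notin A -> indep x f by rewrite inE negbK => /asboolP.
have Ag x : x \in A -> indep x g.
  by rewrite inE => /asboolP xf; case: (H x).
have E : EA A (fun s => f s * g s) = fun s => Ex f * g s.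
  apply/funext => s; rewrite (_ : (fun s => f s * g s) = fun s => g s * f s).
    by rewrite EAZ // EA_const // mulrC.
  by apply/funext => t; rewrite mulrC.
by rewrite -(Ex_EA A) E ExZ.
Qed.

Lemma EAD A f g s : EA A (fun s => f s + g s) s = EA A f s + EA A g s.
Proof. exact: ExD. Qed.

Lemma EAB A f g s : EA A (fun s => f s - g s) s = EA A f s - EA A g s.
Proof. exact: ExB. Qed.

Lemma Ex_CS f g : Ex (fun s => f s * g s) ^+ 2
  <= Ex (fun s => f s ^+ 2) * Ex (fun s => g s ^+ 2).
Proof.
set a := Ex (fun s => f s ^+ 2); set b := Ex (fun s => g s ^+ 2).
set c := Ex (fun s => f s * g s).
have a0 : 0 <= a by apply: Ex_ge0 => s; exact: sqr_ge0.
have b0 : 0 <= b by apply: Ex_ge0 => s; exact: sqr_ge0.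
have H u v : 0 <= u ^+ 2 * a - 2 * u * v * c + v ^+ 2 * b.
  have := @Ex_ge0 (fun s => (u * f s - v * g s) ^+ 2) (fun s => sqr_ge0 _).
  rewrite (eq_Ex (g := fun s => u ^+ 2 * f s ^+ 2
    + (- (2 * u * v) * (f s * g s) + v ^+ 2 * g s ^+ 2))); last by move=> s; ring.
  by rewrite ExD ExD !ExZ mulNr addrA.
have [E|bn] := eqVneq b 0.
  rewrite E mulr0; suff -> : c = 0 by rewrite expr0n.
  by rewrite /c -(Ex_cst 0); apply: eq_Ex => s; rewrite (Ex_sqr_eq0 E) mulr0.
have bp : 0 < b by rewrite lt_def bn.
(* At u = b, v = c the quadratic form equals b (a b - c^2). *)
have := H b c; rewrite -subr_ge0 => K.
have : 0 <= b * (a * b - c ^+ 2) by apply: le_trans K _; rewrite le_eqVlt; apply/orP; left; apply/eqP; ring.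
by rewrite pmulr_rge0 // subr_ge0.
Qed.

Lemma EA_CS A f g s : EA A (fun s => f s * g s) s ^+ 2
  <= EA A (fun s => f s ^+ 2) s * EA A (fun s => g s ^+ 2) s.
Proof. exact: Ex_CS. Qed.

Definition nrm f := Ex (fun s => f s ^+ 2).

Lemma nrm_ge0 f : 0 <= nrm f.
Proof. by apply: Ex_ge0 => s; exact: sqr_ge0. Qed.

Lemma EA_sqr A f s : EA A f s ^+ 2 <= EA A (fun s => f s ^+ 2) s.
Proof.
have := EA_CS A f (fun=> 1) s.
have -> : (fun s => f s * 1) = f by apply/funext => t; rewrite mulr1.
by rewrite [X in _ * X]Ex_cst expr1n mulr1.
Qed.

Lemma nrm_EA A f : nrm (EA A f) <= nrm f.
Proof. by rewrite /nrm -[X in _ <= X](Ex_EA A); apply: Ex_le => s; exact: EA_sqr. Qed.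

Lemma EA_adj A f g : Ex (fun s => f s * EA A g s) = Ex (fun s => EA A f s * EA A g s).
Proof.
rewrite -[LHS](Ex_EA A); apply: eq_Ex => s.
under [X in EA A X]funext do rewrite mulrC.
by rewrite EAZ 1?mulrC // => x xA; exact: EA_indep.
Qed.

Lemma nrm_pythag A f : nrm (fun s => f s - EA A f s) = nrm f - nrm (EA A f).
Proof.
rewrite /nrm (eq_Ex (g := fun s => f s ^+ 2 + (EA A f s ^+ 2 - 2 * (f s * EA A f s)))); last by move=> s; ring.
rewrite ExD ExB ExZ EA_adj.
rewrite (eq_Ex (f := fun s => EA A f s * EA A f s) (g := fun s => EA A f s ^+ 2)); last by move=> s; rewrite expr2.
lra.
Qed.

Lemma nrm_proj A f : nrm (fun s => f s - EA A f s) <= nrm f.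
Proof. by rewrite nrm_pythag gerBl nrm_ge0. Qed.

Lemma nrmD3 f g h : nrm (fun s => f s + g s + h s) <= 3 * (nrm f + nrm g + nrm h).
Proof.
rewrite /nrm -!ExD -ExZ; apply: Ex_le => s.
have := sqr_ge0 (f s - g s); have := sqr_ge0 (f s - h s).
by have := sqr_ge0 (g s - h s); nra.
Qed.

Lemma nrmZ c f : nrm (fun s => c * f s) = c ^+ 2 * nrm f.
Proof. by rewrite /nrm -ExZ; apply: eq_Ex => s; rewrite exprMn. Qed.

End ProductSpace.

(** * Emptying rounds on a tree *)

Section BinomialTail.
Variable R : realType.
Implicit Types (a : R) (l : seq R) (k m : nat).

(* Probability that at least m of independent events succeed, the i-th one
   having probability l`_i. *)
Fixpoint tails l m : R :=
  match l, m with
  | _, 0%N => 1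
  | [::], _.+1 => 0
  | a :: l', m'.+1 => a * tails l' m' + (1 - a) * tails l' m
  end.

Definition tail a k m := tails (nseq k a) m.

Lemma tails0 l : tails l 0 = 1. Proof. by case: l. Qed.

Lemma tail_rec a k m :
  tail a k.+1 m.+1 = a * tail a k m + (1 - a) * tail a k m.+1.
Proof. by []. Qed.

Lemma tails_decr l m : all (fun a => 0 <= a <= 1) l -> tails l m.+1 <= tails l m.
Proof.
elim: l m => [|a l IH] [|m] //= /andP[/andP[a0 a1] Hl].
  by have := IH 0%N Hl; rewrite !tails0; nra.
by have := IH m Hl; have := IH m.+1 Hl; nra.
Qed.

Lemma tails_ge0 l m : all (fun a => 0 <= a <= 1) l -> 0 <= tails l m.
Proof.
elim: l m => [|a l IH] [|m] //= /andP[/andP[a0 a1] Hl].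
by rewrite addr_ge0 // mulr_ge0 ?IH ?subr_ge0.
Qed.

Lemma tails_le1 l m : all (fun a => 0 <= a <= 1) l -> tails l m <= 1.
Proof.
move=> Hl; elim: m => [|m IH]; first by rewrite tails0.
exact: le_trans (tails_decr _ Hl) IH.
Qed.

Lemma tails_le (I : Type) (r : seq I) (f g : I -> R) m :
  (forall i, 0 <= f i /\ f i <= g i /\ g i <= 1) ->
  tails (map f r) m <= tails (map g r) m.
Proof.
move=> H; have Hf : all (fun a => 0 <= a <= 1) (map f r).
  by elim: r => //= i r ->; have [f0 [fg g1]] := H i; rewrite f0 (le_trans fg).
elim: r m Hf => [|i r IH] [|m] //= /andP[_ Hr].
have [f0 [fg g1]] := H i; have := tails_decr m Hr.
have := IH m Hr; have := IH m.+1 Hr; nra.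
Qed.

Fixpoint lamb (p : R) k m n : R :=
  if n is n'.+1 then p * tail (lamb p k m n') k m else p.

Lemma tail01 a k m : 0 <= a <= 1 -> 0 <= tail a k m <= 1.
Proof.
move=> a01; have H : all (fun a => 0 <= a <= 1) (nseq k a) by rewrite all_nseq a01 orbT.
by rewrite tails_ge0 ?tails_le1.
Qed.

Lemma lamb01 p k m n : 0 <= p <= 1 -> 0 <= lamb p k m n <= 1.
Proof.
move=> p01; elim: n => [|n IH] //=.
have /andP[t0 t1] := tail01 k m IH; case/andP: p01 => p0 p1.
by rewrite mulr_ge0 //= mulr_ile1.
Qed.

Lemma tail_map (I : Type) (r : seq I) a k m : size r = k ->
  tail a k m = tails (map (fun=> a) r) m.
Proof. by move=> <-; congr tails; elim: r => //= i r ->. Qed.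

End BinomialTail.

Section Count.
Variables (R : realType) (V : choiceType) (P : pred V) (T : subFinType P).
Variable p : R.
Hypotheses (p0 : 0 < p) (p1 : p < 1).
Local Notation conf := {ffun T -> bool}.

Lemma indep_comp (A B : Type) (F : A -> B) x (f : conf -> A) :
  indep x f -> indep x (fun s => F (f s)).
Proof. by move=> xf s b; rewrite xf. Qed.

Lemma indep2 (A B C : Type) (F : A -> B -> C) x (f : conf -> A) (g : conf -> B) :
  indep x f -> indep x g -> indep x (fun s => F (f s) (g s)).
Proof. by move=> xf xg s b; rewrite xf xg. Qed.

Lemma indep_count (I : eqType) (r : seq I) (B : I -> conf -> bool) x :
  (forall i, i \in r -> indep x (B i)) ->
  indep x (fun s => count (B^~ s) r).
Proof.
move=> H s b; apply: eq_in_count => i ir; exact: H.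
Qed.

(** Independence is expressed sitewise: no site influences two of the events. The induction
    conditions on the first event. *)
Lemma Ex_count (I : eqType) (r : seq I) (B : I -> conf -> bool) m :
  uniq r ->
  (forall i i' x, i \in r -> i' \in r -> i != i' ->
    indep x (B i) \/ indep x (B i')) ->
  Ex p (fun s => (m <= count (B^~ s) r)%:R)
    = tails (map (fun i => Ex p (fun s => (B i s)%:R)) r) m.
Proof.
elim: r m => [|i r IH] m.
  move=> _ _ /=; rewrite -[RHS](Ex_cst T p); apply: eq_Ex => s.
  by case: m.
move=> /= /andP[ir ur] H; case: m => [|m].
  by rewrite -[RHS](Ex_cst T p); apply: eq_Ex.
have rW i' : i' \in r -> i' \in i :: r by rewrite in_cons orbC => ->.
have {}IH m' := IH m' ur (fun i i' x ir i'r => H i i' x (rW i ir) (rW i' i'r)).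
pose c s := count (B^~ s) r.
(* The event [B i] matters only when exactly [m] of the remaining ones occur. *)
rewrite (@eq_Ex _ _ _ _ p _ (fun s => (B i s)%:R * ((m <= c s)%:R - (m.+1 <= c s)%:R)
   + (m.+1 <= c s)%:R)); last first.
  move=> s; rewrite -/(c s); case: (B i s); rewrite ?add1n ?add0n ?ltnS ?mul1r ?mul0r ?add0r //.
  by rewrite subrK.
rewrite ExD Ex_indepM //; last first.
  move=> x; have [xr|/existsNP[i']] := pselect (forall i', i' \in r -> indep x (B i')).
    by right; apply: (indep_comp (fun n => (m <= n)%:R - (m < n)%:R : R)); exact: indep_count.
  move/not_implyP => [i'r ni]; left.
  have ii' : i != i' by apply: contra ir => /eqP ->.
  have [xi|//] := H i i' x (mem_head _ _) (rW _ i'r) ii'.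
  exact: (indep_comp (fun b : bool => b%:R : R) xi).
by rewrite ExB !IH; ring.
Qed.

End Count.

(** [N] lists children, [le v z] means that [z] is [v] or a descendant of it, [dp] is the depth.
    Roots are left open, so that the record covers both the rooted tree of words and the two halves
    of the regular tree. *)
Record tree_order (V : eqType) (N : V -> seq V) (le : rel V) (dp : V -> nat) :
  Prop := TreeOrder {
  tree_refl : reflexive le;
  tree_trans : transitive le;
  tree_uniq : forall v, uniq (N v);
  tree_dp : forall v u, u \in N v -> dp u = (dp v).+1;
  tree_split : forall v z, le v z = (z == v) || has (le^~ z) (N v);
  tree_dp_le : forall v z, le v z -> (dp v <= dp z)%N;
  tree_anc : forall v v' z, le v z -> le v' z -> dp v = dp v' -> v = v' }.

Section Blocked.
Variables (V : choiceType) (N : V -> seq V) (j : nat).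
Variables (le : rel V) (dp : V -> nat).
Hypothesis tree : tree_order N le dp.
Implicit Types (w : V -> bool) (v u x : V) (n : nat).

Definition below v x := has (le^~ x) (N v).

(* v stays occupied during n rounds in which every vertex having at least j
   empty children gets emptied *)
Fixpoint blk n w v : bool :=
  if n is n'.+1 then w v && ~~ (j <= count (fun u => ~~ blk n' w u) (N v))%N
  else w v.

(** The constraint at [v] after [n] rounds below it; [n = 0] gives the constraint of the model. *)
Definition cleared n w v := (j <= count (fun u => ~~ blk n w u) (N v))%N.

Lemma blkS n w v : blk n.+1 w v = w v && ~~ cleared n w v.
Proof. by []. Qed.

Lemma tree_kid v u : u \in N v -> le v u.
Proof.
move=> uv; rewrite (tree_split tree); apply/orP; right; apply/hasP; exists u => //.
exact: (tree_refl tree).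
Qed.

Lemma below_dp v x : below v x -> (dp v < dp x)%N.
Proof. by case/hasP => u uv /(tree_dp_le tree); rewrite (tree_dp tree uv). Qed.

Lemma tree_disj v u u' x : u \in N v -> u' \in N v -> le u x -> le u' x -> u = u'.
Proof.
move=> uv u'v ux u'x; apply: (tree_anc tree ux u'x).
by rewrite (tree_dp tree uv) (tree_dp tree u'v).
Qed.

Lemma blk_upd n w v x b : ~~ le v x -> blk n (upd w x b) v = blk n w v.
Proof.
elim: n v => [|n IH] v vx /=.
  by rewrite /upd; case: eqP => // E; rewrite E (tree_refl tree) in vx.
move: (vx); rewrite (tree_split tree) negb_or => /andP[xv /hasPn H].
rewrite {1}/upd eq_sym (negbTE xv); congr (_ && ~~ (_ <= _)%N).
by apply: eq_in_count => u uv; rewrite IH // H.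
Qed.

Lemma cleared_upd n w v x b : ~~ below v x -> cleared n (upd w x b) v = cleared n w v.
Proof.
move=> /hasPn H; rewrite /cleared; congr (_ <= _)%N.
by apply: eq_in_count => u uv; rewrite blk_upd // H.
Qed.

Lemma blk_upd_far n w v x b : (dp v + n < dp x)%N -> blk n (upd w x b) v = blk n w v.
Proof.
elim: n v => [|n IH] v vx /=.
  by rewrite /upd; case: eqP => // E; rewrite E addn0 ltnn in vx.
rewrite {1}/upd; have /negbTE -> : v != x.
  by apply: contraL vx => /eqP ->; rewrite -leqNgt leq_addr.
congr (_ && ~~ (_ <= _)%N).
by apply: eq_in_count => u uv; rewrite IH // (tree_dp tree uv) addSnnS.
Qed.

Lemma cleared_upd_far n w v x b : (dp v + n.+1 < dp x)%N ->
  cleared n (upd w x b) v = cleared n w v.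
Proof.
move=> H; rewrite /cleared; congr (_ <= _)%N.
by apply: eq_in_count => u uv; rewrite blk_upd_far // (tree_dp tree uv) addSnnS.
Qed.

Lemma clearedN n w v k : size (N v) = k -> (0 < j <= k)%N ->
  ~~ cleared n w v = (k.+1 - j <= count (blk n w) (N v))%N.
Proof.
move=> kE /andP[j0 jk]; rewrite /cleared -ltnNge.
have : (count (blk n w) (N v) + count (fun u => ~~ blk n w u) (N v))%N = k.
  by rewrite -kE; exact: count_predC.
by set a := count _ _; set b := count _ _; lia.
Qed.

End Blocked.

(** * Law of the blocked vertices under the product measure *)

Section BlockedLaw.
Variables (R : realType) (V : choiceType) (P : pred V) (T : subFinType P).
Variable p : R.
Hypotheses (p0 : 0 < p) (p1 : p < 1).
Variables (N : V -> seq V) (j k : nat) (le : rel V) (dp : V -> nat).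
Hypothesis tree : tree_order N le dp.
Hypotheses (sizeN : forall v, size (N v) = k) (jk : (0 < j <= k)%N).
Local Notation conf := {ffun T -> bool}.
Local Notation m := (k.+1 - j)%N.

Lemma ext0_updT (s : conf) x b : ext0 (updT s x b) = upd (ext0 s) (val x) b.
Proof.
apply/funext => v; rewrite /ext0 /upd.
have [Pv|nP] := boolP (P v); last first.
  by rewrite !insubN //=; case: eqP => // E; rewrite E valP in nP.
by rewrite -(SubK T Pv) valK /= ffunE val_eqE.
Qed.

Lemma ext0_val (s : conf) x : ext0 s (val x) = s x.
Proof. by rewrite /ext0 valK. Qed.

Lemma ext0_out (s : conf) v : ~~ P v -> ext0 s v = false.
Proof. by move=> nP; rewrite /ext0 insubN. Qed.

Lemma indep_blk n v (x : T) : ~~ le v (val x) ->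
  indep x (fun s : conf => blk N j n (ext0 s) v).
Proof. by move=> H s b; rewrite ext0_updT (blk_upd _ tree). Qed.

Lemma indep_cleared n v (x : T) : ~~ below N le v (val x) ->
  indep x (fun s : conf => cleared N j n (ext0 s) v).
Proof. by move=> H s b; rewrite ext0_updT (cleared_upd _ tree). Qed.

Definition pblk n v := Ex p (fun s : conf => (blk N j n (ext0 s) v)%:R).

Lemma Ex_occupied (x : T) : Ex p (fun s : conf => (s x)%:R) = p.
Proof.
rewrite -(Ex_site p x) -[RHS](Ex_cst T p); apply: eq_Ex => s.
by rewrite /site_meanT big_bool /= !ffunE eqxx mulr1 mulr0 addr0.
Qed.

Lemma Ex_not_cleared n v : Ex p (fun s : conf => (~~ cleared N j n (ext0 s) v)%:R)
  = tails (map (pblk n) (N v)) m.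
Proof.
rewrite (@eq_Ex _ _ _ _ p _ (fun s => (m <= count (fun u => blk N j n (ext0 s) u) (N v))%:R)).
  rewrite (@Ex_count R V P T p V (N v) (fun u (s : conf) => blk N j n (ext0 s) u) m (tree_uniq tree v)) //.
  move=> u u' x uv u'v ne; have [ux|ux] := boolP (le u (val x)); last by left; apply: indep_blk.
  right; apply: indep_blk; apply: contra ne => u'x; apply/eqP.
  exact: (tree_disj tree uv u'v ux u'x).
by move=> s; rewrite (clearedN _ _ (sizeN v)).
Qed.

Lemma pblkS n (x : T) : pblk n.+1 (val x) = p * tails (map (pblk n) (N (val x))) m.
Proof.
rewrite -Ex_not_cleared -[X in X * _](Ex_occupied x) -Ex_indepM; last first.
  move=> y; have [->|ne] := eqVneq y x.
    right; apply: (indep_comp (fun b : bool => (~~ b)%:R : R)); apply: indep_cleared.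
    by apply/negP => /(below_dp tree); rewrite ltnn.
  left; move=> s b; rewrite ffunE eq_sym; case: eqP => // E; by rewrite E eqxx in ne.
by apply: eq_Ex => s; rewrite blkS ext0_val; case: (s x); rewrite ?mul1r ?mul0r.
Qed.

Lemma pblk0 (x : T) : pblk 0 (val x) = p.
Proof. by rewrite -[RHS](Ex_occupied x); apply: eq_Ex => s /=; rewrite ext0_val. Qed.

Lemma pblk_out n v : ~~ P v -> pblk n v = 0.
Proof.
move=> nP; rewrite -[RHS](Ex_cst T p); apply: eq_Ex => s.
by case: n => [|n] /=; rewrite ext0_out.
Qed.

Lemma pblk_ge0 n v : 0 <= pblk n v.
Proof. by apply: Ex_ge0 => // s; rewrite ler0n. Qed.

(** Sites outside [P] are empty, so a finite tree is at most as blocked as the infinite one, for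
    which [lamb] is the exact recursion; [tails] is monotone in the success probabilities. *)
Lemma pblk_le n v : pblk n v <= lamb p k m n.
Proof.
have p01 : 0 <= p <= 1 by rewrite !ltW.
have L i := andP (lamb01 k m i p01); elim: n v => [|n IH] v.
  have [Pv|nP] := boolP (P v); last by rewrite pblk_out //= ltW.
  by rewrite -(SubK T Pv) pblk0.
have [Pv|nP] := boolP (P v); last by rewrite pblk_out //; case: (L n.+1).
have := pblkS n (Sub v Pv); rewrite SubK => -> /=.
rewrite ler_wpM2l ?(ltW p0) // (tail_map _ _ (sizeN v)); apply: tails_le => u.
by split; [exact: pblk_ge0|split; [exact: IH|case: (L n)]].
Qed.

Lemma Ex_not_cleared_le n v :
  Ex p (fun s : conf => (~~ cleared N j n (ext0 s) v)%:R) <= tail (lamb p k m n) k m.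
Proof.
have p01 : 0 <= p <= 1 by rewrite !ltW.
rewrite Ex_not_cleared (tail_map _ _ (sizeN v)); apply: tails_le => u.
by split; [exact: pblk_ge0|split; [exact: pblk_le|case/andP: (lamb01 k m n p01)]].
Qed.

(* v and its descendants down to depth n below it *)
Fixpoint inside n v := if n is n'.+1 then P v && all (inside n') (N v) else P v.

Lemma pblk_inside n v : inside n v -> pblk n v = lamb p k m n.
Proof.
elim: n v => [|n IH] v /=; first by move=> Pv; rewrite -(SubK T Pv) pblk0.
move=> /andP[Pv /allP H]; have := pblkS n (Sub v Pv); rewrite SubK => ->.
rewrite (tail_map _ _ (sizeN v)); congr (_ * tails _ _).
by apply/eq_in_map => u /H /IH.
Qed.

End BlockedLaw.

(** * Uniform spectral gap below criticality *)

Section SpectralGap.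
Variables (R : realType) (V : choiceType) (P : pred V) (T : subFinType P).
Variable p : R.
Hypotheses (p0 : 0 < p) (p1 : p < 1).
Variables (N : V -> seq V) (j : nat) (le : rel V) (dp : V -> nat).
Hypothesis tree : tree_order N le dp.
Local Notation conf := {ffun T -> bool}.
Local Notation Ex := (@Ex R V P T p).
Local Notation EA := (@EA R V P T p).
Local Notation nrm := (@nrm R V P T p).
Local Notation Es := (@site_meanT R V p P T).
Implicit Types (f g : conf -> R) (x y : T) (A B S : {set T}) (n : nat).

Definition descs x : {set T} := [set y : T | below N le (val x) (val y)].

Lemma descs_dp x y : y \in descs x -> (dp (val x) < dp (val y))%N.
Proof. by rewrite inE => /(below_dp tree). Qed.

Lemma below_le v z : below N le v z -> le v z.
Proof. by move=> H; rewrite (tree_split tree); apply/orP; right. Qed.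

Lemma descs_trans x y : y \in descs x -> descs y \subset descs x.
Proof.
rewrite inE => /hasP[u ux uy]; apply/fintype.subsetP => z; rewrite !inE => /below_le yz.
by apply/hasP; exists u => //; exact: (tree_trans tree uy yz).
Qed.

(** The mean variance at [x] of what remains of [f] once the descendants of [x] are averaged out. *)
Definition desc_var f x := nrm (fun s => EA (descs x) f s - EA (x |: descs x) f s).

Lemma desc_var_ge0 f x : 0 <= desc_var f x.
Proof. exact: nrm_ge0. Qed.

(* Averaging out the vertices of S bottom-up, each vertex y costs at most
   desc_var f y because its descendants are averaged out already. *)
Lemma telescope f S B : (forall y, y \in S -> descs y \subset B :|: S) ->
  nrm (EA B f) - nrm (EA (B :|: S) f) <= \sum_(y in S) desc_var f y.
Proof.
have [n] := ubnP #|S|; elim: n S => // n IH S; rewrite ltnS => Sn H.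
have [->|[y0 y0S]] := set_0Vmem S; first by rewrite finset.setU0 subrr big_set0.
have [y yS ymin] := arg_minnP (fun y : T => dp (val y)) y0S.
have {}yS : y \in S := yS.
set S' := S :\ y; have ES : S = y |: S' by rewrite finset.setD1K.
have /IH {}IH : (#|S'| < n)%N by rewrite (leq_trans _ Sn) // [X in (_ < X)%N](cardsD1 y S) yS.
have H' z : z \in S -> descs z \subset B :|: S'.
  move=> zS; apply/fintype.subsetP => t tz; have := fintype.subsetP (H z zS) t tz.
  rewrite !inE => /orP[->//|tS]; rewrite tS andbT; apply/orP; right.
  by apply: contraL (ymin _ zS) => /eqP <-; rewrite -ltnNge; exact: descs_dp.
have {}IH := IH (fun z zS' => H' z (fintype.subsetP (subD1set S y) z zS')).
rewrite (big_setD1 y) //= -/S'.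
have E1 : EA (B :|: S) f = EA [set y] (EA (B :|: S') f).
  by rewrite EA_EA finset.setUCA -ES.
suff step : nrm (EA (B :|: S') f) - nrm (EA (B :|: S) f) <= desc_var f y by lra.
rewrite E1 -nrm_pythag //.
have E2 : EA (B :|: S') f = EA (B :|: S') (EA (descs y) f).
  by rewrite EA_EA (finset.setUidPl (H' y yS)).
apply: le_trans (nrm_EA p0 p1 (B :|: S') _); rewrite le_eqVlt; apply/orP; left; apply/eqP.
congr nrm; apply/funext => s; rewrite EAB E2 EAC EA_EA EA_EA.
have -> // : EA (B :|: S') (EA (y |: descs y) f) = EA (y |: (descs y :|: (B :|: S'))) f.
by rewrite EA_EA finset.setUC -finset.setUA.
Qed.

Lemma variance_le f : nrm f - Ex f ^+ 2 <= \sum_x desc_var f x.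
Proof.
have := @telescope f finset.setT finset.set0.
rewrite finset.set0U EA0 => /(_ (fun y _ => finset.subsetT _)).
have -> : nrm (EA finset.setT f) = Ex f ^+ 2.
  by rewrite -[RHS](Ex_cst T p); apply: eq_Ex => s; rewrite EAT.
by move/le_trans; apply; under eq_bigl do rewrite inE.
Qed.

(** These sites include all those that [clr n x] reads: [n] rounds at the children reach depth
    [n.+1] below [x]. *)
Definition near n x : {set T} :=
  [set y in descs x | (dp (val y) <= dp (val x) + n.+1)%N].

Definition clr n x (s : conf) : R := (cleared N j n (ext0 s) (val x))%:R.

Lemma indep_clr n x y : y \notin near n x -> indep y (clr n x).
Proof.
rewrite inE; have [yx /= H|yx _] := boolP (y \in descs x).
  move=> s b; rewrite /clr ext0_updT (cleared_upd_far _ tree) //.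
  by rewrite ltnNge.
by move=> s b; rewrite /clr ext0_updT (cleared_upd _ tree) //; rewrite inE in yx.
Qed.

(** The fluctuation of [f] at [x] is split according to [clr n x]. Where [x] is cleared, Jensen
    gives a Dirichlet term. The complement has probability [d] and depends on [near n x] only; there
    the function, averaged over the farther descendants, is its mean over [near n x] plus a
    fluctuation. Cauchy-Schwarz bounds the latter by [d] times the variances of the near sites, and
    the mean returns [desc_var f x] with factor [d ^+ 2]. *)
Lemma desc_var_step n x f (d := Ex (fun s => 1 - clr n x s)) :
  desc_var f x <= 3 * (Ex (fun s => clr n x s * (f s - Es x f s) ^+ 2)
    + d * (\sum_(y in near n x) desc_var f y) + d ^+ 2 * desc_var f x).
Proof.
set c := clr n x; set L := near n x; set B := descs x :\: L.
have LB : L :|: B = descs x.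
  by apply/setP => y; rewrite !inE; case: (below _ _ _ _); rewrite ?andbF //= andbT orbN.
pose F s := f s - Es x f s; pose G := EA B F; pose D := EA (descs x) F.
have DE : (fun s => EA (descs x) f s - EA (x |: descs x) f s) = D.
  by apply/funext => s; rewrite /D EAB EA_site.
have DL : D = EA L G by rewrite /D /G EA_EA LB.
have d0 : 0 <= d by apply: Ex_ge0 => // s; rewrite /clr; case: cleared; rewrite ?subr0 ?subrr.
have cL y : y \notin L -> indep y (fun s => 1 - c s).
  by move=> /indep_clr yc s b; rewrite /c yc.
have c2 s : (1 - c s) ^+ 2 = 1 - c s by rewrite /c /clr; case: cleared; rewrite ?subr0 ?subrr ?expr1n ?expr0n.
pose H s := G s - EA L G s.
(* [D] does not depend on the sites of [L], so multiplying by [1 - c] and averaging over [L] turns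
   it into [d * D]. *)
have Dsplit : D = fun s => EA (descs x) (fun s => c s * F s) s + EA L (fun s => (1 - c s) * H s) s + d * D s.
  apply/funext => s.
  have -> : d * D s = EA L (fun s => D s * (1 - c s)) s.
    rewrite EAZ; first by rewrite mulrC EA_const.
    by move=> y yL; rewrite DL; apply: EA_indep.
  have -> : EA (descs x) (fun s => c s * F s) s = D s - EA L (fun s => (1 - c s) * G s) s.
    have <- : EA B (fun s => (1 - c s) * F s) = (fun s => (1 - c s) * G s).
      apply/funext => t; rewrite EAZ // => y; rewrite inE => /andP[+ _]; exact: cL.
    rewrite EA_EA LB /D -EAB; congr (EA _ _ _); apply/funext => t; ring.
  rewrite -addrA -EAD -[LHS](subrK (EA L (fun s => (1 - c s) * G s) s)); congr (_ + EA _ _ _).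
  by apply/funext => t; rewrite /H DL; ring.
have b1 : nrm (EA (descs x) (fun s => c s * F s)) <= Ex (fun s => c s * F s ^+ 2).
  apply: le_trans (nrm_EA _ _ _ _) _ => //; rewrite /nrm.
  apply: Ex_le => // s; rewrite exprMn /c /clr; case: cleared; rewrite ?expr1n ?expr0n ?mul1r ?mul0r //.
have b2 : nrm (EA L (fun s => (1 - c s) * H s)) <= d * nrm H.
  rewrite /nrm -ExZ -[X in _ <= X](Ex_EA p L); apply: Ex_le => // s.
  apply: le_trans (EA_CS _ _ _ _ _ _) _ => //.
  under [X in EA L X s * _]funext do rewrite c2.
  by rewrite EA_const // /EA ExZ.
(* Removing the mean at [x] is a projection and does not increase the norm; what remains is a
   telescoping difference over [L], the sites of [B] being averaged out already. *)
have b3 : nrm H <= \sum_(y in L) desc_var f y.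
  pose K s := EA B f s - EA L (EA B f) s.
  have -> : H = fun s => K s - EA [set x] K s.
    apply/funext => s; rewrite /H /K /G.
    rewrite [in RHS]EAB; have -> : EA B F = fun s => EA B f s - EA [set x] (EA B f) s.
      by apply/funext => t; rewrite /F EAB EA_EA EA_site.
    rewrite EAB (EAC p L [set x]); ring.
  apply: le_trans (nrm_proj _ _ _ _) _ => //; rewrite /K nrm_pythag // EA_EA finset.setUC.
  apply: telescope => y; rewrite inE => /andP[yx _].
  by rewrite finset.setUC LB; exact: descs_trans.
rewrite {1}/desc_var DE [X in nrm X]Dsplit.
apply: le_trans (nrmD3 _ _ _ _ _) _ => //.
rewrite nrmZ /desc_var DE ler_wpM2l // lerD2r lerD // (le_trans b2) // ler_wpM2l //.
Qed.

(** An ancestor of [y] is determined by its depth, and its distance to [y] lies between 1 and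
    [n.+1]. *)
Lemma card_near n y : (#|[set x | y \in near n x]| <= n.+1)%N.
Proof.
pose h (x : T) : 'I_n.+1 := inord (dp (val y) - (dp (val x)).+1).
rewrite -[X in (_ <= X)%N]card_ord -(card_in_imset (f := h)) ?max_card //.
move=> x x'; rewrite !inE => /andP[xy nx] /andP[x'y nx'] /(congr1 val) /=.
have dx := below_dp tree xy; have dx' := below_dp tree x'y.
rewrite /h => E; apply/val_inj; apply: (tree_anc tree (below_le xy) (below_le x'y)).
move: nx nx' dx dx' E; set a := dp (val x); set b := dp (val x'); set c := dp (val y).
move=> nx nx' dx dx'; rewrite !inordK; lia.
Qed.

Lemma sum_near n f :
  \sum_x \sum_(y in near n x) desc_var f y <= n.+1%:R * \sum_x desc_var f x.
Proof.
rewrite (exchange_big_dep xpredT) //= mulr_sumr; apply: ler_sum => y _.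
rewrite (eq_bigl (fun x => x \in [set x | y \in near n x])); last by move=> x; rewrite !inE.
by rewrite sumr_const -[X in X <= _]mulr_natl; apply: ler_wpM2r; rewrite ?desc_var_ge0 ?ler_nat ?card_near.
Qed.

(** Dirichlet form of the dynamics with the relaxed constraint [cleared n]; [n = 0] is the model
    itself. *)
Definition dirichlet n f := \sum_x Ex (fun s => clr n x s * (f s - Es x f s) ^+ 2).

Lemma dirichlet_ge0 n f : 0 <= dirichlet n f.
Proof.
by apply: sumr_ge0 => x _; apply: Ex_ge0 => // s; rewrite mulr_ge0 ?sqr_ge0 // /clr; case: cleared.
Qed.

(** Summing [desc_var_step] over [x], the condition on [d] bounds the last two terms by half of the
    sum of the [desc_var]. This half is absorbed on the left, which doubles the factor 3 to 6. *)
Lemma long_range_gap n f (d : R) :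
  0 <= d -> (forall x, Ex (fun s => 1 - clr n x s) <= d) -> 3 * (d * n.+1%:R + d ^+ 2) <= 2^-1 ->
  nrm f - Ex f ^+ 2 <= 6 * dirichlet n f.
Proof.
move=> d0 Hd d6; apply: le_trans (variance_le f) _.
set S := \sum_x desc_var f x; have S0 : 0 <= S by apply: sumr_ge0 => x _; exact: desc_var_ge0.
have : S <= 3 * (dirichlet n f + d * (n.+1%:R * S) + d ^+ 2 * S).
  have := sum_near n f; rewrite -/S => near_le.
  apply: (@le_trans _ _ (3 * (dirichlet n f + d * (\sum_x \sum_(y in near n x) desc_var f y) + d ^+ 2 * S))); last first.
    by rewrite ler_wpM2l // lerD2r lerD2l ler_wpM2l.
  rewrite /dirichlet /S !mulr_sumr -!big_split mulr_sumr; apply: ler_sum => x _.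
  apply: le_trans (desc_var_step n x f) _; rewrite ler_wpM2l //.
  have dx0 : 0 <= Ex (fun s => 1 - clr n x s).
    by apply: Ex_ge0 => // s; rewrite /clr; case: cleared; rewrite ?subr0 ?subrr.
  rewrite -addrA -[X in _ <= X]addrA lerD2l lerD // ler_wpM2r ?desc_var_ge0 //.
    by apply: sumr_ge0 => y _; exact: desc_var_ge0.
  by rewrite lerXn2r // nnegrE // (le_trans dx0).
by move: d6 S0; set D := dirichlet n f; nra.
Qed.

Definition sitevar f x (s : conf) := (f s - Es x f s) ^+ 2.

Lemma siteE x f s :
  Es x f s = p * f (updT s x true) + (1 - p) * f (updT s x false).
Proof. by rewrite /site_meanT big_bool. Qed.

(* To flip x legally: first empty y, flip x, then restore y. *)
Lemma detour x y f (C D b : conf -> bool) : x != y ->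
  indep x b -> indep y b -> indep x D ->
  (forall s, C s -> ~~ D s -> [/\ s y, b s & D (updT s y false)]) ->
  Ex (fun s => (C s)%:R * sitevar f x s) <=
  (1 + 3 / (1 - p)) * (Ex (fun s => (D s)%:R * sitevar f x s)
     + Ex (fun s => (b s)%:R * sitevar f y s)).
Proof.
move=> xy xb yb xD H; have q0 : 0 < 1 - p by rewrite subr_gt0.
pose W (s : conf) : R := (s y && b s && D (updT s y false))%:R * sitevar f x s.
have CW : Ex (fun s => (C s)%:R * sitevar f x s) <=
    Ex (fun s => (D s)%:R * sitevar f x s) + Ex W.
  rewrite -ExD; apply: Ex_le => // s; rewrite -mulrDl ler_wpM2r ?sqr_ge0 //.
  have [Cs|_] := boolP (C s); last by rewrite addr_ge0.
  have [Ds|nDs] := boolP (D s); first by rewrite lerDl.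
  by have [-> -> ->] := H _ Cs nDs; rewrite add0r.
suff WK : Ex W <= 3 / (1 - p) * (Ex (fun s => (D s)%:R * sitevar f x s)
     + Ex (fun s => (b s)%:R * sitevar f y s)).
  have b0 : 0 <= Ex (fun s => (b s)%:R * sitevar f y s).
    by apply: Ex_ge0 => // s; rewrite mulr_ge0 ?sqr_ge0.
  by rewrite mulrDl mul1r; lra.
(* Averaging both sides over [x] and [y] reduces the claim to an inequality, for each [s], between
   the four values of [f] at the states of these two sites. *)
rewrite -ExD -ExZ -(Ex_site p x) -(Ex_site p y) -[X in _ <= X](Ex_site p x) -[X in _ <= X](Ex_site p y).
apply: Ex_le => // s; rewrite !siteE /W /sitevar !siteE.
have yx : y != x by rewrite eq_sym.
have E0 a c : updT (updT (updT s y a) x c) y true = updT (updT s y true) x c.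
  by rewrite (updTC _ _ _ xy) updT_upd.
have E1 a c : updT (updT (updT s y a) x c) y false = updT (updT s y false) x c.
  by rewrite (updTC _ _ _ xy) updT_upd.
rewrite !E0 !E1 !updT_upd !xD !xb !yb !ffunE !eqxx !(negbTE yx) /=.
set F11 := f (updT (updT s y true) x true); set F01 := f (updT (updT s y true) x false).
set F10 := f (updT (updT s y false) x true); set F00 := f (updT (updT s y false) x false).
rewrite !(mul0r, mulr0, addr0).
have nn (b0 : bool) : 0 <= (b0%:R : R) by [].
set D0 := D (updT s y false); set D1 := (D (updT s y true))%:R : R.
have D1p : 0 <= D1 by exact: nn.
have key : (1 - p) * (p * (p * (1 - p) * (F11 - F01) ^+ 2)) <=
   3 * ((1 - p) * (p * (1 - p) * (F10 - F00) ^+ 2)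
     + p * (1 - p) * (p * (F11 - F10) ^+ 2 + (1 - p) * (F01 - F00) ^+ 2)).
  (* The three legs of the path 11, 10, 00, 01. The division by 1 - p in the constant pays for [y]
     being empty on the middle leg. *)
  have cv : (F11 - F01) ^+ 2 <= 3 * ((F10 - F00) ^+ 2 + (F11 - F10) ^+ 2 + (F01 - F00) ^+ 2).
    have := sqr_ge0 ((F10 - F00) - (F11 - F10)); have := sqr_ge0 ((F10 - F00) + (F01 - F00)).
    by have := sqr_ge0 ((F11 - F10) + (F01 - F00)); nra.
  move: cv; move: ((F11 - F01) ^+ 2) (sqr_ge0 (F10 - F00)) (sqr_ge0 (F11 - F10)) (sqr_ge0 (F01 - F00)).
  move: ((F10 - F00) ^+ 2) ((F11 - F10) ^+ 2) ((F01 - F00) ^+ 2) => u v w t u0 v0 w0 cv.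
  have pq : 0 < p * (1 - p) by rewrite mulr_gt0.
  have -> : (1 - p) * (p * (p * (1 - p) * t)) = p * (1 - p) * (p * (1 - p) * t) by ring.
  have -> : 3 * ((1 - p) * (p * (1 - p) * u) + p * (1 - p) * (p * v + (1 - p) * w))
     = p * (1 - p) * (3 * ((1 - p) * u + p * v + (1 - p) * w)) by ring.
  rewrite ler_pM2l //; apply: (@le_trans _ _ (p * (1 - p) * (3 * (u + v + w)))).
    by rewrite ler_wpM2l // ltW.
  have h1 : p * (1 - p) <= 1 - p by rewrite ger_pMl // ltW.
  have h2 : p * (1 - p) <= p by rewrite ger_pMr // gerBl ltW.
  have := ler_wpM2r u0 h1; have := ler_wpM2r v0 h2; have := ler_wpM2r w0 h1; lra.
rewrite -mulnb natrM; set be := (b s)%:R : R; set de := D0%:R : R.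
have be01 : 0 <= be <= 1 by rewrite /be ler0n lern1 leq_b1.
have de01 : 0 <= de <= 1 by rewrite /de ler0n lern1 leq_b1.
set c := 3 / (1 - p).
set A := (1 - p) * (p * (1 - p) * (F10 - F00) ^+ 2) in key.
set B := p * (1 - p) * (p * (F11 - F10) ^+ 2 + (1 - p) * (F01 - F00) ^+ 2) in key.
set X := p * (p * (1 - p) * (F11 - F01) ^+ 2) in key.
rewrite [X in X <= _](_ : _ = be * de * X); last by rewrite /X; ring.
rewrite [X in _ <= X](_ : _ = c * (D1 * X + de * A + be * B)); last by rewrite /X /A /B; ring.
have pq0 : 0 <= p * (1 - p) by apply: mulr_ge0; exact: ltW.
have X0 : 0 <= X by apply: mulr_ge0; [exact: ltW|apply: mulr_ge0 => //; exact: sqr_ge0].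
have A0 : 0 <= A by apply: mulr_ge0; [exact: ltW|apply: mulr_ge0 => //; exact: sqr_ge0].
have B0 : 0 <= B.
  by apply: mulr_ge0 => //; apply: addr_ge0; apply: mulr_ge0; rewrite ?sqr_ge0 // ltW.
have c0 : 0 <= c by rewrite divr_ge0 // ltW.
have XAB : X <= c * (A + B) by rewrite /c mulrAC ler_pdivlMr // mulrC.
case/andP: be01 => be0 be1; case/andP: de01 => de0 de1.
have bd0 : 0 <= be * de by rewrite mulr_ge0.
apply: le_trans (ler_wpM2l bd0 XAB) _; rewrite mulrCA ler_wpM2l //.
have h1 : be * de * A <= de * A by rewrite ler_wpM2r // ler_piMl.
have h2 : be * de * B <= be * B by rewrite ler_wpM2r // ler_piMr.
have := mulr_ge0 D1p X0; rewrite mulrDr; lra.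
Qed.

Variable k : nat.
Hypothesis sizeN : forall v, size (N v) = k.

Local Notation K := (1 + 3 / (1 - p)).

Lemma K_ge1 : 1 <= K.
Proof. by rewrite lerDl divr_ge0 // subr_ge0 ltW. Qed.

(* The children in l1 count as empty as soon as they can be emptied, those in
   l2 only if they are empty. *)
Definition mixed n (l1 l2 : seq V) (s : conf) : bool :=
  (j <= count (fun u => ~~ blk N j n.+1 (ext0 s) u) l1 + count (fun u => ~~ ext0 s u) l2)%N.

(** Each child moved from [l1] to [l2] costs one [detour], hence a factor [K]: the child is emptied
    first, which is a move allowed by [cleared n]. *)
Lemma mixed_le n x f (l1 l2 : seq V) :
  uniq (l1 ++ l2) -> {subset l1 ++ l2 <= N (val x)} ->
  Ex (fun s => (mixed n l1 l2 s)%:R * sitevar f x s) <=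
  K ^+ size l1 * (Ex (fun s => (mixed n [::] (catrev l1 l2) s)%:R * sitevar f x s)
    + \sum_(y : T | val y \in l1) Ex (fun s => clr n y s * sitevar f y s)).
Proof.
elim: l1 l2 => [|u l1 IH] l2 /=.
  by move=> _ _; rewrite expr0 mul1r big_pred0 ?addr0.
rewrite -/(cat _ _) => /andP[ul ul12] sub.
have uN : u \in N (val x) by apply: sub; rewrite mem_head.
have uni : uniq (l1 ++ u :: l2) by rewrite -cat1s uniq_catCA /= ul.
have sub' : {subset l1 ++ u :: l2 <= N (val x)}.
  by move=> v; rewrite mem_cat in_cons orbCA -mem_cat -in_cons; exact: sub.
have {}IH := IH (u :: l2) uni sub'.
set Z := Ex (fun s => (mixed n [::] _ s)%:R * _) in IH *.
set Q := \sum_(y | val y \in l1) _ in IH.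
set Q' := \sum_(y | _) _.
have g0 y : 0 <= Ex (fun s => clr n y s * sitevar f y s).
  by apply: Ex_ge0 => // s; rewrite mulr_ge0 ?sqr_ge0 // /clr.
have Z0 : 0 <= Z by apply: Ex_ge0 => // s; rewrite mulr_ge0 ?sqr_ge0.
have Q0 : 0 <= Q by apply: sumr_ge0 => y _; exact: g0.
have K1 := K_ge1; have Kl : 1 <= K ^+ size l1 by rewrite exprn_ege1.
rewrite exprS; have ul1 : u \notin l1 by apply: contra ul; rewrite mem_cat => ->.
(* A child outside the tree is empty and counts alike in both lists, so no detour is made. *)
have [Pu|nPu] := boolP (P u); last first.
  have -> : Ex (fun s => (mixed n (u :: l1) l2 s)%:R * sitevar f x s) =
     Ex (fun s => (mixed n l1 (u :: l2) s)%:R * sitevar f x s).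
    by apply: eq_Ex => s; rewrite /mixed /= ext0_out //= !add1n addSn addnS.
  have -> : Q' = Q.
    apply: eq_bigl => y; rewrite in_cons; case: eqP => // E.
    by rewrite -E valP in nPu.
  apply: le_trans IH _; rewrite ler_wpM2r ?addr_ge0 //.
  by rewrite ler_peMl // (le_trans ler01).
pose y0 : T := Sub u Pu; have y0E : val y0 = u by rewrite SubK.
have -> : Q' = Ex (fun s => clr n y0 s * sitevar f y0 s) + Q.
  rewrite /Q' (bigD1 y0) /=; last by rewrite y0E mem_head.
  congr (_ + _); apply: eq_bigl => y; rewrite in_cons -y0E (inj_eq val_inj).
  by case: (eqVneq y y0) => [->|_]; rewrite ?y0E ?(negbTE ul1) ?andbT.
have kidx v : v \in N (val x) -> ~~ le v (val x).
  by move=> /(tree_dp tree) dv; apply/negP => /(tree_dp_le tree); rewrite dv ltnn.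
have y0x : x != y0.
  by apply: contraL uN => /eqP E; rewrite -y0E -E; apply/negP => /kidx; rewrite (tree_refl tree).
have ne_le v : v \in l1 -> ~~ le v u.
  move=> vl1; apply: contra ul1 => vu; have vN : v \in N (val x) by apply: sub; rewrite in_cons mem_cat vl1 orbT.
  by rewrite -(tree_disj tree vN uN vu (tree_refl tree u)).
apply: le_trans (@detour x y0 f (mixed n (u :: l1) l2) (mixed n l1 (u :: l2))
  (fun s => cleared N j n (ext0 s) u) y0x _ _ _ _) _.
- move=> s b; rewrite ext0_updT (cleared_upd _ tree) //.
  by apply/negP => /below_le; apply/negP; exact: kidx.
- move=> s b; rewrite ext0_updT (cleared_upd _ tree) // y0E.
  by apply/negP => /(below_dp tree); rewrite ltnn.
- move=> s b; rewrite /mixed ext0_updT; congr (_ <= _ + _)%N.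
    apply: eq_in_count => v vl; rewrite (blk_upd _ tree) //.
    by apply: kidx; apply: sub; rewrite in_cons mem_cat vl orbT.
  apply: eq_in_count => v vl; rewrite /upd; case: eqP => // E.
  suff : ~~ le v (val x) by rewrite E (tree_refl tree).
  by apply: kidx; apply: sub'; rewrite mem_cat vl orbT.
- move=> s; rewrite /mixed /= -y0E ext0_val.
  have E1 : count (fun v => ~~ blk N j n.+1 (ext0 (updT s y0 false)) v) l1
     = count (fun v => ~~ blk N j n.+1 (ext0 s) v) l1.
    by apply: eq_in_count => v vl; rewrite ext0_updT (blk_upd _ tree) // y0E ne_le.
  have E2 : count (fun v => ~~ ext0 (updT s y0 false) v) l2 = count (fun v => ~~ ext0 s v) l2.
    apply: eq_in_count => v vl; rewrite ext0_updT /upd y0E; case: eqP => // E.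
    by rewrite mem_cat -E vl orbT in ul.
  move: E1 E2 => /= -> ->; rewrite ext0_val ffunE eqxx /= -/(cleared _ _ _ _ _).
  by case: (s y0); case: cleared; rewrite /= ?add0n ?add1n ?addnS ?addSn => H;
    rewrite ?H //= => _; split.
have g0y := g0 y0; rewrite -mulrA ler_wpM2l ?(le_trans ler01 K1) //.
have : Ex (fun s => (cleared N j n (ext0 s) u)%:R * sitevar f y0 s)
    <= K ^+ size l1 * Ex (fun s => clr n y0 s * sitevar f y0 s).
  rewrite (_ : Ex _ = Ex (fun s => clr n y0 s * sitevar f y0 s)) ?ler_peMl //.
  by apply: eq_Ex => s; rewrite /clr y0E.
move: IH; set e1 := Ex _; set e2 := Ex _; set e3 := Ex _; set e4 := K ^+ _.
have -> : e4 * (Z + (e3 + Q)) = e4 * (Z + Q) + e4 * e3 by ring.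
exact: lerD.
Qed.

(** All [k] children of each vertex are converted by [mixed_le]. A vertex is a child of at most one
    [x], so the correction terms sum to at most [dirichlet n f]. *)
Lemma dirichletS n f : dirichlet n.+1 f <= K ^+ k * (dirichlet 0 f + dirichlet n f).
Proof.
have step x : Ex (fun s => clr n.+1 x s * sitevar f x s) <=
    K ^+ k * (Ex (fun s => clr 0 x s * sitevar f x s)
    + \sum_(y : T | val y \in N (val x)) Ex (fun s => clr n y s * sitevar f y s)).
  have := @mixed_le n x f (N (val x)) [::]; rewrite cats0 sizeN.
  move/(_ (tree_uniq tree _) (fun v h => h)); rewrite /mixed /= catrevE cats0.
  congr (_ <= _ * (_ + _)); apply: eq_Ex => s; rewrite /clr /cleared ?addn0 //.
  by rewrite add0n count_rev.
apply: le_trans (ler_sum _ (fun x _ => step x)) _.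
have K0 : 0 <= K ^+ k by rewrite exprn_ge0 // (le_trans ler01 K_ge1).
rewrite -mulr_sumr ler_wpM2l // big_split /= lerD2l.
rewrite (exchange_big_dep xpredT) //=; apply: ler_sum => y _.
have g0 : 0 <= Ex (fun s => clr n y s * sitevar f y s).
  by apply: Ex_ge0 => // s; rewrite mulr_ge0 ?sqr_ge0 // /clr.
have [x0 xy|no] := pickP (fun x : T => val y \in N (val x)).
  rewrite (big_pred1 x0) // => x; apply/idP/eqP => [xy'|->//].
  apply/val_inj/(tree_anc tree (tree_kid tree xy') (tree_kid tree xy)).
  by apply/eqP; rewrite -eqSS -(tree_dp tree xy') -(tree_dp tree xy).
by rewrite big_pred0.
Qed.

Lemma dirichlet_short n f :
  dirichlet n f <= (2 * K ^+ k) ^+ n * dirichlet 0 f.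
Proof.
have K0 : 1 <= K ^+ k by rewrite exprn_ege1 // K_ge1.
elim: n => [|n IH]; first by rewrite expr0 mul1r.
apply: le_trans (dirichletS n f) _.
have -> : (2 * K ^+ k) ^+ n.+1 * dirichlet 0 f = K ^+ k * (2 * ((2 * K ^+ k) ^+ n * dirichlet 0 f)).
  by rewrite exprS; ring.
rewrite ler_wpM2l ?(le_trans ler01 K0) //.
have D0 := dirichlet_ge0 0 f.
have : dirichlet 0 f <= (2 * K ^+ k) ^+ n * dirichlet 0 f.
  by rewrite ler_peMl // exprn_ege1 //; lra.
lra.
Qed.

End SpectralGap.

(** * A gap constant common to all finite trees *)

Section UniformGap.
Variables (R : realType) (p p2 : R) (k j : nat).
Hypotheses (p0 : 0 < p) (p1 : p < 1) (pp2 : p < p2).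
Hypothesis jk : (0 < j <= k)%N.
Local Notation m := (k.+1 - j)%N.
Hypothesis subcritical : forall a : R, 0 <= a <= 1 -> p2 * tail a k m <= a.

(** At [a = lamb n] the hypothesis [subcritical] bounds the tail by [lamb n / p2], so each round
    gains a factor [p / p2]. *)
Lemma lamb_decay n : lamb p k m n <= (p / p2) ^+ n.
Proof.
have p20 : 0 < p2 by exact: lt_trans pp2.
have p01 : 0 <= p <= 1 by rewrite !ltW.
elim: n => [|n IH] /=; first by rewrite expr0 ltW.
have H := subcritical (lamb01 k m n p01).
rewrite exprS -mulrA ler_pM2l // mulrC ler_pdivlMr // mulrC.
exact: le_trans H IH.
Qed.

(** With r = s^2, one factor s^n absorbs n + 1 by Bernoulli's inequality and the other one tends to
    0. *)
Lemma mul_geometric_small (r e : R) : 0 < r < 1 -> 0 < e ->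
  exists n, n.+1%:R * r ^+ n <= e.
Proof.
move=> /andP[r0 r1] e0; pose s := Num.sqrt r.
have s0 : 0 < s by rewrite sqrtr_gt0.
have s1 : s < 1 by rewrite -sqrtr1 ltr_sqrt.
have rs : r = s * s by rewrite -expr2 sqr_sqrtr // ltW.
pose h := Num.min 1 (s^-1 - 1).
have h0 : 0 < h by rewrite /h lt_min ltr01 subr_gt0 invf_gt1.
have bern n : n.+1%:R * h <= s^-1 ^+ n.
  elim: n => [|n IH]; first by rewrite mul1r expr0 /h ge_min lexx.
  rewrite -natr1 mulrDl mul1r exprS.
  have h1 : h <= s^-1 - 1 by rewrite /h ge_min lexx orbT.
  have e1 : 1 <= s^-1 ^+ n by rewrite exprn_ege1 // ltW // invf_gt1.
  have : (s^-1 - 1) * 1 <= (s^-1 - 1) * s^-1 ^+ n.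
    by rewrite ler_wpM2l // subr_ge0 ltW // invf_gt1.
  by rewrite mulr1 mulrBl mul1r; lra.
have s1' : `|s| < 1 by rewrite ger0_norm // ltW.
have /cvgrPdist_lt/(_ _ (mulr_gt0 e0 h0)) [n _ /(_ n (leqnn n))] := cvg_expr s1'.
rewrite /= sub0r normrN ger0_norm ?exprn_ge0 ?(ltW s0) // => sn.
exists n; rewrite rs exprMn -(ler_pM2r h0) (le_trans _ (ltW sn)) //.
have : n.+1%:R * h * (s ^+ n * s ^+ n) <= s^-1 ^+ n * (s ^+ n * s ^+ n).
  by rewrite ler_wpM2r // mulr_ge0 // exprn_ge0 // ltW.
rewrite [X in _ <= X -> _](_ : _ = s ^+ n); last first.
  by rewrite mulrA -exprMn mulVf ?gt_eqF // expr1n mul1r.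
by rewrite mulrAC.
Qed.

Lemma uniform_gap : exists2 C : R, 0 < C &
  forall (V : choiceType) (P : pred V) (T : subFinType P) (N : V -> seq V)
    (le : rel V) (dp : V -> nat), tree_order N le dp ->
    (forall v, size (N v) = k) -> forall f : {ffun T -> bool} -> R,
    nrm p f - Ex p f ^+ 2 <= C * dirichlet p N j 0 f.
Proof.
have p20 : 0 < p2 by exact: lt_trans pp2.
set r := p / p2; have r01 : 0 < r < 1 by rewrite divr_gt0 //= ltr_pdivrMr // mul1r.
(* This makes d (n + 1) and d at most 1/12 below, and 3 (1/12 + 1/144) is less than the 1/2 required
   by [long_range_gap]. *)
have e12 : 0 < p2 * 12^-1 by rewrite mulr_gt0.
have [n Hn] := mul_geometric_small r01 e12.
exists (6 * (2 * (1 + 3 / (1 - p)) ^+ k) ^+ n).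
  have q0 : 0 < 1 - p by rewrite subr_gt0.
  by rewrite mulr_gt0 // exprn_gt0 // mulr_gt0 // exprn_gt0 // addr_gt0 // divr_gt0.
move=> V P T N le dp tree sizeN f.
case/andP: r01 => r0 r1.
(* A vertex fails to be cleared with probability at most tail (lamb n) <= lamb n / p2 <= r^n /
   p2. *)
pose d := r ^+ n / p2; have d0 : 0 <= d by rewrite divr_ge0 ?exprn_ge0 // ltW.
have dn : d * n.+1%:R <= 12^-1.
  by rewrite /d mulrAC ler_pdivrMr // (mulrC _ p2) (mulrC (r ^+ n)).
apply: le_trans (long_range_gap p0 p1 (j := j) tree (n := n) (d := d) f d0 _ _) _.
- move=> x; apply: (@le_trans _ _ (tail (lamb p k m n) k m)).
    rewrite (le_trans _ (Ex_not_cleared_le T p0 p1 tree sizeN jk n (val x))) //.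
    rewrite le_eqVlt; apply/orP; left; apply/eqP; apply: eq_Ex => s.
    by rewrite /clr; case: cleared; rewrite ?subrr ?subr0.
  have p01 : 0 <= p <= 1 by rewrite !ltW.
  rewrite /d ler_pdivlMr // mulrC.
  exact: le_trans (subcritical (lamb01 k m n p01)) (lamb_decay n).
- have n1 : (1 : R) <= n.+1%:R by rewrite ler1n.
  nra.
rewrite -mulrA ler_wpM2l //.
exact: (dirichlet_short p0 p1 j tree sizeN).
Qed.

End UniformGap.

(** * Semigroup and mixing times in finite volume *)

Section Derivatives.
Variable R : realType.
Implicit Types (f g : R -> R) (t a : R).

Lemma derD f g t a b : is_derive t 1 f a -> is_derive t 1 g b ->
  is_derive t 1 (fun t => f t + g t) (a + b).
Proof. exact: is_deriveD. Qed.

Lemma derM f g t a b : is_derive t 1 f a -> is_derive t 1 g b ->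
  is_derive t 1 (fun t => f t * g t) (a * g t + f t * b).
Proof.
by move=> fa gb; apply: is_derive_eq (is_deriveM fa gb) _; rewrite addrC mulrC.
Qed.

Lemma der_cst t a : is_derive t 1 (fun=> a) 0.
Proof. exact: is_derive_cst. Qed.

Lemma derZ f t a b : is_derive t 1 f a -> is_derive t 1 (fun t => b * f t) (b * a).
Proof.
move=> fa; apply: is_derive_eq (derM (der_cst t b) fa) _.
by rewrite mul0r add0r.
Qed.

Lemma der_sum (I : Type) (r : seq I) (F : I -> R -> R) (dF : I -> R) t :
  (forall i, is_derive t 1 (F i) (dF i)) ->
  is_derive t 1 (fun t => \sum_(i <- r) F i t) (\sum_(i <- r) dF i).
Proof.
move=> H; elim: r => [|i r IH].
  rewrite big_nil (_ : (fun t => _) = fun=> 0); first exact: der_cst.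
  by apply/funext => u; rewrite big_nil.
rewrite big_cons (_ : (fun t => _) = fun t => F i t + \sum_(i <- r) F i t).
  exact: derD.
by apply/funext => u; rewrite big_cons.
Qed.

Lemma der_exp t a : is_derive t 1 (fun t => expR (a * t)) (a * expR (a * t)).
Proof.
have H : is_derive t 1 (fun t => a * t) a.
  by apply: is_derive_eq (derZ a (is_derive_id t 1)) _; rewrite mulr1.
by apply: is_derive_eq (is_derive1_comp (is_derive_expR _) H) _; rewrite mulrC.
Qed.

Lemma der_nonincr f (df : R -> R) : (forall t, is_derive t 1 f (df t)) ->
  (forall t, 0 <= t -> df t <= 0) -> forall s t, 0 <= s -> s <= t -> f t <= f s.
Proof.
move=> H df0 s t s0 st; apply: (@ler0_derive1_nincry R f 0) => //.
- move=> x; rewrite in_itv /= andbT => x0.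
  by rewrite derive1E; have [_ ->] := H x; rewrite df0 // ltW.
- apply: continuous_subspaceT => x.
  by apply: differentiable_continuous; apply/derivable1_diffP; have [] := H x.
Qed.

(** The product of [f] with e^(at) is nonincreasing. The rate [a] has no sign: it is positive for
    the decay of the variance and negative for the growth of [vacancies]. *)
Lemma gronwall f (df : R -> R) a : (forall t, is_derive t 1 f (df t)) ->
  (forall t, 0 <= t -> df t <= - (a * f t)) ->
  forall s t, 0 <= s -> 0 <= t -> f (s + t) <= expR (- (a * t)) * f s.
Proof.
move=> H dfa s t s0 t0.
have D u := derM (der_exp u a) (H u).
have := @der_nonincr _ _ D _ s (s + t) s0 _.
rewrite lerDl => /(_ _ t0) K; have {}K : expR (a * (s + t)) * f (s + t) <= expR (a * s) * f s.
  apply: K => u u0; have := dfa u u0; have := expR_gt0 (a * u); nra.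
rewrite -(ler_pM2l (expR_gt0 (a * (s + t)))) (le_trans K) //.
have -> : expR (a * s) = expR (a * (s + t)) * expR (- (a * t)).
  by rewrite -expRD; congr expR; ring.
by rewrite mulrA.
Qed.

End Derivatives.

(** * Exponential of a linear operator on a finite space *)

Section OperatorExponential.
Local Open Scope classical_set_scope.
Local Open Scope ring_scope.
Variables (R : realType) (X : finType) (A : (X -> R) -> X -> R).
Hypothesis Alin : forall a f g x, A (fun x => a * f x + g x) x = a * A f x + A g x.
Implicit Types (f g : X -> R) (x y : X) (t : R).

Definition expA t f x : R :=
  limn (series (fun m => t ^+ m / m`!%:R * iter m A f x)).

Lemma cvg_sum_seq (I : Type) (r : seq I) (u : I -> nat -> R) (l : I -> R) :
  (forall i, u i n @[n --> \oo] --> l i) ->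
  \sum_(i <- r) u i n @[n --> \oo] --> \sum_(i <- r) l i.
Proof.
move=> H; elim: r => [|i r IH].
  by under eq_fun do rewrite big_nil; rewrite big_nil; exact: cvg_cst.
by under eq_fun do rewrite big_cons; rewrite big_cons; exact: cvgD.
Qed.

Lemma A0 x : A (fun=> 0) x = 0.
Proof.
have := Alin 1 (fun=> 0) (fun=> 0) x.
rewrite (_ : (fun x => _) = fun=> 0); last by apply/funext => y; rewrite mulr0 addr0.
by move/eqP; rewrite mul1r -subr_eq0 opprD addNKr oppr_eq0 => /eqP.
Qed.

Lemma A_sum (I : Type) (r : seq I) (a : I -> R) (F : I -> X -> R) x :
  A (fun x => \sum_(i <- r) a i * F i x) x = \sum_(i <- r) a i * A (F i) x.
Proof.
elim: r => [|i r IH].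
  rewrite big_nil -[RHS](A0 x); congr (A _ x).
  by apply/funext => y; rewrite big_nil.
rewrite big_cons -IH -Alin; congr (A _ x).
by apply/funext => y; rewrite big_cons.
Qed.

Lemma A_coord f x : A f x = \sum_y f y * A (fun z => (z == y)%:R) x.
Proof.
rewrite -A_sum; congr (A _ x); apply/funext => z.
rewrite (bigD1 z) //= eqxx mulr1 big1 ?addr0 // => y yz.
by rewrite eq_sym (negbTE yz) mulr0.
Qed.

Lemma A_bound : exists2 M : R, 0 <= M & forall f B,
  (forall x, `|f x| <= B) -> forall x, `|A f x| <= M * B.
Proof.
exists (\sum_x \sum_y `|A (fun z => (z == y)%:R) x|).
  by apply: sumr_ge0 => x _; apply: sumr_ge0.
move=> f B fB x; have B0 : 0 <= B by exact: le_trans (fB x).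
rewrite A_coord; apply: le_trans (ler_norm_sum _ _ _) _.
apply: (@le_trans _ _ ((\sum_y `|A (fun z => (z == y)%:R) x|) * B)).
  rewrite mulr_suml; apply: ler_sum => y _; rewrite normrM mulrC.
  by rewrite ler_wpM2l.
rewrite ler_wpM2r // [X in _ <= X](bigD1 x) //= lerDl.
by apply: sumr_ge0 => z _; apply: sumr_ge0.
Qed.

Definition expA_coef f x m : R := iter m A f x / m`!%:R.

Lemma expA_pseries t f x : expA t f x = limn (pseries (expA_coef f x) t).
Proof.
rewrite /expA /pseries; congr (limn (series _)); apply/funext => m /=.
by rewrite /expA_coef; ring.
Qed.

Lemma expA_diffs f x : pseries_diffs (expA_coef f x) = expA_coef (A f) x.
Proof.
apply/funext => m; rewrite /pseries_diffs /expA_coef -iterSr factS natrM invfM.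
by rewrite mulrCA mulVKf // pnatr_eq0.
Qed.

Lemma is_cvg_expA t f x : cvgn (pseries (expA_coef f x) t).
Proof.
have [M M0 HM] := A_bound.
pose B := \sum_y `|f y|; have B0 : 0 <= B by apply: sumr_ge0.
have fB y : `|f y| <= B by rewrite /B (bigD1 y) //= lerDl; apply: sumr_ge0.
have it m y : `|iter m A f y| <= M ^+ m * B.
  by elim: m y => [|m IH] y; rewrite ?mul1r //= exprS -mulrA; exact: HM.
apply: normed_cvg; rewrite /normed_series_of /=.
apply: (@series_le_cvg _ _ (fun m => B * exp_coeff (M * `|t|) m)).
- by move=> m; exact: normr_ge0.
- by move=> m; rewrite mulr_ge0 // exp_coeff_ge0 // mulr_ge0.
- move=> m; rewrite /expA_coef /exp_coeff /= !normrM normrX normfV [`|_%:R|]ger0_norm //.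
  rewrite exprMn; have -> : B * (M ^+ m * `|t| ^+ m / m`!%:R) = M ^+ m * B / m`!%:R * `|t| ^+ m by ring.
  by rewrite ler_wpM2r ?exprn_ge0 // ler_wpM2r ?invr_ge0.
have -> : (fun m => B * exp_coeff (M * `|t|) m) = B *: exp_coeff (M * `|t|) by [].
exact/is_cvg_seriesZ/is_cvg_series_exp_coeff.
Qed.

(** Termwise differentiation of a power series in [t]. By [expA_diffs] the derived series is that of
    [A f], so a single convergence lemma covers all derivatives. *)
Lemma expA_der t f x : is_derive t 1 (fun t => expA t f x) (expA t (A f) x).
Proof.
have -> : (fun t => expA t f x) = fun t => limn (pseries (expA_coef f x) t).
  by apply/funext => u; exact: expA_pseries.
rewrite expA_pseries -expA_diffs; apply: (@pseries_snd_diffs _ _ (`|t| + 1)).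
- exact: is_cvg_expA.
- by rewrite expA_diffs; exact: is_cvg_expA.
- by rewrite !expA_diffs; exact: is_cvg_expA.
- by rewrite [X in _ < X]ger0_norm ?addr_ge0 // ltrDl.
Qed.

Lemma iterA_coord m f x : iter m A (A f) x = A (iter m A f) x.
Proof. by rewrite -iterSr. Qed.

Lemma cvg_expA t f x : series (fun m => t ^+ m / m`!%:R * iter m A f x) @ \oo --> expA t f x.
Proof.
have := @is_cvg_expA t f x; rewrite /pseries.
rewrite (_ : (fun _ => _) = (fun m => t ^+ m / m`!%:R * iter m A f x)) //.
by apply/funext => m; rewrite /expA_coef; ring.
Qed.

Lemma expA_comm t f x : expA t (A f) x = A (expA t f) x.
Proof.
have H := @cvg_expA t (A f) x; apply: (cvg_unique _ H) => //.
rewrite A_coord.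
have -> : series (fun m => t ^+ m / m`!%:R * iter m A (A f) x) =
    (fun n => \sum_y series (fun m => t ^+ m / m`!%:R * iter m A f y) n * A (fun z => (z == y)%:R) x).
  apply/funext => n; rewrite /series /=.
  under [RHS]eq_bigr do rewrite mulr_suml.
  rewrite exchange_big; apply: eq_bigr => m _.
  rewrite iterA_coord A_coord mulr_sumr; apply: eq_bigr => y _; by rewrite mulrA.
apply: cvg_sum_seq => y; apply: cvgM; [exact: cvg_expA|exact: cvg_cst].
Qed.

Lemma expA0 f x : expA 0 f x = f x.
Proof.
have H := @cvg_expA 0 f x.
suff K : series (fun m => 0 ^+ m / m`!%:R * iter m A f x) @ \oo --> f x.
  exact: (cvg_unique _ H K).
rewrite -cvg_shiftS; apply: cvg_near_cst; apply: nearW => n /=.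
rewrite /series /= big_nat_recl // expr0 fact0 divr1 mul1r big1 ?addr0 // => i _.
by rewrite expr0n /= !mul0r.
Qed.

Lemma expA_ge0 t f x : 0 <= t -> (forall f, (forall x, 0 <= f x) -> forall x, 0 <= A f x) ->
  (forall x, 0 <= f x) -> 0 <= expA t f x.
Proof.
move=> t0 A0 f0; apply: limr_ge; first exact: cvgP (@cvg_expA t f x).
apply: nearW => n; apply: sumr_ge0 => m _; rewrite mulr_ge0 ?divr_ge0 ?exprn_ge0 //.
by elim: m x => [|m IH] x //=; exact: A0.
Qed.

End OperatorExponential.

(** * The semigroup of the finite oriented model *)

Section Dynamics.
Variables (R : realType) (V : choiceType) (P : pred V) (T : subFinType P).
Variable p : R.
Hypotheses (p0 : 0 < p) (p1 : p < 1).
Variables (N : V -> seq V) (j : nat) (le : rel V) (dp : V -> nat).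
Hypothesis tree : tree_order N le dp.
Local Notation conf := {ffun T -> bool}.
Local Notation Ex := (@Ex R V P T p).
Local Notation nrm := (@nrm R V P T p).
Local Notation Es := (@site_meanT R V p P T).
Local Notation L := (@generatorT R V N j p P T).
Local Notation S := (@semigroupT R V N j p P T).
Local Notation clr := (@clr R V P T N j 0).
Implicit Types (f g : conf -> R) (x y : T) (s : conf) (t : R) (u : R -> conf -> R) (D : {set T}).

Lemma generatorE f s : L f s = \sum_(x : T) clr x s * (Es x f s - f s).
Proof. by []. Qed.

Lemma generator_lin a f g s : L (fun s => a * f s + g s) s = a * L f s + L g s.
Proof.
rewrite !generatorE mulr_sumr -big_split; apply: eq_bigr => x _ /=.
by rewrite !siteE; ring.
Qed.

Lemma indep_clr0 x : indep x (clr x).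
Proof.
move=> s b; rewrite /(clr _ _) ext0_updT (cleared_upd _ tree) //.
by apply/negP => /(below_dp tree); rewrite ltnn.
Qed.

(** Reversibility: the rate at [x] does not read [x], so averaging over [x] makes each term
    symmetric in the two functions. *)
Lemma Ex_gen_sym f g : Ex (fun s => f s * L g s) = Ex (fun s => L f s * g s).
Proof.
have H h1 h2 : Ex (fun s => h1 s * L h2 s) =
    \sum_(x : T) (Ex (fun s => clr x s * Es x h1 s * Es x h2 s) - Ex (fun s => clr x s * h1 s * h2 s)).
  under eq_Ex do rewrite generatorE mulr_sumr.
  rewrite Ex_sum; apply: eq_bigr => x _.
  rewrite -ExB -[LHS](Ex_site p x) -[RHS](Ex_site p x); apply: eq_Ex => s.
  by rewrite !siteE !(indep_clr0 x) !updT_upd; ring.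
rewrite H; under [RHS]eq_Ex do rewrite mulrC.
by rewrite H; apply: eq_bigr => x _; congr (_ - _); apply: eq_Ex => s; ring.
Qed.

Lemma Ex_gen_dirichlet f : Ex (fun s => f s * L f s) = - dirichlet p N j 0 f.
Proof.
under eq_Ex do rewrite generatorE mulr_sumr.
rewrite Ex_sum /dirichlet -sumrN; apply: eq_bigr => x _.
rewrite -[LHS](Ex_site p x) -[in RHS](Ex_site p x) -mulN1r -ExZ; apply: eq_Ex => s.
by rewrite !siteE !(indep_clr0 x) !updT_upd; ring.
Qed.

Lemma nrm_der u t : (forall s, is_derive t 1 (u ^~ s) (L (u t) s)) ->
  is_derive t 1 (fun t => nrm (u t)) (- (2 * dirichlet p N j 0 (u t))).
Proof.
move=> H; have D := @der_sum R _ (index_enum _) (fun s t => muT p s * (u t s * u t s)) _ t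
  (fun s => derZ (muT p s) (derM (H s) (H s))).
rewrite (_ : (fun t => nrm (u t)) = (fun t => \sum_(s : conf) muT p s * (u t s * u t s))); last first.
  by apply/funext => v; apply: eq_bigr => s _; rewrite expr2.
apply: is_derive_eq D _; rewrite -mulrN -Ex_gen_dirichlet -ExZ.
by apply: eq_bigr => s _; ring.
Qed.

Lemma semigroupE t f s : S t f s = expA L t f s. Proof. by []. Qed.

Lemma semigroup_der f s t : is_derive t 1 (fun t => S t f s) (L (S t f) s).
Proof.
have := expA_der generator_lin t f s; rewrite (expA_comm generator_lin).
exact.
Qed.

Lemma semigroup0 f s : S 0 f s = f s.
Proof. exact: (expA0 generator_lin). Qed.

(** The norm of the difference is nonincreasing and starts at 0. Positivity, linearity,
    factorization and commutation with site averages are all obtained from this, by exhibiting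
    another solution of the same equation. *)
Lemma ode_unique u v : (forall t s, is_derive t 1 (u ^~ s) (L (u t) s)) ->
  (forall t s, is_derive t 1 (v ^~ s) (L (v t) s)) -> u 0 =1 v 0 ->
  forall t s, 0 <= t -> u t s = v t s.
Proof.
move=> Hu Hv uv0 t s t0; pose w t s := u t s - v t s.
have Hw t' s' : is_derive t' 1 (w ^~ s') (L (w t') s').
  have -> : L (w t') s' = L (u t') s' + (-1) * L (v t') s'.
    rewrite addrC -generator_lin; congr (L _ _).
    by apply/funext => z; rewrite /w; ring.
  have -> : w ^~ s' = fun t => u t s' + (-1) * v t s'.
    by apply/funext => z; rewrite /w; ring.
  exact: (derD (Hu t' s') (derZ (-1) (Hv t' s'))).
have := der_nonincr (fun t => nrm_der (Hw t)) _ (lexx 0) t0.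
have -> : nrm (w 0) = 0.
  by rewrite -[RHS](Ex_cst T p); apply: eq_Ex => z; rewrite /w uv0 subrr expr0n.
move=> /(_ _) H; apply/eqP; rewrite -subr_eq0; apply/eqP.
apply: (@Ex_sqr_eq0 _ _ _ _ _ p0 p1 (w t)); apply/eqP; rewrite eq_le nrm_ge0 // andbT.
by apply: H => t' _; rewrite oppr_le0 mulr_ge0 // dirichlet_ge0.
Qed.

Lemma semigroup_unique u f : (forall t s, is_derive t 1 (u ^~ s) (L (u t) s)) ->
  u 0 =1 f -> forall t s, 0 <= t -> u t s = S t f s.
Proof.
move=> H u0 t s t0; apply: (ode_unique H (fun t s => semigroup_der f s t) _ _ t0).
by move=> z; rewrite u0 semigroup0.
Qed.

(* With M the number of sites, L + M maps nonnegative functions to nonnegative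
   functions, hence so does its exponential, which is e^{Mt} e^{tL}. *)
Lemma semigroup_ge0 f t s : 0 <= t -> (forall s, 0 <= f s) -> 0 <= S t f s.
Proof.
move=> t0 f0; pose M : R := #|T|%:R.
pose B g s := L g s + M * g s.
have Blin a g h z : B (fun s => a * g s + h s) z = a * B g z + B h z.
  by rewrite /B generator_lin; ring.
have BE g z : B g z = \sum_(x : T) (clr x z * Es x g z + (1 - clr x z) * g z).
  rewrite /B generatorE /M -sum1_card natr_sum mulr_suml -big_split.
  by apply: eq_bigr => x _ /=; ring.
have B0 g : (forall z, 0 <= g z) -> forall z, 0 <= B g z.
  move=> g0 z; rewrite BE; apply: sumr_ge0 => x _.
  rewrite /(clr _ _); case: cleared; rewrite ?subrr ?subr0 ?mul1r ?mul0r ?addr0 ?add0r //.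
  exact: site_ge0.
have L0 z : L (fun=> 0) z = 0.
  by rewrite generatorE big1 // => x _; rewrite siteE !mulr0 !addr0 subrr mulr0.
pose u t s : R := expR (- M * t) * expA B t f s.
have Hu t' z : is_derive t' 1 (u ^~ z) (L (u t') z).
  apply: is_derive_eq (derM (der_exp t' (- M)) (expA_der Blin t' f z)) _.
  rewrite (expA_comm Blin) /B.
  have -> : u t' = fun s => expR (- M * t') * expA B t' f s + 0.
    by apply/funext => y; rewrite addr0.
  by rewrite generator_lin L0; ring.
have u0 : u 0 =1 f by move=> z; rewrite /u mulr0 expR0 mul1r (expA0 Blin).
by rewrite -(semigroup_unique Hu u0 s t0) mulr_ge0 ?expR_ge0 // expA_ge0.
Qed.

Lemma semigroup_lin a f g t s : 0 <= t ->
  S t (fun s => a * f s + g s) s = a * S t f s + S t g s.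
Proof.
move=> t0; pose u t s : R := a * S t f s + S t g s.
have Hu t' z : is_derive t' 1 (u ^~ z) (L (u t') z).
  rewrite generator_lin.
  exact: (derD (derZ a (semigroup_der f z t')) (semigroup_der g z t')).
by rewrite -(semigroup_unique Hu _ s t0) // => z; rewrite /u !semigroup0.
Qed.

Lemma generator_indep f : (forall x, indep x f) -> forall s, L f s = 0.
Proof.
by move=> H s; rewrite generatorE big1 // => x _; rewrite site_indep // subrr mulr0.
Qed.

Lemma semigroup_cst c t s : 0 <= t -> S t (fun=> c) s = c.
Proof.
move=> t0; pose u (t : R) (s : conf) : R := c.
have Hu t' z : is_derive t' 1 (u ^~ z) (L (u t') z).
  by rewrite generator_indep //; exact: der_cst.
by rewrite -(semigroup_unique Hu _ s t0).
Qed.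

Lemma semigroup_mono f g t s : 0 <= t -> (forall s, f s <= g s) -> S t f s <= S t g s.
Proof.
move=> t0 fg; rewrite -subr_ge0.
have := @semigroup_ge0 (fun s => (-1) * f s + g s) t s t0.
rewrite semigroup_lin // mulN1r addrC; apply=> z.
by rewrite mulN1r addrC subr_ge0.
Qed.

(** The symmetry of [L] passes to its powers, to the partial sums and to the limit. *)
Lemma Ex_semigroup_sym f g t :
  Ex (fun s => f s * S t g s) = Ex (fun s => S t f s * g s).
Proof.
have it m : Ex (fun s => f s * iter m L g s) = Ex (fun s => iter m L f s * g s).
  by elim: m g => // m IH g; rewrite iterS -Ex_gen_sym -IH; apply: eq_Ex => s; rewrite -iterS iterSr.
pose F h n s := series (fun m => t ^+ m / m`!%:R * iter m L h s) n.
have C h h' : (Ex (fun s => h s * F h' n s) @[n --> \oo] --> Ex (fun s => h s * S t h' s))%classic.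
  apply: cvg_sum_seq => s; apply: cvgM; first exact: cvg_cst.
  by apply: cvgM; [exact: cvg_cst|exact: (cvg_expA generator_lin)].
have E : (fun n => Ex (fun s => f s * F g n s)) = (fun n => Ex (fun s => g s * F f n s)).
  apply/funext => n; have H h h' : Ex (fun s => h s * F h' n s) =
      \sum_(0 <= m < n) t ^+ m / m`!%:R * Ex (fun s => h s * iter m L h' s).
    rewrite /F /series /=; under eq_Ex do rewrite mulr_sumr.
    rewrite Ex_sum; apply: eq_bigr => m _; rewrite -ExZ; apply: eq_Ex => s; ring.
  rewrite !H; apply: eq_bigr => m _; rewrite it; congr (_ * _).
  by apply: eq_Ex => s; rewrite mulrC.
have := C f g; rewrite E => K.
rewrite (cvg_unique _ K (C g f)) //; apply: eq_Ex => s; exact: mulrC.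
Qed.

Lemma Ex_semigroup f t : 0 <= t -> Ex (S t f) = Ex f.
Proof.
move=> t0; rewrite (eq_Ex p (g := fun s => 1 * S t f s)); last by move=> s; rewrite mul1r.
rewrite Ex_semigroup_sym; apply: eq_Ex => s.
by rewrite semigroup_cst // mul1r.
Qed.


Definition supported D f := forall x, x \notin D -> indep x f.

Definition desc_closed D := forall x, x \in D -> descs N le x \subset D.

(** Orientation enters here: the constraint at a site of [D] reads only its descendants, which lie
    in [D]. *)
Lemma generator_supported D f : desc_closed D -> supported D f -> supported D (L f).
Proof.
move=> Dc Df y yD s b; rewrite !generatorE; apply: eq_bigr => x _.
have [xD|xD] := boolP (x \in D); last by rewrite !(site_indep p _ (Df x xD)) !subrr !mulr0.
rewrite (indep_siteW p x (Df y yD)) (Df y yD) /(clr _ _) ext0_updT (cleared_upd _ tree) //.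
by apply: contra yD => xy; apply: (fintype.subsetP (Dc x xD)); rewrite inE.
Qed.

Lemma semigroup_supported D f t : desc_closed D -> supported D f -> supported D (S t f).
Proof.
move=> Dc Df y yD s b; congr (limn (series _)); apply/funext => m.
have : supported D (iter m L f) by elim: m => //= m; exact: generator_supported.
by move/(_ y yD) ->.
Qed.

(** At each site one of the two evolved factors is constant, so [L] obeys the Leibniz rule on the
    product, which therefore solves the evolution equation. *)
Lemma semigroupM D D' f g t s : 0 <= t -> desc_closed D -> desc_closed D' ->
  (forall x, x \in D -> x \notin D') -> supported D f -> supported D' g ->
  S t (fun s => f s * g s) s = S t f s * S t g s.
Proof.
move=> t0 Dc D'c DD' Df D'g; pose u t s : R := S t f s * S t g s.
have Hu t' z : is_derive t' 1 (u ^~ z) (L (u t') z).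
  apply: is_derive_eq (derM (semigroup_der f z t') (semigroup_der g z t')) _.
  rewrite !generatorE mulr_suml mulr_sumr -big_split; apply: eq_bigr => x _ /=.
  have Df' := semigroup_supported t' Dc Df; have D'g' := semigroup_supported t' D'c D'g.
  have [xD|xD] := boolP (x \in D).
    have xD' := DD' x xD.
    rewrite (site_indep p _ (D'g' x xD')) /u.
    have -> : Es x (fun s => S t' f s * S t' g s) z = S t' g z * Es x (S t' f) z.
      rewrite -(siteZ p (S t' f) z (D'g' x xD')); congr (site_meanT p x _ z).
      by apply/funext => y; rewrite mulrC.
    by ring.
  by rewrite (site_indep p _ (Df' x xD)) /u (siteZ p (S t' g) z (Df' x xD)); ring.
by rewrite -(semigroup_unique Hu _ s t0) // => z; rewrite /u !semigroup0.
Qed.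

Lemma semigroup_prod (I : eqType) (r : seq I) (D : I -> {set T}) (F : I -> conf -> R) t s :
  0 <= t -> uniq r -> (forall i, desc_closed (D i)) ->
  (forall i i', i \in r -> i' \in r -> i != i' -> forall x, x \in D i -> x \notin D i') ->
  (forall i, supported (D i) (F i)) ->
  S t (fun s => \prod_(i <- r) F i s) s = \prod_(i <- r) S t (F i) s.
Proof.
move=> t0 + Dc + HF; elim: r s => [|i r IH] s.
  move=> _ _; rewrite big_nil -[RHS](semigroup_cst 1 s t0).
  by congr (semigroupT _ _ _ _ _ s); apply/funext => z; rewrite big_nil.
move=> /= /andP[ir ur] H; rewrite big_cons -IH //; last first.
  by move=> a b ar br; apply: H; rewrite in_cons ?ar ?br orbT.
rewrite -(@semigroupM (D i) [set x | has (fun a => x \in D a) r]) //.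
- by congr (semigroupT _ _ _ _ _ s); apply/funext => z; rewrite big_cons.
- move=> x; rewrite inE => /hasP[a ar xa]; apply/fintype.subsetP => y yx.
  by rewrite inE; apply/hasP; exists a => //; exact: (fintype.subsetP (Dc a x xa)).
- move=> x xi; rewrite inE; apply/hasP => -[a ar]; apply/negP.
  apply: (H i a _ _ _ x xi); rewrite ?mem_head // ?in_cons ?ar ?orbT //.
  by apply: contra ir => /eqP ->.
- move=> x xD z b; apply: eq_big_seq => a ar; apply: (HF a).
  by apply: contra xD => xa; rewrite inE; apply/hasP; exists a.
Qed.

Lemma siteC x y f : Es x (Es y f) = Es y (Es x f).
Proof. by rewrite -!(EA1 p) EAC. Qed.

(** Among the sites on which [f] depends, no rate reads [x]; hence averaging over [x] commutes with
    the generator along the evolution. *)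
Lemma semigroup_site x f t s : 0 <= t -> supported (x |: descs N le x) f ->
  Es x (S t f) s = S t (Es x f) s.
Proof.
move=> t0 Df; pose u t := Es x (S t f).
have Dc : desc_closed (x |: descs N le x).
  move=> y /setU1P[->|yx]; first exact: finset.subsetUr.
  by apply: fintype.subset_trans (descs_trans tree yx) _; exact: finset.subsetUr.
have xx : x \notin descs N le x by apply/negP => /(descs_dp tree); rewrite ltnn.
have Hu t' z : is_derive t' 1 (u ^~ z) (L (u t') z).
  have Df' := semigroup_supported t' Dc Df; set g := S t' f in Df'.
  have -> : L (u t') z = Es x (L g) z.
    rewrite generatorE; have -> : Es x (L g) z = \sum_(y : T) Es x (fun s => clr y s * (Es y g s - g s)) z.
      rewrite siteE !generatorE !mulr_sumr -big_split; apply: eq_bigr => y _.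
      by rewrite [RHS]siteE.
    apply: eq_bigr => y _; rewrite -/g.
    have [xy|xy] := boolP (x \in y |: descs N le y); last first.
      rewrite siteZ ?siteB ?[u t']/Es -/(u t') /u -/g 1?siteC //.
      move=> a b; rewrite /(clr _ _) ext0_updT (cleared_upd _ tree) //.
      by apply: contra xy => xy; rewrite !inE xy orbT.
    have [->|yx] := eqVneq y x.
      rewrite siteZ; last exact: indep_clr0.
      by rewrite siteB /u -/g.
    (* Here [y] is a proper ancestor of [x]: its rate reads [x], but the function does not depend on
       [y] and both terms vanish. *)
    have yD : y \notin x |: descs N le x.
      rewrite !inE negb_or yx /=; apply/negP => /(below_dp tree) d1.
      move: xy; rewrite !inE eq_sym (negbTE yx) /= => /(below_dp tree) d2; lia.
    have -> : Es y (u t') z = u t' z.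
      by apply: site_indep; apply: indep_siteW; exact: Df'.
    rewrite subrr mulr0 siteE !(site_indep p _ (Df' y yD)) !subrr; ring.
  have -> : u ^~ z = fun t => p * S t f (updT z x true) + (1 - p) * S t f (updT z x false).
    by apply/funext => w; rewrite /u siteE.
  rewrite siteE.
  exact: (derD (derZ p (semigroup_der f (updT z x true) t'))
    (derZ (1 - p) (semigroup_der f (updT z x false) t'))).
rewrite -/(u t) -(semigroup_unique Hu _ s t0) // => z.
by rewrite /u !siteE !semigroup0.
Qed.

Lemma variance_decay (C : R) f : 0 < C ->
  (forall f, nrm f - Ex f ^+ 2 <= C * dirichlet p N j 0 f) ->
  forall s t : R, 0 <= s -> 0 <= t ->
  nrm (S (s + t) f) - Ex f ^+ 2 <= expR (- (2 / C * t)) * (nrm (S s f) - Ex f ^+ 2).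
Proof.
move=> C0 gap s t s0 t0.
have D v := derD (nrm_der (fun z => semigroup_der f z v)) (der_cst v (- Ex f ^+ 2)).
apply: (gronwall D _ s0 t0) => v v0; rewrite addr0 lerN2.
have := gap (S v f); rewrite Ex_semigroup // => g.
by rewrite mulrAC ler_pdivrMr // -mulrA ler_wpM2l // mulrC.
Qed.

Lemma Ex_prod (I : eqType) (r : seq I) (F : I -> conf -> R) : uniq r ->
  (forall i i' x, i \in r -> i' \in r -> i != i' -> indep x (F i) \/ indep x (F i')) ->
  Ex (fun s => \prod_(i <- r) F i s) = \prod_(i <- r) Ex (F i).
Proof.
elim: r => [|i r IH] /=.
  move=> _ _; rewrite big_nil -[RHS](Ex_cst T p); apply: eq_Ex => s.
  by rewrite big_nil.
move=> /andP[ir ur] H; rewrite big_cons -IH //; last first.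
  by move=> a b x ar br; apply: H; rewrite in_cons ?ar ?br orbT.
rewrite -Ex_indepM; first by apply: eq_Ex => s; rewrite big_cons.
move=> x; have [xr|/existsNP[a /not_implyP[ar na]]] :=
  pselect (forall a, a \in r -> indep x (F a)).
  by right=> s b; apply: eq_big_seq => a ar; exact: xr.
left; have ia : i != a by apply: contra ir => /eqP ->.
by have [|||//] := H i a x _ _ ia; rewrite ?mem_head // in_cons ar orbT.
Qed.

(* Density with respect to muT of the point mass at eta on the sites of D,
   times muT on the other sites. *)
Definition point_density (eta : conf) D s : R :=
  \prod_(x in D) ((s x == eta x)%:R / bern p (eta x)).

Lemma point_density_site eta (x : T) : Ex (fun s => (s x == eta x)%:R / bern p (eta x)) = 1.
Proof.
rewrite -(Ex_site p x) -[RHS](Ex_cst T p); apply: eq_Ex => s.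
have b0 b : bern p b != 0 by rewrite gt_eqF // bern_gt0.
rewrite siteE !ffunE eqxx; have := b0 true; have := b0 false.
case: (eta x) => /= b1 b2; rewrite ?(mul0r, mulr0, addr0, add0r) mul1r divff //.
Qed.

Lemma indep_point eta x y : x != y -> indep y (fun s : conf => (s x == eta x)%:R / bern p (eta x)).
Proof. by move=> xy s b; rewrite ffunE (negbTE xy). Qed.

Lemma point_density_supported eta D : supported D (point_density eta D).
Proof.
move=> y yD s b; apply: eq_bigr => x xD; rewrite indep_point //.
by apply: contraNneq yD => <-.
Qed.

Lemma Ex_point_density eta D : Ex (point_density eta D) = 1.
Proof.
rewrite /point_density.
under eq_Ex do rewrite -big_enum.
rewrite Ex_prod ?enum_uniq //; first by rewrite big1 // => x _; exact: point_density_site.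
move=> a b x _ _ ab; have [ax|ax] := eqVneq a x; last by left; exact: indep_point.
by right; apply: indep_point; rewrite -ax eq_sym.
Qed.

Lemma point_density_ge0 eta D s : 0 <= point_density eta D s.
Proof. by apply: prodr_ge0 => x _; rewrite divr_ge0 // ltW // bern_gt0. Qed.

Variables (k n : nat).
Hypotheses (sizeN : forall v, size (N v) = k) (levels : forall v, P v = (dp v <= n)%N).

Definition subtree (v : V) : {set T} := [set y : T | le v (val y)].

Lemma subtree_val x : subtree (val x) = x |: descs N le x.
Proof.
by apply/setP => y; rewrite !inE (tree_split tree) (inj_eq val_inj).
Qed.

Lemma subtree_closed v : desc_closed (subtree v).
Proof.
move=> x; rewrite inE => vx; apply/fintype.subsetP => y; rewrite !inE => /(below_le tree).
exact: (tree_trans tree vx).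
Qed.

Definition pt_evol eta D t := S t (point_density eta D).

Lemma pt_evol_ge0 eta D t s : 0 <= t -> 0 <= pt_evol eta D t s.
Proof. by move=> t0; apply: semigroup_ge0 => // z; exact: point_density_ge0. Qed.

Local Notation mn := (Num.min p (1 - p)).

Lemma nrm_site_ge0 f x : (forall s, 0 <= f s) -> mn * nrm f <= nrm (Es x f).
Proof.
move=> f0; rewrite /nrm -ExZ -(Ex_site p x); apply: Ex_le => // s.
rewrite !siteE; have := f0 (updT s x true); have := f0 (updT s x false).
move: (f _) (f _) => b a a0 b0; have q0 : 0 < 1 - p by rewrite subr_gt0.
have m1 : mn <= p by rewrite ge_min lexx.
have m2 : mn <= 1 - p by rewrite ge_min lexx orbT.
have h1 : mn * (p * b ^+ 2) <= p * (p * b ^+ 2).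
  by rewrite ler_wpM2r // mulr_ge0 ?sqr_ge0 ?(ltW p0).
have h2 : mn * ((1 - p) * a ^+ 2) <= (1 - p) * ((1 - p) * a ^+ 2).
  by rewrite ler_wpM2r // mulr_ge0 ?sqr_ge0 ?(ltW q0).
have h3 : 0 <= 2 * (p * b) * ((1 - p) * a) by rewrite !mulr_ge0 // ltW.
have -> : (p * b + (1 - p) * a) ^+ 2 = p * (p * b ^+ 2) + (1 - p) * ((1 - p) * a ^+ 2) + 2 * (p * b) * ((1 - p) * a) by ring.
have -> : p * (mn * b ^+ 2) + (1 - p) * (mn * a ^+ 2) = mn * (p * b ^+ 2) + mn * ((1 - p) * a ^+ 2) by ring.
lra.
Qed.

(** Averaging over [x] costs the factor [mn]. It commutes with the evolution and removes [x] from
    the initial density, which becomes a product over the subtrees of the children; these evolve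
    independently. *)
Lemma nrm_pt_evol_step eta x t : 0 <= t ->
  mn * nrm (pt_evol eta (subtree (val x)) t) <=
  \prod_(u <- N (val x)) nrm (pt_evol eta (subtree u) t).
Proof.
move=> t0; apply: le_trans (nrm_site_ge0 x (fun s => pt_evol_ge0 eta _ s t0)) _.
have kids_disj (u u' : V) y : u \in N (val x) -> u' \in N (val x) -> u != u' ->
    y \in subtree u -> y \notin subtree u'.
  move=> ux u'x uu'; rewrite !inE => uy; apply: contra uu' => u'y.
  by apply/eqP; exact: (tree_disj tree ux u'x uy u'y).
have E s : Es x (pt_evol eta (subtree (val x)) t) s = \prod_(u <- N (val x)) pt_evol eta (subtree u) t s.
  rewrite /pt_evol semigroup_site //; last first.
    by rewrite -subtree_val; exact: point_density_supported.
  rewrite -(semigroup_prod (D := subtree)) ?(tree_uniq tree) //; last 3 first.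
  - exact: subtree_closed.
  - by move=> u u' ux u'x uu' y; exact: kids_disj.
  - by move=> i; exact: point_density_supported.
  congr (semigroupT _ _ _ _ _ s); apply/funext => z.
  have xx : x \notin descs N le x by apply/negP => /(descs_dp tree); rewrite ltnn.
  rewrite (_ : point_density eta (subtree (val x)) = fun z => point_density eta (descs N le x) z * ((z x == eta x)%:R / bern p (eta x))); last first.
    by apply/funext => w; rewrite /point_density subtree_val big_setU1 //= mulrC.
  rewrite siteZ; last exact: point_density_supported.
  rewrite -(EA1 p) EA_const; last first.
    by move=> y; rewrite inE => yx; apply: indep_point; rewrite eq_sym.
  rewrite point_density_site mulr1 /point_density.
  have : forall r : seq V, uniq r -> {subset r <= N (val x)} ->
     \prod_(v <- r) \prod_(y in subtree v) ((z y == eta y)%:R / bern p (eta y)) =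
     \prod_(y : T | has (fun v : V => le v (val y)) r) ((z y == eta y)%:R / bern p (eta y)).
    elim=> [|u r IH] /=; first by rewrite big_nil big_pred0.
    move=> /andP[ur uni] sub; rewrite big_cons IH // => [|v vr]; last by apply: sub; rewrite in_cons vr orbT.
    rewrite [RHS](bigID (fun y : T => y \in subtree u)) /=; congr (_ * _); apply: eq_bigl => y.
      by rewrite !inE; case: (le u (val y)); rewrite ?andbF.
    rewrite !inE; case: (boolP (le u (val y))) => //= uy; rewrite ?andbT ?andbF //.
    apply/negbTE/hasPn => v vr; have := kids_disj u v y (sub u (mem_head _ _)) (sub v _) _ _.
    rewrite !inE vr orbT uy; apply => //.
    by apply: contra ur => /eqP ->.
  move=> /(_ _ (tree_uniq tree _) (fun v h => h)) ->.
  by apply: eq_bigl => y; rewrite inE.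
rewrite /nrm.
rewrite (@eq_Ex _ _ _ _ p _ (fun s => \prod_(u <- N (val x)) (pt_evol eta (subtree u) t s ^+ 2))); last first.
  by move=> s; rewrite E prodrXl.
rewrite Ex_prod ?(tree_uniq tree) //.
move=> u u' y ux u'x uu'; have [uy|uy] := boolP (y \in subtree u); last first.
  left; apply: (indep_comp (fun a : R => a ^+ 2)).
  by apply: (semigroup_supported _ (@subtree_closed u) _ uy); exact: point_density_supported.
right; apply: (indep_comp (fun a : R => a ^+ 2)).
apply: (semigroup_supported _ (@subtree_closed u') _ (kids_disj _ _ _ ux u'x uu' uy)).
exact: point_density_supported.
Qed.

Lemma mn_gt0 : 0 < mn.
Proof. by rewrite lt_min p0 subr_gt0. Qed.

Variable C : R.
Hypotheses (C0 : 0 < C) (gap : forall f, nrm f - Ex f ^+ 2 <= C * dirichlet p N j 0 f).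

(* Time in which the contraction of the variance compensates the factor
   2 ^ k / mn lost when passing from the subtrees of the children to that of
   their parent. *)
Definition level_time : R := 8 * C * 2 ^+ k / mn.

Lemma level_time_ge0 : 0 <= level_time.
Proof. by rewrite /level_time !mulr_ge0 ?invr_ge0 ?exprn_ge0 ?(ltW C0) ?(ltW mn_gt0). Qed.

(** [h] counts the levels of the subtree, which is empty for [h = 0]. The excess 1/16 over the norm
    of the constant 1 is the square of the threshold 1/4. *)
Lemma nrm_pt_evol eta h v t : (dp v + h = n.+1)%N -> h%:R * level_time <= t ->
  nrm (pt_evol eta (subtree v) t) <= 1 + 16^-1.
Proof.
elim: h v t => [|h IH] v t.
  rewrite addn0 mul0r => dv t0; have -> : subtree v = finset.set0.
    apply/setP => y; rewrite !inE; apply/negP => /(tree_dp_le tree).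
    by have := valP y; rewrite levels dv => dy; rewrite ltnNge dy.
  have -> : pt_evol eta finset.set0 t = fun=> 1.
    apply/funext => s; rewrite /pt_evol -[RHS](semigroup_cst 1 s t0).
    by congr (semigroupT _ _ _ _ _ s); apply/funext => z; rewrite /point_density big_set0.
  by rewrite /nrm (eq_Ex p (g := fun=> 1)) ?Ex_cst ?lerDl ?invr_ge0 // => s; rewrite expr1n.
move=> dv ht; have Pv : P v by rewrite levels; lia.
have t0 : 0 <= t - level_time.
  rewrite subr_ge0 (le_trans _ ht) // -natr1 mulrDl mul1r lerDr mulr_ge0 //.
  exact: level_time_ge0.
have Ht : h%:R * level_time <= t - level_time.
  by rewrite lerBrDr (le_trans _ ht) // -natr1 mulrDl mul1r.
pose x : T := Sub v Pv; have xv : val x = v by rewrite SubK.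
have := variance_decay (point_density eta (subtree v)) C0 gap t0 level_time_ge0.
rewrite subrK Ex_point_density expr1n -/(pt_evol eta (subtree v) t) -/(pt_evol eta (subtree v) (t - level_time)).
set A := nrm _; set B := nrm _ => AB.
have B2 : mn * B <= 2 ^+ k.
  have := nrm_pt_evol_step eta x t0; rewrite xv -/B => /le_trans; apply.
  apply: (@le_trans _ _ (\prod_(u <- N v) 2)).
    rewrite big_seq_cond [X in _ <= X]big_seq_cond; apply: ler_prod => u; rewrite andbT => uv.
    rewrite nrm_ge0 //= (le_trans (IH u _ _ Ht)) //.
      by rewrite (tree_dp tree uv) addSnnS.
    lra.
  by rewrite big_const_seq count_predT sizeN -Monoid.iteropE.
(* With z = 2^k / mn, the children's norms being at most 2 gives B <= z, while the exponent is y =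
   16 z; since e^y >= y, the product is at most z / (16 z). *)
have eB : expR (- (2 / C * level_time)) * (B - 1) <= 16^-1.
  set y := 2 / C * level_time.
  have yE : y = 16 * (2 ^+ k / mn).
    by rewrite /y /level_time; field; rewrite gt_eqF ?mn_gt0 //= gt_eqF.
  have z0 : 0 < 2 ^+ k / mn by rewrite divr_gt0 ?exprn_gt0 ?mn_gt0.
  have Bz : B <= 2 ^+ k / mn by rewrite ler_pdivlMr ?mn_gt0 // mulrC.
  have ey : y <= expR y by have := expR_ge1Dx y; lra.
  rewrite expRN mulrC ler_pdivrMr ?expR_gt0 //.
  have : 16 * (2 ^+ k / mn) <= expR y by rewrite -yE.
  lra.
lra.
Qed.

(** * Speed at which vacancies travel from the leaves *)

Section LowerBound.
Hypothesis j_range : (0 < j <= k)%N.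
Variable root : V.
Hypotheses (root_le : forall v, le root v) (root_dp : dp root = 0%N).

Let k0 : (0 < k)%N. Proof. by case/andP: j_range => /leq_trans; apply. Qed.

Lemma card_level v d :
  (#|[set x : T | le v (val x) && (dp (val x) == dp v + d)%N]| <= k ^ d)%N.
Proof.
elim: d v => [|d IH] v.
  rewrite expn0 addn0; apply/card_le1_eqP => x y; rewrite !inE.
  move=> /andP[vx /eqP dx] /andP[vy /eqP dy]; apply: val_inj.
  have ex z : le v z -> dp z = dp v -> z = v.
    by move=> vz dz; apply/esym/(tree_anc tree vz (tree_refl tree z)); rewrite dz.
  by rewrite (ex _ vx dx) (ex _ vy dy).
apply: (@leq_trans (\sum_(u <- N v) #|[set x : T | le u (val x) && (dp (val x) == dp u + d)%N]|)).
  under [X in (_ <= X)%N]eq_bigr do rewrite -sum1dep_card.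
  rewrite -sum1dep_card (exchange_big_dep xpredT) //= big_mkcond; apply: leq_sum => x _.
  case: ifP => // /andP[vx /eqP dx]; have : has (le^~ (val x)) (N v).
    move: vx; rewrite (tree_split tree) => /orP[/eqP E|//].
    by move: dx; rewrite E -[X in X = _]addn0 => /addnI.
  case/hasP => u uv ux; rewrite big_mkcond (big_rem u) //= ux dx (tree_dp tree uv).
  by rewrite addSnnS eqxx.
apply: (@leq_trans (\sum_(u <- N v) k ^ d)%N); first by rewrite big_seq_cond [X in (_ <= X)%N]big_seq_cond; apply: leq_sum => u _; exact: IH.
by rewrite big_const_seq count_predT sizeN iter_addn_0 expnS mulnC.
Qed.

Local Notation th := ((2 * k%:R)^-1 : R).

Let k2 : 0 < 2 * k%:R :> R. Proof. by rewrite mulr_gt0 // ltr0n. Qed.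

(* The weights decay fast enough for the generator to control the empty sites
   of each level by those of the next one. *)
Definition vacancies (s : conf) : R := \sum_(x : T) th ^+ dp (val x) * (~~ s x)%:R.

Lemma vacancies_ge0 s : 0 <= vacancies s.
Proof. by apply: sumr_ge0 => x _; rewrite mulr_ge0 // exprn_ge0 // invr_ge0 ltW. Qed.

(** Above depth [n], a facilitated vertex has an empty child inside the tree, whose weight is
    smaller by the factor 1 / (2k). At depth [n] there are at most k^n vertices of weight (2k)^(-n),
    which gives the source term. *)
Lemma generator_vacancies s : L vacancies s <= 2 * k%:R * vacancies s + 2^-1 ^+ n.
Proof.
have th0 : 0 <= th by rewrite invr_ge0 ltW.
have -> : L vacancies s = \sum_(x : T) th ^+ dp (val x) * (clr x s * ((1 - p) - (~~ s x)%:R)).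
  have -> : vacancies = fun s => \sum_(x : T) th ^+ dp (val x) * (~~ s x)%:R by [].
  rewrite (A_sum generator_lin); apply: eq_bigr => x _; congr (_ * _).
  rewrite generatorE (bigD1 x) //= big1 ?addr0; last first.
    by move=> y yx; rewrite site_indep ?subrr ?mulr0 // => z b; rewrite ffunE eq_sym (negbTE yx).
  by congr (_ * (_ - _)); rewrite siteE !ffunE eqxx /= mulr0 mulr1 add0r.
apply: (@le_trans _ _ (\sum_(x : T) th ^+ dp (val x) * clr x s)).
  apply: ler_sum => x _; rewrite ler_wpM2l ?exprn_ge0 //.
  apply: ler_piMr; first by rewrite /(clr _ _).
  have h : 0 <= (~~ s x)%:R :> R := ler0n _ _.
  by rewrite -addrA -opprD gerDl oppr_le0 addr_ge0 // ltW.
rewrite (bigID (fun x : T => dp (val x) == n)) /= addrC lerD //; last first.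
  apply: (@le_trans _ _ (\sum_(x : T | dp (val x) == n) th ^+ n)).
    apply: ler_sum => x /eqP ->; rewrite ler_piMr ?exprn_ge0 // /(clr _ _).
    by case: cleared.
  rewrite sumr_const -[X in X <= _]mulr_natl.
  apply: (@le_trans _ _ ((k ^ n)%:R * th ^+ n)).
    rewrite ler_wpM2r ?exprn_ge0 // ler_nat.
    have := card_level root n; rewrite root_dp add0n; apply: leq_trans.
    by apply: subset_leq_card; apply/fintype.subsetP => x; rewrite !inE unfold_in root_le.
  by rewrite natrX -exprMn invfM mulrCA mulfV ?mulr1 // pnatr_eq0 -lt0n.
rewrite /vacancies mulr_sumr.
apply: (@le_trans _ _ (\sum_(x : T) \sum_(y : T | val y \in N (val x)) th ^+ dp (val x) * (~~ s y)%:R)).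
  rewrite [X in _ <= X](bigID (fun x : T => dp (val x) == n)) /=.
  rewrite -[X in X <= _]add0r lerD //.
    by apply: sumr_ge0 => x _; apply: sumr_ge0 => y _; rewrite mulr_ge0 ?exprn_ge0.
  apply: ler_sum => x xn; rewrite -mulr_sumr ler_wpM2l ?exprn_ge0 //.
  rewrite /(clr _ _); have [cx|_] := boolP (cleared _ _ _ _ _); last by apply: sumr_ge0.
  have : has (fun v : V => ~~ ext0 s v) (N (val x)).
    by rewrite has_count; case/andP: j_range => j0 _; exact: leq_trans j0 cx.
  case/hasP => u ux; have Pu : P u.
    rewrite levels (tree_dp tree ux) ltn_neqAle xn.
    by have := valP x; rewrite levels.
  rewrite -(SubK T Pu) ext0_val => sy; rewrite (bigD1 (Sub u Pu)) /=; last by rewrite SubK.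
  by rewrite sy lerDl; apply: sumr_ge0.
rewrite (exchange_big_dep xpredT) //=; apply: ler_sum => y _.
have [x xy|no] := pickP (fun x : T => val y \in N (val x)); last first.
  by rewrite big_pred0 // mulr_ge0 ?(ltW k2) // mulr_ge0 ?exprn_ge0.
rewrite (big_pred1 x) => [|x']; last first.
  apply/idP/eqP => [xy'|->//]; apply/val_inj/(tree_anc tree (tree_kid tree xy') (tree_kid tree xy)).
  by apply/eqP; rewrite -eqSS -(tree_dp tree xy') -(tree_dp tree xy).
by rewrite (tree_dp tree xy) exprS !mulrA divff ?mul1r // gt_eqF.
Qed.

Definition full : conf := [ffun=> true].

Lemma semigroup_vacancies t : 0 <= t -> S t vacancies full <= expR (2 * k%:R * t) * 2^-1 ^+ n.
Proof.
move=> t0; set K := 2 * k%:R; set b := 2^-1 ^+ n.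
have b0 : 0 <= b by rewrite exprn_ge0 // invr_ge0.
(* The shift by b / K makes the differential inequality homogeneous. *)
have D v := derD (semigroup_der vacancies full v) (der_cst v (b / K)).
have H v : 0 <= v -> L (S v vacancies) full + 0 <= - (- K * (S v vacancies full + b / K)).
  move=> v0; rewrite addr0 -(expA_comm generator_lin) -semigroupE.
  apply: (le_trans (semigroup_mono full v0 generator_vacancies)).
  rewrite semigroup_lin // semigroup_cst // mulNr opprK mulrDr lerD2l.
  by rewrite mulrCA divff ?mulr1 // gt_eqF.
have := gronwall D H (lexx 0) t0; rewrite add0r semigroup0.
have -> : vacancies full = 0 by rewrite /vacancies big1 // => x _; rewrite ffunE mulr0.
rewrite add0r mulNr opprK => G.
have bK : b / K <= b.
  by rewrite ler_piMr // invf_le1 // /K -natrM ler1n muln_gt0.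
have bK0 : 0 <= b / K by rewrite divr_ge0 // ltW.
have := ler_wpM2l (expR_ge0 (K * t)) bK; lra.
Qed.

(* Information travels at bounded speed from the leaves, so that from the full
   configuration the top levels stay full for a time proportional to n. *)
Lemma semigroup_top_full (r : seq T) m t : 0 <= t -> (forall x, x \in r -> (dp (val x) <= m)%N) ->
  uniq r ->
  1 - (2 * k%:R) ^+ m * (expR (2 * k%:R * t) * 2^-1 ^+ n) <=
  S t (fun s => (all s r)%:R) full.
Proof.
move=> t0 rm ur; set c := (2 * k%:R) ^+ m.
have k1 : 1 <= 2 * k%:R :> R by rewrite -natrM ler1n muln_gt0.
have c0 : 0 < c by rewrite exprn_gt0.
(* One empty site at depth at most [m] contributes at least 1 / c to [vacancies]. *)
have H s : - c * vacancies s + 1 <= (all s r)%:R.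
  have [//|/allPn [x xr sx]] := boolP (all s r).
    by move=> _; rewrite gerDr mulNr oppr_le0 mulr_ge0 ?vacancies_ge0 // ltW.
  rewrite mulNr addrC subr_le0 /vacancies (bigD1 x) //= sx mulr1.
  rewrite mulrDr; apply: (@le_trans _ _ (c * th ^+ dp (val x))).
    by rewrite /c exprVn ler_pdivlMr ?exprn_gt0 // mul1r; apply: ler_weXn2l => //; exact: rm.
  rewrite lerDl mulr_ge0 ?(ltW c0) //; apply: sumr_ge0 => y _.
  by rewrite mulr_ge0 // exprn_ge0 // invr_ge0 ltW.
have := semigroup_mono full t0 H; rewrite semigroup_lin // semigroup_cst //.
have := ler_wpM2l (ltW c0) (semigroup_vacancies t0); rewrite mulNr; lra.
Qed.

(** The children of a deepest vertex lie outside the tree and are empty, so its constraint always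
    holds and it is resampled at rate 1. *)
Lemma semigroup_leaf x t s : dp (val x) = n -> 0 <= t ->
  S t (fun s => (s x)%:R) s = p + expR (- t) * ((s x)%:R - p).
Proof.
move=> dx t0; pose u t (s : conf) : R := p + expR (- 1 * t) * ((s x)%:R - p).
have clr1 z : clr x z = 1.
  rewrite /(clr _ _) /cleared (_ : count _ _ = k); first by case/andP: j_range => _ ->.
  rewrite -(sizeN (val x)) -[RHS]count_predT; apply: eq_in_count => v vx /=.
  by rewrite ext0_out // levels (tree_dp tree vx) dx ltnn.
have Hu t' z : is_derive t' 1 (u ^~ z) (L (u t') z).
  apply: is_derive_eq (derD (der_cst t' p) (derM (der_exp t' (-1)) (der_cst t' ((z x)%:R - p)))) _.
  rewrite generatorE (bigD1 x) //= big1 ?addr0; last first.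
    by move=> y yx; rewrite site_indep ?subrr ?mulr0 // => w b; rewrite /u ffunE eq_sym (negbTE yx).
  by rewrite clr1 siteE /u !ffunE eqxx /=; ring.
rewrite -(semigroup_unique Hu _ s t0); first by rewrite /u mulN1r.
by move=> z; rewrite /u mulr0 expR0 mul1r addrC subrK.
Qed.

End LowerBound.

Lemma Ex_dirac (z : conf) f : Ex (fun w => (w == z)%:R * f w) = muT p z * f z.
Proof.
rewrite /(Ex _) (bigD1 z) //= eqxx mul1r big1 ?addr0 // => w wz.
by rewrite (negbTE wz) mul0r mulr0.
Qed.

Lemma point_densityT (eta : conf) :
  point_density eta finset.setT = fun w => (muT p eta)^-1 * (w == eta)%:R.
Proof.
apply/funext => w; rewrite /point_density /muT.
rewrite (eq_bigl xpredT); last by move=> x; rewrite inE.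
rewrite prodf_div [RHS]mulrC; congr (_ / _).
have [->|/eqP wn] := eqVneq w eta; first by rewrite big1 // => x _; rewrite eqxx.
have [x wx] : exists x, w x != eta x.
  apply/not_existsP => H; apply: wn; apply/ffunP => x; apply/eqP/negPn/negP; exact: H.
by rewrite (bigD1 x) //= (negbTE wx) mul0r.
Qed.

(** Reversibility: as a function of the end point, the density of the law is the semigroup applied
    to the density of the initial point mass. *)
Lemma densityE t (eta s : conf) : 0 <= t ->
  densityT N j p t eta s = pt_evol eta finset.setT t s.
Proof.
move=> t0; have m0 (z : conf) : muT p z != 0 by rewrite gt_eqF // muT_gt0.
pose dl (z : conf) : conf -> R := fun w => (w == z)%:R.
have sym : muT p eta * S t (dl s) eta = muT p s * S t (dl eta) s.
  by rewrite -!Ex_dirac Ex_semigroup_sym; apply: eq_Ex => w; exact: mulrC.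
rewrite /pt_evol point_densityT.
rewrite (_ : (fun w => _) = fun w => (muT p eta)^-1 * dl eta w + 0); last first.
  by apply/funext => w; rewrite addr0.
rewrite semigroup_lin // semigroup_cst // addr0 /densityT /lawT -/(dl s).
by apply: (mulfI (m0 eta)); rewrite mulrA sym mulrC mulKf // mulVKf.
Qed.

Lemma distT1E t (eta : conf) : 0 <= t -> distT N j p 1 t eta = Ex (fun s => `|pt_evol eta finset.setT t s - 1|).
Proof.
move=> t0; rewrite /distT invr1 powRr1; last first.
  by apply: sumr_ge0 => s _; rewrite mulr_ge0 ?powR_ge0 ?ltW ?muT_gt0.
by apply: eq_bigr => s _; rewrite powRr1 // densityE.
Qed.

Lemma distT2E t (eta : conf) : 0 <= t -> distT N j p 2 t eta = Num.sqrt (nrm (fun s => pt_evol eta finset.setT t s - 1)).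
Proof.
move=> t0; rewrite /distT -powR12_sqrt ?nrm_ge0 //; congr (_ `^ _).
apply: eq_bigr => s _; congr (_ * _).
by rewrite powR_mulrn // real_normK ?num_real // densityE.
Qed.

Lemma test_le_dist1 g t (eta : conf) : 0 <= t -> (forall s, 0 <= g s <= 1) ->
  `|S t g eta - Ex g| <= distT N j p 1 t eta.
Proof.
move=> t0 g01; rewrite distT1E //.
have -> : S t g eta = Ex (fun s => pt_evol eta finset.setT t s * g s).
  rewrite /pt_evol -Ex_semigroup_sym.
  rewrite point_densityT; under eq_Ex do rewrite -mulrA.
  by rewrite ExZ Ex_dirac mulKf // gt_eqF // muT_gt0.
rewrite -ExB /(Ex _); apply: le_trans (ler_norm_sum _ _ _) _; apply: ler_sum => s _.
rewrite normrM (ger0_norm (muT_ge0 p0 p1 s)) ler_wpM2l ?muT_ge0 //.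
rewrite -[X in _ - X]mul1r -mulrBl normrM; have /andP[g0 g1] := g01 s.
by rewrite ler_piMr // ger0_norm.
Qed.

Lemma dist1_le_dist2 t (eta : conf) : 0 <= t -> distT N j p 1 t eta <= distT N j p 2 t eta.
Proof.
move=> t0; rewrite distT1E // distT2E //.
have E0 : 0 <= Ex (fun s => `|pt_evol eta finset.setT t s - 1|) by apply: Ex_ge0.
rewrite -[X in X <= _]ger0_norm // -sqrtr_sqr ler_wsqrtr //.
have := Ex_CS p0 p1 (fun s => `|pt_evol eta finset.setT t s - 1|) (fun=> 1).
rewrite (@eq_Ex _ _ _ _ p (fun s => _ * 1) (fun s => `|pt_evol eta finset.setT t s - 1|)); last by move=> s; rewrite mulr1.
rewrite (@eq_Ex _ _ _ _ p (fun s => 1 ^+ 2) (fun=> 1)) ?Ex_cst ?mulr1; last by move=> s; rewrite expr1n.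
move/le_trans; apply; rewrite le_eqVlt; apply/orP; left; apply/eqP; apply: eq_Ex => s.
by rewrite real_normK ?num_real.
Qed.

Lemma nrm_pt_evol_sub1 eta t : 0 <= t ->
  nrm (fun s => pt_evol eta finset.setT t s - 1) = nrm (pt_evol eta finset.setT t) - 1.
Proof.
move=> t0; rewrite /nrm (@eq_Ex _ _ _ _ p _ (fun s => pt_evol eta finset.setT t s ^+ 2 +
  ((-2) * pt_evol eta finset.setT t s + 1))); last by move=> s; ring.
rewrite !ExD ExZ Ex_cst /pt_evol Ex_semigroup // Ex_point_density; ring.
Qed.

End Dynamics.

(** * Mixing times on the tree of words *)

Section Words.
Variables (R : realType) (k j : nat) (p : R).
Hypotheses (jk : (0 < j <= k)%N) (p0 : 0 < p) (p1 : p < 1).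
Local Notation word := (seq 'I_k).

Lemma size_kids (s : word) : size (kids s) = k.
Proof. by rewrite size_map size_enum_ord. Qed.

(** The last move comes first in a word, so ancestors are suffixes. *)
Lemma words_tree : tree_order (@kids k) (@suffix 'I_k) size.
Proof.
split=> [s|||v u|v z|v z|v v' z].
- exact: suffix_refl.
- exact: suffix_trans.
- by move=> v; rewrite map_inj_uniq ?enum_uniq // => i i' [].
- by case/mapP => i _ ->.
- apply/idP/orP => [/suffixP [t ->]|].
    case/lastP: t => [|t i]; first by left.
    right; apply/hasP; exists (i :: v); first by apply: map_f; rewrite mem_enum.
    by apply/suffixP; exists t; rewrite cat_rcons.
  case=> [/eqP ->|/hasP[u /mapP[i _ ->]]]; first exact: suffix_refl.
  by apply: suffix_trans; exact: suffix_cons.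
- exact: size_suffix.
- by rewrite !suffixE => /eqP E1 /eqP E2 E; rewrite -E1 -E2 E.
Qed.

Variable n : nat.
Local Notation T := {bseq n of 'I_k}.
Local Notation conf := {ffun T -> bool}.

Let levels (v : word) : (size v <= n)%N = (size v <= n)%N. Proof. by []. Qed.

Let i0 : 'I_k. Proof. by apply: Ordinal; case/andP: jk; exact: leq_trans. Defined.

Definition left_word (i : nat) : T := insubd [bseq] (nseq i i0).

Lemma val_left_word i : (i <= n)%N -> val (left_word i) = nseq i i0.
Proof. by move=> iN; rewrite /left_word val_insubd size_nseq iN. Qed.

(** A single deepest vertex relaxes as e^(-t) from a value [b] at distance at least 1/2 from [p].
    This bound, uniform in [n], settles small [n] in [dist_lower] and turns its additive constants
    into multiples of [t]. *)
Lemma dist_ge_half t : 0 <= t ->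
  (forall eta : conf, distT (@kids k) j p 1 t eta <= 4^-1) -> 2^-1 <= t.
Proof.
move=> t0 H; pose x := left_word n; pose b := p <= 2^-1.
have := H [ffun=> b]; have g01 (s : conf) : 0 <= ((s x)%:R : R) <= 1 by case: (s x); rewrite lexx ler01.
have dx : size (val x) = n by rewrite val_left_word // size_nseq.
have := test_le_dist1 p0 p1 j words_tree [ffun=> b] t0 g01.
rewrite (semigroup_leaf p0 p1 words_tree size_kids levels jk _ dx t0) Ex_occupied ffunE addrAC subrr add0r.
have e0 := expR_gt0 (- t); rewrite normrM ger0_norm ?(ltW e0) //.
have : 2^-1 <= `|b%:R - p|.
  rewrite /b; have [hp|] := boolP (p <= 2^-1); first by rewrite (_ : true%:R = 1 :> R) // ger0_norm; lra.
  by rewrite -ltNge => hp; rewrite (_ : false%:R = 0 :> R) // sub0r normrN ger0_norm; lra.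
move=> h1 h2 h3; have := expR_ge1Dx (- t).
have : expR (- t) * 2^-1 <= 4^-1.
  by apply: le_trans h3; apply: le_trans h2; rewrite ler_pM2l.
lra.
Qed.

(** The test event is that the first [M] vertices of one branch are occupied. It has probability at
    most 1/4 at equilibrium and close to 1 from the full configuration, as long as few vacancies
    have reached these levels. *)
Lemma dist_lower M t : p ^+ M <= 4^-1 -> 0 <= t ->
  (forall eta : conf, distT (@kids k) j p 1 t eta <= 4^-1) ->
  n.+1%:R <= (4 * k%:R + 8 * k%:R * M%:R + 6) * t.
Proof.
move=> pM t0 H; have t2 := dist_ge_half t0 H.
have k1 : 1 <= (k%:R : R) by rewrite ler1n; case/andP: jk; exact: leq_trans.
have M0 : 0 <= (M%:R : R) by [].
have [nM|Mn] := leqP n.+1 M.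
  have : n.+1%:R <= (M%:R : R) by rewrite ler_nat.
  have h : M%:R <= 8 * k%:R * M%:R * t.
    have : 1 <= 8 * k%:R * t by nra.
    by move=> h; rewrite mulrAC ler_peMl.
  have : 0 <= (4 * k%:R + 6) * t by rewrite mulr_ge0 // addr_ge0 // mulr_ge0.
  nra.
pose r := [seq left_word i | i <- iota 0 M].
have vl i : i \in iota 0 M -> val (left_word i) = nseq i i0.
  by rewrite mem_iota add0n /= => iM; rewrite val_left_word // -ltnS (leq_trans iM) // ltnW.
have ur : uniq r.
  rewrite map_inj_in_uniq ?iota_uniq // => a b aM bM /(congr1 val).
  by rewrite !vl // => /(congr1 size); rewrite !size_nseq.
have rM x : x \in r -> (size (val x) <= M)%N.
  by case/mapP => i iM ->; rewrite vl // size_nseq; move: iM; rewrite mem_iota add0n => /ltnW.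
have g01 (s : conf) : 0 <= ((all s r)%:R : R) <= 1 by case: all; rewrite lexx ler01.
have ExA : Ex p (fun s : conf => (all s r)%:R) = p ^+ M.
  rewrite (@eq_Ex _ _ _ _ p _ (fun s : conf => \prod_(x <- r) (s x)%:R)); last first.
    by move=> s; elim: (r) => [|x l IH]; rewrite ?big_nil //= big_cons -IH; case: (s x); rewrite ?mul1r ?mul0r.
  rewrite Ex_prod //; last first.
    move=> x y z xr yr xy; have [xz|xz] := eqVneq x z.
      by right=> s b; rewrite ffunE -xz eq_sym (negbTE xy).
    by left=> s b; rewrite ffunE (negbTE xz).
  by under eq_bigr do rewrite Ex_occupied; rewrite big_const_seq count_predT size_map size_iota -Monoid.iteropE.
have := le_trans (test_le_dist1 p0 p1 j words_tree (full T) t0 g01) (H _).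
have := @semigroup_top_full _ _ _ T p p0 p1 _ j _ _ words_tree k n size_kids levels jk [::] (fun v => suffix0s v) erefl r M t t0 rM ur.
rewrite ExA; set A := semigroupT _ _ _ _ _ _.
set y := _ * (_ * _) => h1 h2; have {h1 h2} yh : 2^-1 <= y.
  have := ler_norm (A - p ^+ M); lra.
set K : R := 2 * k%:R in y yh.
have K0 : 0 < K by rewrite /K; lra.
have eK : K <= expR K by have := expR_ge1Dx K; lra.
have eM : K ^+ M <= expR (M%:R * K).
  by rewrite expRM_natl; apply: lerXn2r; rewrite ?nnegrE ?expR_ge0 ?(ltW K0).
have e2 : (expR (2^-1) : R) <= 2.
  have := @expR_ge1Dx R (- 2^-1); rewrite expRN => h.
  have : 2^-1 <= (expR (2^-1))^-1 :> R by lra.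
  by rewrite lef_pV2 ?posrE ?expR_gt0.
have en : expR (n%:R * 2^-1) * 2^-1 ^+ n <= 1 :> R.
  rewrite expRM_natl exprVn ler_pdivrMr ?exprn_gt0 // mul1r.
  by apply: lerXn2r; rewrite ?nnegrE ?expR_ge0.
(* Everything is compared with exponentials: e^(n/2) <= 2^n, e^(-1) <= 1/2 and K^M <= e^(M K). *)
have : expR (n%:R * 2^-1 - 1) <= expR (M%:R * K + K * t).
  rewrite !expRD -(ler_pM2r (_ : 0 < 2^-1 ^+ n :> R)) ?exprn_gt0 ?invr_gt0 //.
  apply: (@le_trans _ _ (2^-1)).
    rewrite mulrAC; apply: (@le_trans _ _ (expR (-1))); first by rewrite ler_piMl ?expR_ge0.
    have := @expR_ge1Dx R 1; rewrite expRN => h.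
    by rewrite lef_pV2 ?posrE ?expR_gt0 //; lra.
  apply: (le_trans yh); rewrite /y mulrA ler_wpM2r ?exprn_ge0 ?invr_ge0 //.
  by rewrite ler_wpM2r ?expR_ge0.
rewrite ler_expR => hn; rewrite -natr1.
(* Hence n + 1 <= 4kM + 4kt + 3, and 1 <= 2t turns 4kM and 3 into 8kMt and 6t. *)
have : n%:R <= 2 * M%:R * K + 2 * K * t + 2 by lra.
rewrite /K => h.
have : M%:R * k%:R * 4 <= M%:R * k%:R * 4 * (2 * t).
  by rewrite ler_peMr; [lra|rewrite !mulr_ge0|lra].
have -> : (4 * k%:R + 8 * k%:R * M%:R + 6) * t = 4 * (k%:R * t) + M%:R * k%:R * 4 * (2 * t) + 6 * t by ring.
lra.
Qed.

Lemma mixing_time_lower M : p ^+ M <= 4^-1 ->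
  (((4 * k%:R + 8 * k%:R * M%:R + 6)^-1 * n.+1%:R)%:E <= mixing_time (@kids k) j p T 1)%E.
Proof.
move=> pM; apply/ereal_infP => _ [t [t0 Ht] <-]; rewrite lee_fin.
have k1 : 0 <= (k%:R : R) by [].
have c0 : 0 < 4 * k%:R + 8 * k%:R * M%:R + 6 :> R.
  by rewrite ltr_wpDl // addr_ge0 ?mulr_ge0.
rewrite mulrC ler_pdivrMr // mulrC; apply: dist_lower => // eta.
by apply: le_trans Ht; exact: le_bigmax.
Qed.

Lemma mixing_time_12 :
  (mixing_time (@kids k) j p T 1 <= mixing_time (@kids k) j p T 2)%E.
Proof.
apply: ereal_inf_le_tmp => _ [t [t0 Ht] <-].
exists t; last reflexivity.
split; first exact: t0.
apply: bigmax_le => [|eta _]; first by rewrite invr_ge0.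
apply: le_trans (dist1_le_dist2 p0 p1 j words_tree eta t0) _.
by apply: le_trans Ht; exact: le_bigmax.
Qed.

Lemma mixing_time_upper (C : R) : 0 < C ->
  (forall f : conf -> R, nrm p f - Ex p f ^+ 2 <= C * dirichlet p (@kids k) j 0 f) ->
  (mixing_time (@kids k) j p T 2 <= (level_time p k C * n.+1%:R)%:E)%E.
Proof.
move=> C0 gap; apply: ereal_inf_lbound; exists (level_time p k C * n.+1%:R) => //.
have lt0 : 0 <= level_time p k C * n.+1%:R by rewrite mulr_ge0 // level_time_ge0.
split=> //; apply: bigmax_le => [|eta _]; first by rewrite invr_ge0.
rewrite (distT2E p0 p1 j words_tree) // (nrm_pt_evol_sub1 p0 p1 j words_tree) //.
have -> : 4^-1 = Num.sqrt (16^-1) :> R.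
  by rewrite -[LHS]ger0_norm ?invr_ge0 // -sqrtr_sqr; congr Num.sqrt; rewrite exprVn -natrX.
rewrite ler_wsqrtr // lerBlDl.
have := @nrm_pt_evol _ _ _ T p p0 p1 _ j _ _ words_tree k n size_kids levels C C0 gap eta n.+1 [::] (level_time p k C * n.+1%:R) erefl.
rewrite mulrC => /(_ (lexx _)).
suff -> : subtree T (@suffix 'I_k) [::] = finset.setT by [].
by apply/setP => y; rewrite !inE suffix0s.
Qed.

End Words.

(** * Subcriticality below the critical density *)

Section BinomialFixedPoint.
Local Open Scope classical_set_scope.
Local Open Scope ring_scope.
Variable R : realType.
Implicit Types (a u v w : R) (k m i : nat).

Definition bin_pmf a k i : R := a ^+ i * (1 - a) ^+ (k - i) *+ 'C(k, i).

Lemma bin_pmf_rec a k i :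
  bin_pmf a k.+1 i.+1 = a * bin_pmf a k i + (1 - a) * bin_pmf a k i.+1.
Proof.
rewrite /bin_pmf binS subSS mulrnDr exprS addrC; congr (_ + _).
  by rewrite -mulrA mulrnAr.
have [ik|ki] := ltnP i k; last by rewrite bin_small ?ltnS // !mulr0n mulr0.
rewrite -[(k - i)%N]prednK ?subn_gt0 // -subnS exprS mulrnAr; congr (_ *+ _).
ring.
Qed.

Lemma bin_pmf0 a k : bin_pmf a k 0 = (1 - a) ^+ k.
Proof. by rewrite /bin_pmf bin0 mulr1n expr0 mul1r subn0. Qed.

Lemma bin_pmf_big a k i : (k < i)%N -> bin_pmf a k i = 0.
Proof. by move=> ki; rewrite /bin_pmf bin_small // mulr0n. Qed.

Lemma tail_pmf a k m : tail a k m - tail a k m.+1 = bin_pmf a k m.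
Proof.
elim: k m => [|k IH] [|m]; rewrite ?tail_rec.
- by rewrite /tail /= subr0 bin_pmf0 expr0.
- by rewrite /tail /= subrr bin_pmf_big.
- rewrite bin_pmf0 exprS -bin_pmf0 -IH /tail !tails0; ring.
- rewrite bin_pmf_rec -!IH; ring.
Qed.

Lemma tail_big a k m : (k < m)%N -> tail a k m = 0.
Proof.
elim: k m => [|k IH] [|m] //; rewrite ltnS => km.
by rewrite tail_rec !IH ?mulr0 ?addr0 // ltnW.
Qed.

Lemma tail_sum a k m : tail a k m = \sum_(m <= i < k.+1) bin_pmf a k i.
Proof.
have [km|mk] := ltnP k m; first by rewrite tail_big // big_geq.
under eq_bigr do rewrite -tail_pmf -opprB.
by rewrite sumrN (telescope_sumr _ (leqW mk)) (tail_big a (ltnSn k)) sub0r opprK.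
Qed.

(** Each of the k + 1 trials is decisive exactly when [m] of the other [k] succeed. *)
Lemma tail_der k m a :
  is_derive a 1 (fun a => tail a k.+1 m.+1) (k.+1%:R * bin_pmf a k m).
Proof.
have id_der : is_derive a 1 (fun a : R => a) 1 by exact: is_derive_id.
have id_derN : is_derive a 1 (fun a : R => 1 - a) (-1).
  rewrite (_ : (fun a : R => 1 - a) = fun a => 1 + (-1) * a); last first.
    by apply/funext => b; rewrite mulN1r.
  by apply: is_derive_eq (derD (der_cst a 1) (derZ (-1) id_der)) _; rewrite add0r mulr1.
elim: k m => [|k IH] m.
  have T0 b : tail b 0 m = tail a 0 m by case: (m).
  rewrite (_ : (fun a => _) = fun b => b * tail a 0 m + (1 - b) * 0); last first.
    by apply/funext => b; rewrite tail_rec T0.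
  apply: is_derive_eq (derD (derM id_der (der_cst a (tail a 0 m))) (derM id_derN (der_cst a 0))) _.
  rewrite !mulr0 !addr0 -tail_pmf {3}/tail /= subr0; ring.
rewrite (_ : (fun a => _) = fun a => a * tail a k.+1 m + (1 - a) * tail a k.+1 m.+1); last by apply/funext.
(* For m = 0 the tail is constantly 1; the conditional lets one computation cover this case and the
   induction hypothesis. *)
have [dT dTE] : exists d, is_derive a 1 (fun a => tail a k.+1 m) d /\ a * d = k.+1%:R * (a * (if m is m'.+1 then bin_pmf a k m' else 0)).
  case: m => [|m].
    exists 0; split; last by rewrite !mulr0.
    rewrite (_ : (fun a => _) = fun=> 1); first exact: der_cst.
    by apply/funext => b; rewrite /tail tails0.
  by exists (k.+1%:R * bin_pmf a k m); split; [exact: IH|ring].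
case: dTE => H1 H2.
apply: is_derive_eq (derD (derM id_der H1) (derM id_derN (IH m))) _.
have E : bin_pmf a k.+1 m = a * (if m is m'.+1 then bin_pmf a k m' else 0) + (1 - a) * bin_pmf a k m.
  by case: (m) => [|m']; rewrite ?bin_pmf_rec // !bin_pmf0 exprS mulr0 add0r.
have -> : k.+2%:R * bin_pmf a k.+1 m = k.+1%:R * bin_pmf a k.+1 m + (tail a k.+1 m - tail a k.+1 m.+1).
  by rewrite tail_pmf -[k.+2%:R]natr1 mulrDl mul1r.
by rewrite H2 E; ring.
Qed.

Lemma tail_mono u w k m : 0 <= u -> u <= w -> w <= 1 -> tail u k m <= tail w k m.
Proof.
move=> u0 uw w1; rewrite !(tail_map _ _ (size_iota 0 k)).
exact: tails_le.
Qed.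

Lemma pmf_gt0 w k m : 0 < w < 1 -> (m <= k)%N -> 0 < bin_pmf w k m.
Proof.
move=> /andP[w0 w1] mk; rewrite /bin_pmf pmulrn_lgt0 ?bin_gt0 //.
by rewrite mulr_gt0 // exprn_gt0 // subr_gt0.
Qed.

(* The ratio m P(Bin = m) / P(Bin >= m), which is the logarithmic derivative of
   the tail with respect to log v, decreases with v. *)
Lemma tail_ratio_decr v w k m : 0 < v -> v <= w -> w < 1 -> (m <= k)%N ->
  tail w k m <= m%:R * bin_pmf w k m -> tail v k m <= m%:R * bin_pmf v k m.
Proof.
move=> v0 vw w1 mk Hw; have w0 := lt_le_trans v0 vw; have v1 := le_lt_trans vw w1.
(* Termwise in i = m + d, this is the comparison of the odds v / (1 - v) and w / (1 - w) raised to
   the power d. *)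
have cross : tail v k m * bin_pmf w k m <= tail w k m * bin_pmf v k m.
  rewrite !tail_sum !mulr_suml big_seq_cond [X in _ <= X]big_seq_cond.
  apply: ler_sum => i; rewrite andbT mem_index_iota ltnS => /andP[mi ik].
  rewrite /bin_pmf !mulrnAl !mulrnAr lerMn2r; apply/orP; right.
  rewrite lerMn2r; apply/orP; right.
  have [d iE] : exists d, i = (m + d)%N by exists (i - m)%N; rewrite subnKC.
  have [c kE] : exists c, k = (m + d + c)%N by exists (k - i)%N; rewrite -iE subnKC.
  have -> : (k - i = c)%N by lia.
  have -> : (k - m = c + d)%N by lia.
  rewrite iE !exprD.
  have H : (v * (1 - w)) ^+ d <= (w * (1 - v)) ^+ d.
    apply: lerXn2r; last nra.
      by rewrite nnegrE mulr_ge0 ?subr_ge0 ?(ltW v0) ?(ltW w1).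
    by rewrite nnegrE mulr_ge0 ?subr_ge0 ?(ltW w0) ?(ltW v1).
  rewrite !exprMn in H.
  have Z0 : 0 <= v ^+ m * w ^+ m * (1 - v) ^+ c * (1 - w) ^+ c.
    by rewrite !mulr_ge0 // exprn_ge0 ?subr_ge0 // ltW.
  have := ler_wpM2l Z0 H.
  rewrite [X in X <= _ -> _](_ : _ = v ^+ m * v ^+ d * (1 - v) ^+ c * (w ^+ m * ((1 - w) ^+ c * (1 - w) ^+ d))); last by ring.
  rewrite [X in _ <= X -> _](_ : _ = w ^+ m * w ^+ d * (1 - w) ^+ c * (v ^+ m * ((1 - v) ^+ c * (1 - v) ^+ d))); last by ring.
  by [].
have bw := pmf_gt0 (introT andP (conj w0 w1)) mk.
have bv := pmf_gt0 (introT andP (conj v0 v1)) mk.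
rewrite -(ler_pM2r bw) (le_trans cross) // mulrAC.
by rewrite ler_wpM2r ?(ltW bv).
Qed.

Lemma mul_pmf_diag v k m :
  v * (k.+1%:R * bin_pmf v k m) = m.+1%:R * bin_pmf v k.+1 m.+1.
Proof.
have pmfE n i : bin_pmf v n i = 'C(n, i)%:R * (v ^+ i * (1 - v) ^+ (n - i)).
  by rewrite /bin_pmf mulr_natl.
rewrite !pmfE subSS exprS.
have E : k.+1%:R * 'C(k, m)%:R = m.+1%:R * 'C(k.+1, m.+1)%:R :> R.
  by rewrite -!natrM -(mul_bin_diag k.+1 m).
set x := v ^+ m; set y := (1 - v) ^+ _.
transitivity (k.+1%:R * 'C(k, m)%:R * (v * x * y)); first by ring.
by rewrite E; ring.
Qed.

(* At a nonzero fixed point w of p tail the slope is < 1, since otherwise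
   tail v / v would be nondecreasing on ]0, w]. *)
Lemma slope_lt1 (p p2 u w : R) k m : 0 < u -> u <= w -> w < 1 -> 0 < p2 -> p2 < p ->
  (m <= k)%N -> u < p2 * tail u k.+1 m.+1 -> p * tail w k.+1 m.+1 = w ->
  p * (k.+1%:R * bin_pmf w k m) < 1.
Proof.
move=> u0 uw w1 p20 pp mk Hu Hw; rewrite ltNge; apply/negP => H1.
have w0 := lt_le_trans u0 uw; have p0 := lt_trans p20 pp.
(* A slope at least 1 at the fixed point means tail w <= w tail' w, which [tail_ratio_decr] carries
   down to all smaller arguments. *)
have Hr : tail w k.+1 m.+1 <= m.+1%:R * bin_pmf w k.+1 m.+1.
  rewrite -mul_pmf_diag -(ler_pM2l p0) Hw mulrCA.
  by rewrite ler_peMr // ltW.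
have mono : tail u k.+1 m.+1 / u <= tail w k.+1 m.+1 / w.
  have D (x : R) : 0 < x -> is_derive x 1 (fun x => tail x k.+1 m.+1 / x)
     ((x * (k.+1%:R * bin_pmf x k m) - tail x k.+1 m.+1) / x ^+ 2).
    move=> x0; have xn : x != 0 by rewrite gt_eqF.
    have DV : is_derive x 1 (fun x : R => x^-1) (- x ^- 2).
      have dv : derivable (fun y : R => (id y)^-1) x 1 by apply: derivableV.
      apply: DeriveDef; first exact: dv.
      have di : derivable (id : R -> R) x 1 by apply: derivable_id.
      have -> := @deriveV R R id x 1 xn di.
      by rewrite derive_id scaler1.
    apply: is_derive_eq (derM (tail_der k m x) DV) _.
    by field.
  apply: (@ger0_derive1_ndecr _ (fun x => tail x k.+1 m.+1 / x) u w) => //.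
  - move=> x; rewrite in_itv /= => /andP[ux _].
    by have [] := D x (lt_trans u0 ux).
  - move=> x; rewrite in_itv /= => /andP[ux xw]; have x0 := lt_trans u0 ux.
    rewrite derive1E; have [_ ->] := D x x0.
    rewrite divr_ge0 ?exprn_ge0 ?(ltW x0) // subr_ge0 mul_pmf_diag.
    exact: tail_ratio_decr (ltW xw) w1 _ Hr.
  - apply: derivable_within_continuous => x; rewrite in_itv /= => /andP[ux _].
    by have [] := D x (lt_le_trans u0 ux).
have h1 : 1 < p2 * (tail u k.+1 m.+1 / u) by rewrite mulrA ltr_pdivlMr // mul1r.
have h2 : p * (tail w k.+1 m.+1 / w) = 1 by rewrite mulrA Hw divff // gt_eqF.
have h3 : 0 <= tail w k.+1 m.+1 / w.
  by rewrite divr_ge0 ?(ltW w0) // -(pmulr_rge0 _ p0) Hw ltW.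
nra.
Qed.

Lemma tail_continuous k m : continuous (fun a : R => tail a k m).
Proof.
case: k m => [|k] [|m] a; try by under eq_fun do rewrite /tail tails0; exact: cvg_cst.
  exact: cvg_cst.
apply: differentiable_continuous; apply/derivable1_diffP.
by have [] := tail_der k m a.
Qed.

(** By monotonicity of the tail, the iterates decrease from [p] and stay above [u]; continuity makes
    their limit a fixed point. *)
Lemma lamb_cvg (p u : R) k m : 0 < u -> u <= p -> p <= 1 -> u <= p * tail u k m ->
  exists w, [/\ u <= w, w <= p, p * tail w k m = w & lamb p k m n @[n --> \oo] --> w].
Proof.
move=> u0 up p1 Hu; have p0 := lt_le_trans u0 up.
have p01 : 0 <= p <= 1 by rewrite p1 ltW.
have l01 n := andP (lamb01 k m n p01).
have lu n : u <= lamb p k m n.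
  elim: n => [//|n IH] /=; apply: le_trans Hu _; rewrite ler_pM2l //.
  by apply: tail_mono => //; [exact: ltW|case: (l01 n)].
have decr n : lamb p k m n.+1 <= lamb p k m n.
  elim: n => [|n IH] /=; first by have /andP[_ h] := tail01 k m p01; rewrite ger_pMr.
  rewrite ler_pM2l //; apply: tail_mono => //; first by case: (l01 n.+1).
  by case: (l01 n).
have ni : nonincreasing_seq (lamb p k m) by apply/nonincreasing_seqP.
have cv : cvgn (lamb p k m).
  by apply: nonincreasing_is_cvgn => //; exists u => _ [n _ <-].
exists (limn (lamb p k m)); split.
- by apply: limr_ge => //; apply: nearW.
- by apply: limr_le => //; apply: nearW => n; elim: n => // n; exact: le_trans.
- have c1 : lamb p k m n.+1 @[n --> \oo] --> p * tail (limn (lamb p k m)) k m.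
    apply: cvgM; first exact: cvg_cst.
    exact: (cvg_comp _ _ cv (@tail_continuous k m _)).
  have c2 : lamb p k m n.+1 @[n --> \oo] --> limn (lamb p k m) by rewrite cvg_shiftS.
  exact: (cvg_unique _ c1 c2).
- exact: cv.
Qed.

Lemma contraction_cvg0 (x rho y : nat -> R) (r : R) : r < 1 ->
  (forall n, 0 <= x n) -> (forall n, x n.+1 <= rho n * x n + y n) ->
  rho n @[n --> \oo] --> r -> y n @[n --> \oo] --> 0 -> x n @[n --> \oo] --> 0.
Proof.
(* A ratio strictly between [r] and 1; the maximum with 0 keeps its powers nonnegative when [r] is
   negative. *)
move=> r1 x0 xr rr y0; pose s := Num.max 0 ((r + 1) / 2).
have s0 : 0 <= s by rewrite /s le_max lexx.
have s1 : s < 1 by rewrite /s gt_max ltr01 /= ltr_pdivrMr //; lra.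
have rs : r < s by rewrite /s lt_max; apply/orP; right; rewrite ltr_pdivlMr //; lra.
apply/cvgrPdist_le => e e0.
have s10 : 0 < 1 - s by rewrite subr_gt0.
have /cvgrPdist_le/(_ (e / 2 * (1 - s))) := y0.
have /cvgr_lt/(_ s rs) := rr.
move=> [n1 _ H1] [|n2 _ H2]; first by rewrite mulr_gt0 // divr_gt0.
pose n0 := maxn n1 n2.
(* Once y n <= (1 - s) e / 2, the excess of [x] over e / 2 contracts by [s]. *)
have st n : (n0 <= n)%N -> x n.+1 - e / 2 <= s * (x n - e / 2).
  rewrite geq_max => /andP[/H1 /= h1 /H2 /=]; rewrite sub0r normrN => h2.
  have h3 : y n <= e / 2 * (1 - s) by apply: le_trans h2; exact: ler_norm.
  have h4 : rho n * x n <= s * x n by rewrite ler_wpM2r // ltW.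
  have := xr n; nra.
pose c := Num.max 0 (x n0 - e / 2).
have c0 : 0 <= c by rewrite /c le_max lexx.
have it i : x (n0 + i)%N - e / 2 <= s ^+ i * c.
  elim: i => [|i IH]; first by rewrite addn0 mul1r /c le_max lexx orbT.
  rewrite addnS exprS -mulrA; apply: le_trans (st _ (leq_addr _ _)) _.
  by rewrite ler_wpM2l.
have s1' : `|s| < 1 by rewrite ger0_norm.
have gc : s ^+ i * c @[i --> \oo] --> 0.
  by rewrite -[X in _ --> X](mul0r c); apply: cvgM; [exact: cvg_expr|exact: cvg_cst].
have /cvgrPdist_le/(_ (e / 2)) := gc.
move=> [|n3 _ H3]; first by rewrite divr_gt0.
exists (n0 + n3)%N => // n /= hn; rewrite sub0r normrN ger0_norm //.
have nn : (n0 <= n)%N := leq_trans (leq_addr _ _) hn.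
have nE : n = (n0 + (n - n0))%N by rewrite subnKC.
have := it (n - n0)%N; rewrite -nE => h.
have := H3 (n - n0)%N; rewrite /= sub0r normrN ger0_norm ?mulr_ge0 ?exprn_ge0 // => h3.
have n3n : (n3 <= n - n0)%N by rewrite -(leq_add2l n0) subnKC.
have {}h3 := h3 n3n; lra.
Qed.

End BinomialFixedPoint.

(** * Moments of the number of pivotal vertices *)

Section Pivotal.
Variables (R : realType) (V : choiceType) (P : pred V) (T : subFinType P).
Variable p : R.
Hypotheses (p0 : 0 < p) (p1 : p < 1).
Variables (N : V -> seq V) (j k : nat) (le : rel V) (dp : V -> nat).
Hypothesis tree : tree_order N le dp.
Hypotheses (sizeN : forall v, size (N v) = k) (jk : (0 < j <= k)%N).
Local Notation conf := {ffun T -> bool}.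
Local Notation m := (k.+1 - j)%N.
Local Notation Ex := (@Ex R V P T p).

Fixpoint level n (v : V) : seq V :=
  if n is n'.+1 then flatten [seq level n' u | u <- N v] else [:: v].

Lemma level_spec n v x : x \in level n v -> le v x /\ dp x = (dp v + n)%N.
Proof.
elim: n v => [|n IH] v /=.
  by rewrite inE => /eqP ->; split; [exact: (tree_refl tree)|rewrite addn0].
case/flatten_mapP => u uv /IH [ux ->]; split.
  exact: (tree_trans tree (tree_kid tree uv) ux).
by rewrite (tree_dp tree uv) addSnnS.
Qed.

Definition pivot n x v (w : V -> bool) : bool :=
  blk N j n (upd w x true) v && ~~ blk N j n (upd w x false) v.

Definition pivots n v w : R := \sum_(x <- level n v) (pivot n x v w)%:R.

Lemma pivots_ge0 n v w : 0 <= pivots n v w.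
Proof. by apply: sumr_ge0. Qed.

Definition others n v u w := count (blk N j n w) (rem u (N v)).

(** An occupied [v] stays blocked when at least [m] children are blocked, so the child [u] above [x]
    decides only if exactly m - 1 of its siblings are blocked. *)
Lemma pivotS n x v u w : u \in N v -> le u x ->
  pivot n.+1 x v w -> [&& w v, others n v u w == m.-1 & pivot n x u w].
Proof.
clear p0 p1; move=> uv ux; have dx := tree_dp_le tree ux.
have vx : v != x.
  by apply/negP => /eqP E; move: dx; rewrite -E (tree_dp tree uv) ltnn.
have cE b : count (blk N j n (upd w x b)) (N v) =
    (blk N j n (upd w x b) u + others n v u w)%N.
  rewrite (permP (perm_to_rem uv)) /=; congr (_ + _)%N.
  apply: eq_in_count => u' u'v; rewrite (blk_upd _ tree) //.
  have [u'u u'N] : u' != u /\ u' \in N v.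
    by move: u'v; rewrite (rem_filter _ (tree_uniq tree v)) mem_filter => /andP[].
  by apply: contra u'u => u'x; apply/eqP; exact: (tree_disj tree u'N uv u'x ux).
rewrite /pivot !blkS !(clearedN _ _ (sizeN v)) // !cE /upd (negbTE vx) -/(upd w x true) -/(upd w x false).
case: (w v) => //=; case: (blk N j n (upd w x true) u); case: (blk N j n (upd w x false) u);
  rewrite ?add0n ?add1n /=; case/andP: jk => j0 jk'; lia.
Qed.

Lemma pivotsS n v w : pivots n.+1 v w <=
  (w v)%:R * \sum_(u <- N v) (others n v u w == m.-1)%:R * pivots n u w.
Proof.
rewrite /pivots /= big_flatten /= big_map mulr_sumr big_seq [X in _ <= X]big_seq.
apply: ler_sum => u uv; rewrite !mulr_sumr big_seq [X in _ <= X]big_seq.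
apply: ler_sum => x xu; have [ux _] := level_spec xu.
have := @pivotS n x v u w uv ux.
by case: pivot => [/(_ isT) /and3P [-> -> ->]|_]; rewrite ?mulr1 ?mulr0 ?mulr_ge0.
Qed.

Lemma indep_pivots n v (y : T) : ~~ le v (val y) ->
  indep y (fun s : conf => pivots n v (ext0 s)).
Proof.
move=> vy s b; apply: eq_big_seq => x xv; have [vx _] := level_spec xv.
have xy : x != val y by apply: contra vy => /eqP <-.
rewrite /pivot ext0_updT.
have E c : upd (upd (ext0 s) (val y) b) x c = upd (upd (ext0 s) x c) (val y) b.
  apply/funext => z; rewrite /upd; case: (eqVneq z x) => // ->.
  by rewrite (negbTE xy).
have U w : blk N j n (upd w (val y) b) v = blk N j n w v by rewrite (blk_upd _ tree).
by rewrite !E !U.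
Qed.

Lemma inside_P n v : inside P N n v -> P v.
Proof. by case: n => [|n] //= /andP[]. Qed.

Lemma Ex_others n v u : inside P N n.+1 v -> u \in N v -> (0 < m)%N ->
  Ex (fun s => (others n v u (ext0 s) == m.-1)%:R)
    = bin_pmf (lamb p k m n) k.-1 m.-1.
Proof.
move=> /= /andP[Pv /allP Hv] uv m0; set r := rem u (N v).
have rN x : x \in r -> x \in N v by exact: mem_rem.
have ur : uniq r by apply: rem_uniq; exact: tree_uniq tree v.
have sr : size r = k.-1 by rewrite size_rem // sizeN.
have H i : Ex (fun s => (i <= others n v u (ext0 s))%:R) = tail (lamb p k m n) k.-1 i.
  rewrite (@Ex_count R V P T p V r (fun x (s : conf) => blk N j n (ext0 s) x) i ur); last first.
    move=> x x' y xr x'r xx'; have [xy|xy] := boolP (le x (val y)).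
      right; apply: (indep_blk j tree); apply: contra xx' => x'y; apply/eqP.
      exact: (tree_disj tree (rN _ xr) (rN _ x'r) xy x'y).
    by left; apply: (indep_blk j tree).
  rewrite (tail_map _ _ sr); congr (tails _ _); apply/eq_in_map => x xr.
  by rewrite -(pblk_inside T p tree sizeN jk (Hv x (rN x xr))).
rewrite -tail_pmf -!H -ExB; apply: eq_Ex => s.
by case: ltngtP => // _; rewrite ?subrr ?subr0.
Qed.

(** The derivative of a |-> p tail a k m at [lamb n], by [tail_der]. *)
Definition slope n : R := p * (k%:R * bin_pmf (lamb p k m n) k.-1 m.-1).

Fixpoint mean_pivots n : R := if n is n'.+1 then slope n' * mean_pivots n' else 1.

(** In the square of the sum over the children, diagonal terms contract by [slope]; off-diagonal
    ones factorize, since distinct subtrees are independent, and are bounded by k^2 times the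
    squared mean. *)
Fixpoint sqr_pivots n : R :=
  if n is n'.+1 then slope n' * sqr_pivots n' + k%:R ^+ 2 * mean_pivots n' ^+ 2 else 1.

(** The state of [v], the number of blocked siblings of [u] and the subtree of [u] involve disjoint
    sets of sites. *)
Lemma Ex_kid_pivots n v u (F : R -> R) : inside P N n.+1 v -> u \in N v -> (0 < m)%N ->
  Ex (fun s => (ext0 s v)%:R * ((others n v u (ext0 s) == m.-1)%:R * F (pivots n u (ext0 s))))
   = p * (bin_pmf (lamb p k m n) k.-1 m.-1 * Ex (fun s => F (pivots n u (ext0 s)))).
Proof.
move=> iv uv m0; rewrite -(Ex_others iv uv m0).
have Pv := inside_P iv; pose x : T := Sub v Pv; have xv : val x = v by rewrite SubK.
rewrite -[X in X * _](Ex_occupied p x).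
have kidv u' : u' \in N v -> ~~ le u' v.
  by move=> /(tree_dp tree) d; apply/negP => /(tree_dp_le tree); rewrite d ltnn.
have rN z : z \in rem u (N v) -> z \in N v by exact: mem_rem.
have ind (y : T) : ~~ le u (val y) -> indep y (fun s : conf => F (pivots n u (ext0 s))).
  by move=> uy; apply: indep_comp; exact: indep_pivots.
have indo (y : T) : (forall u', u' \in rem u (N v) -> ~~ le u' (val y)) ->
    indep y (fun s : conf => (others n v u (ext0 s) == m.-1)%:R : R).
  move=> H; apply: (indep_comp (fun i => (i == m.-1)%:R : R)).
  by apply: indep_count => z zr; apply: (indep_blk j tree); exact: H.
rewrite -Ex_indepM; last first.
  move=> y; have [uy|uy] := boolP (le u (val y)); last by right; exact: ind.
  left; apply: indo => u' u'r; apply/negP => u'y.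
  have := tree_disj tree uv (rN _ u'r) uy u'y.
  move: u'r; rewrite (rem_filter _ (tree_uniq tree v)) mem_filter => /andP[+ _] => /[swap] ->.
  by rewrite /= eqxx.
rewrite -Ex_indepM; first by apply: eq_Ex => s; rewrite -{1}xv ext0_val.
move=> y; have [yx|yx] := eqVneq y x; last first.
  by left=> s b; rewrite ffunE eq_sym (negbTE yx).
right; rewrite yx; apply: (indep2 (fun a b : R => a * b)); last by apply: ind; rewrite xv kidv.
by apply: indo => u' u'r; rewrite xv kidv // rN.
Qed.

Lemma slope_ge0 n : 0 <= slope n.
Proof.
rewrite /slope !mulr_ge0 ?(ltW p0) // /bin_pmf mulrn_wge0 //.
have /andP[l0 l1] := lamb01 k m n (introT andP (conj (ltW p0) (ltW p1))).
by rewrite mulr_ge0 ?exprn_ge0 ?subr_ge0.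
Qed.

Lemma mean_pivots_ge0 n : 0 <= mean_pivots n.
Proof. by elim: n => //= n IH; rewrite mulr_ge0 ?slope_ge0. Qed.

Lemma sqr_pivots_ge0 n : 0 <= sqr_pivots n.
Proof. by elim: n => //= n IH; rewrite addr_ge0 // mulr_ge0 ?slope_ge0 ?sqr_ge0 // sqr_ge0. Qed.

Hypothesis m0 : (0 < m)%N.

Lemma Ex_pivots n v : inside P N n v -> Ex (fun s => pivots n v (ext0 s)) <= mean_pivots n.
Proof.
elim: n v => [|n IH] v iv /=.
  rewrite -(Ex_cst T p 1); apply: Ex_le => // s; rewrite /pivots /= big_seq1.
  by rewrite lern1 leq_b1.
apply: (@le_trans _ _ (Ex (fun s => \sum_(u <- N v) (ext0 s v)%:R * ((others n v u (ext0 s) == m.-1)%:R * pivots n u (ext0 s))))).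
  by apply: Ex_le => // s; rewrite -mulr_sumr; exact: pivotsS.
rewrite Ex_sum; apply: (@le_trans _ _ (\sum_(u <- N v) p * (bin_pmf (lamb p k m n) k.-1 m.-1 * mean_pivots n))).
  rewrite big_seq [X in _ <= X]big_seq; apply: ler_sum => u uv.
  have iu : inside P N n u by move: iv => /= /andP[_ /allP]; apply.
  rewrite (@Ex_kid_pivots n v u id iv uv m0) ler_wpM2l ?(ltW p0) //.
  rewrite ler_wpM2l ?IH // /bin_pmf mulrn_wge0 //.
  have /andP[l0 l1] := lamb01 k m n (introT andP (conj (ltW p0) (ltW p1))).
  by rewrite mulr_ge0 ?exprn_ge0 ?subr_ge0.
rewrite big_const_seq count_predT sizeN iter_addr_0 -mulr_natl /slope.
by rewrite le_eqVlt; apply/orP; left; apply/eqP; ring.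
Qed.

Lemma Ex_pivots_sqr n v : inside P N n v ->
  Ex (fun s => pivots n v (ext0 s) ^+ 2) <= sqr_pivots n.
Proof.
elim: n v => [|n IH] v iv /=.
  rewrite -(Ex_cst T p 1); apply: Ex_le => // s; rewrite /pivots /= big_seq1.
  by case: pivot; rewrite ?expr1n ?expr0n.
have iu u : u \in N v -> inside P N n u by move: iv => /= /andP[_ /allP] H /H.
pose z u (s : conf) : R := (ext0 s v)%:R * ((others n v u (ext0 s) == m.-1)%:R * pivots n u (ext0 s) ^+ 2).
(* The indicators of [pivotsS] are kept on the diagonal, where they yield the slope, and dropped
   elsewhere. *)
apply: (@le_trans _ _ (Ex (fun s => \sum_(u <- N v) z u s +
   \sum_(u <- N v) \sum_(u' <- N v | u' != u) pivots n u (ext0 s) * pivots n u' (ext0 s)))).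
  apply: Ex_le => // s; set q := fun u => (others n v u (ext0 s) == m.-1)%:R * pivots n u (ext0 s).
  have q0 u : 0 <= q u by rewrite mulr_ge0 ?pivots_ge0.
  have qp u : q u <= pivots n u (ext0 s).
    by rewrite /q; case: (_ == _); rewrite ?mul1r ?mul0r ?pivots_ge0.
  apply: (@le_trans _ _ ((ext0 s v)%:R * (\sum_(u <- N v) q u) ^+ 2)).
    have := pivotsS n v (ext0 s); rewrite -/(\sum_(u <- N v) q u) => h.
    have h0 := pivots_ge0 n.+1 v (ext0 s).
    case: (ext0 s v) h; rewrite ?mul1r ?mul0r => h.
      by apply: lerXn2r; rewrite ?nnegrE // (le_trans h0 h).
    have -> : pivots n.+1 v (ext0 s) = 0 by apply/eqP; rewrite eq_le h h0.
    by rewrite expr0n.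
  rewrite expr2 mulr_suml mulr_sumr -big_split /=.
  rewrite big_seq [X in _ <= X]big_seq; apply: ler_sum => u uv.
  rewrite mulr_sumr (bigD1_seq u uv (tree_uniq tree v)) /= mulrDr lerD //.
    rewrite /z le_eqVlt; apply/orP; left; apply/eqP; congr (_ * _).
    by rewrite /q; case: (_ == _); rewrite ?mul1r ?mul0r.
  apply: (@le_trans _ _ (\sum_(u' <- N v | u' != u) q u * q u')).
    by rewrite ler_piMl ?lern1 ?leq_b1 //; apply: sumr_ge0 => i _; rewrite mulr_ge0.
  by apply: ler_sum => u' _; apply: ler_pM.
rewrite ExD !Ex_sum; apply: lerD.
  apply: (@le_trans _ _ (\sum_(u <- N v) p * (bin_pmf (lamb p k m n) k.-1 m.-1 * sqr_pivots n))).
    rewrite big_seq [X in _ <= X]big_seq; apply: ler_sum => u uv.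
    rewrite (@Ex_kid_pivots n v u (fun a => a ^+ 2) iv uv m0) ler_wpM2l ?(ltW p0) //.
    rewrite ler_wpM2l ?IH ?iu // /bin_pmf mulrn_wge0 //.
    have /andP[l0 l1] := lamb01 k m n (introT andP (conj (ltW p0) (ltW p1))).
    by rewrite mulr_ge0 ?exprn_ge0 ?subr_ge0.
  rewrite big_const_seq count_predT sizeN iter_addr_0 -mulr_natl /slope.
  by rewrite le_eqVlt; apply/orP; left; apply/eqP; ring.
have M0 := mean_pivots_ge0 n.
apply: (@le_trans _ _ (\sum_(u <- N v) \sum_(u' <- N v) mean_pivots n ^+ 2)).
  rewrite big_seq [X in _ <= X]big_seq; apply: ler_sum => u uv.
  rewrite Ex_sum big_mkcond big_seq [X in _ <= X]big_seq; apply: ler_sum => u' u'v.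
  case: ifP => [u'u|_]; last exact: sqr_ge0.
  rewrite Ex_indepM; last first.
    move=> y; have [uy|uy] := boolP (le u (val y)); last by left; exact: indep_pivots.
    right; apply: indep_pivots; apply: contraTN u'u => u'y; apply/negPn/eqP.
    exact: (tree_disj tree u'v uv u'y uy).
  by rewrite expr2; apply: ler_pM; rewrite ?Ex_pivots ?iu //; apply: Ex_ge0 => // s; exact: pivots_ge0.
under eq_bigr do rewrite big_const_seq count_predT sizeN iter_addr_0.
rewrite big_const_seq count_predT sizeN iter_addr_0 -[_ *+ k *+ k]mulr_natl -[mean_pivots n ^+ 2 *+ k]mulr_natl mulrA.
by rewrite [k%:R ^+ 2]expr2.
Qed.

End Pivotal.

(** * From the infinite product measure to finite sums *)

Section Transfer.
Variables (R : realType) (V : choiceType) (P : pred V) (T : subFinType P).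
Variable p : R.
Variable mu : probability (config V) R.
Hypothesis mup : bernoulli_product p mu.
Local Notation conf := {ffun T -> bool}.

Definition local_on (A : Type) (F : (V -> bool) -> A) :=
  forall w w' : V -> bool, {in P, w =1 w'} -> F w = F w'.

Definition cylinder (s : conf) : set (config V) :=
  [set w : config V | forall v, v \in [seq val x | x : T] -> (w : V -> bool) v = ext0 s v]%classic.

Lemma cylinderE (s : conf) (w : config V) :
  cylinder s w <-> s = [ffun x => (w : V -> bool) (val x)].
Proof.
split=> [H|->].
  by apply/ffunP => x; rewrite ffunE H ?ext0_val // map_f ?mem_enum.
by move=> v /mapP[x _ ->]; rewrite ext0_val ffunE.
Qed.

Lemma mu_cylinder s : mu (cylinder s) = (muT p s)%:E.
Proof.
rewrite /cylinder mup; last by rewrite map_inj_uniq ?enum_uniq //; exact: val_inj.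
by rewrite big_map big_enum; congr (_%:E); apply: eq_bigr => x _; rewrite ext0_val.
Qed.

Lemma measurable_site v b : measurable [set w : config V | (w : V -> bool) v = b]%classic.
Proof. by apply: sub_sigma_algebra; exists v, b. Qed.

Lemma measurable_cylinder s : measurable (cylinder s).
Proof.
rewrite (_ : cylinder s = \bigcap_(x in [set: T]) [set w : config V | (w : V -> bool) (val x) = s x])%classic.
  apply: fin_bigcap_measurable => [|x _]; first exact: finite_finset.
  exact: measurable_site.
apply/seteqP; split=> w /=.
  by move=> H x _ /=; rewrite H ?ext0_val // map_f ?mem_enum.
by move=> H v /mapP[x _ ->]; rewrite ext0_val; apply: H.
Qed.

Lemma ext0_restrict (w : V -> bool) : {in P, ext0 [ffun x : T => w (val x)] =1 w}.
Proof. by move=> v vP; rewrite -[v](SubK T vP) ext0_val ffunE. Qed.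

Lemma local_sum (F : config V -> R) : local_on F ->
  F = (fun w => \sum_(s : conf) F (ext0 s) * \1_(cylinder s) w).
Proof.
move=> FP; apply/funext => w.
rewrite (bigD1 [ffun x => (w : V -> bool) (val x)]) //= [X in _ + X]big1 => [|s sw].
  rewrite addr0 indicE mem_set ?mulr1; last exact/cylinderE.
  by apply: FP => v /ext0_restrict ->.
rewrite indicE memNset ?mulr0 // => /cylinderE E.
by rewrite E eqxx in sw.
Qed.

Lemma measurable_local (F : config V -> R) : local_on F -> measurable_fun setT F.
Proof.
move=> /local_sum ->; apply: measurable_sum => s.
apply: measurable_funM; first exact: measurable_cst.
by apply: measurable_indic; exact: measurable_cylinder.
Qed.

Lemma integral_local (F : config V -> R) : local_on F -> (forall w, 0 <= F w) ->
  (\int[mu]_w (F w)%:E)%E = (Ex p (fun s : conf => F (ext0 s)))%:E.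
Proof.
move=> FP F0.
transitivity (\int[mu]_w (\sum_(s : conf) (F (ext0 s) * \1_(cylinder s) w)%:E)%E)%E.
  by apply: eq_integral => w _; rewrite [F in LHS](local_sum FP) sumEFin.
rewrite ge0_integral_sum //.
- rewrite /Ex -sumEFin; apply: eq_bigr => s _.
  under eq_integral do rewrite EFinM.
  rewrite ge0_integralZl_EFin //.
    rewrite integral_indic //; last exact: measurable_cylinder.
    rewrite classical_sets.setIT mulrC EFinM; congr (_ * _)%E.
    exact: mu_cylinder.
  by apply/measurable_EFinP; apply: measurable_indic; exact: measurable_cylinder.
- move=> s; apply/measurable_EFinP; apply: measurable_funM; first exact: measurable_cst.
  by apply: measurable_indic; exact: measurable_cylinder.
- by move=> s w _; rewrite lee_fin mulr_ge0.
Qed.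

End Transfer.

(** * Null vectors of the generator in L^2 *)

Section Eigenfunctions.
Variables (R : realType) (V : choiceType).
Variable mu : probability (config V) R.

Lemma L2distE (f g : config V -> R) :
  L2dist mu f g = ((\int[mu]_w ((f w - g w) ^+ 2)%:E) `^ 2^-1)%E.
Proof.
rewrite /L2dist unlock; congr (_ `^ _)%E; apply: eq_integral => w _.
by rewrite /= powR_mulrn // real_normK // num_real.
Qed.

Lemma L2dist_cvg0 (f : nat -> config V -> R) (g : config V -> R) (a : nat -> R) :
  (forall n, (\int[mu]_w ((f n w - g w) ^+ 2)%:E <= (a n)%:E)%E) ->
  (a n @[n --> \oo] --> (0 : R))%classic ->
  (L2dist mu (f n) g @[n --> \oo] --> 0%E)%classic.
Proof.
move=> fa a0; apply: (@squeeze_cvge _ _ _ _ (cst 0%E) _ (fun n => (Num.sqrt (a n))%:E)).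
- apply: nearW => n; rewrite L2distE poweR_ge0 /=.
  have I0 : (0 <= \int[mu]_w ((f n w - g w) ^+ 2)%:E)%E.
    by apply: integral_ge0 => w _; rewrite lee_fin sqr_ge0.
  rewrite poweR12_sqrt //; move: I0 (fa n); case: integral => //= r _.
  by rewrite !lee_fin => ra; rewrite ler_wsqrtr.
- exact: cvg_cst.
- apply: cvg_EFin; first exact: nearW.
  rewrite (_ : fine \o _ = fun n => Num.sqrt (a n)) //.
  have := continuous_cvg _ (@sqrt_continuous R 0) a0.
  by rewrite sqrtr0; apply.
Qed.

Lemma Lfun_indic (A : set (config V)) : measurable A -> (\1_A : config V -> R) \in Lfun mu 2%:E.
Proof.
move=> mA; rewrite inE/=; apply/andP; split; rewrite inE/=; first exact: measurable_indic.
rewrite /finite_norm unlock poweR_lty //.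
rewrite (eq_integral (fun w => (\1_A w : R)%:E)) => [|w _]; last first.
  rewrite /= indicE; case: (w \in A); first by rewrite normr1 powR1.
  by rewrite normr0 powR0.
by rewrite integral_indic // classical_sets.setIT (le_lt_trans (probability_le1 _ _)) // ltry.
Qed.

Lemma ae_witness (A : set (config V)) (Q : config V -> Prop) :
  measurable A -> (0 < mu A)%E -> (\forall w \ae mu, Q w)%classic ->
  exists2 w, A w & Q w.
Proof.
move=> mA A0 H; apply: contrapT => nE.
have : mu.-negligible A.
  by apply: negligibleS H => w Aw /= Qw; apply: nE; exists w.
by move/(measure_negligible mA) => E; rewrite E ltxx in A0.
Qed.

Variables (N : V -> seq V) (j : nat) (p : R).

Lemma eigenspace_cst c : Defs.eigenspace N j p mu 0 (cst c).
Proof.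
have L0 : local_generator N j p (cst c : config V -> R) = cst 0.
  apply/funext => w; rewrite /local_generator fsbig1 // => x _.
  by rewrite /site_mean big_bool /= /bern -mulrDl addrCA subrr addr0 mul1r subrr mulr0.
split; [exact: Lfun_cst|by under eq_fun do rewrite mul0r; exact: Lfun_cst|].
exists (fun=> cst c); split=> [n||].
- by exists [::].
- apply: (@L2dist_cvg0 _ _ (fun=> 0)); last exact: cvg_cst.
  by move=> n; under eq_integral do rewrite subrr expr0n /=; rewrite integral0.
- apply: (@L2dist_cvg0 _ _ (fun=> 0)); last exact: cvg_cst.
  by move=> n; under eq_integral do rewrite L0 mul0r subrr expr0n /=; rewrite integral0.
Qed.

(** Constants are null vectors as well. If 1 and the indicator of [A] were both multiples of one
    function, evaluating at a point of [A] and at a point outside it would be contradictory. *)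
Lemma simple_eigenvalue_trivial (A : set (config V)) : measurable A ->
  simple_eigenvalue N j p mu 0 -> Defs.eigenspace N j p mu 0 (\1_A) ->
  (0 < mu A)%E -> (0 < mu (~` A)%classic)%E -> False.
Proof.
move=> mA [g [_ _ spans]] eA A0 nA0.
have [c1 H1] := spans _ (eigenspace_cst 1); have [c2 H2] := spans _ eA.
have H : (\forall w \ae mu, 1 = c1 * g w /\ \1_A w = c2 * g w)%classic.
  by apply: filterS2 H1 H2 => w /(_ I) E1 /(_ I) E2.
have [w Aw [E1 E2]] := ae_witness mA A0 H.
have [w' nAw' [E1' E2']] := ae_witness (measurableC mA) nA0 H.
move: E2 E2'; rewrite !indicE mem_set // memNset // => E2 E2'.
have gw : g w' != 0 by apply/eqP => g0; move: E1'; rewrite g0 mulr0 => /eqP; rewrite oner_eq0.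
move: E2' => /esym/eqP; rewrite mulf_eq0 (negbTE gw) orbF => /eqP c0.
by move: E2; rewrite c0 mul0r => /eqP; rewrite oner_eq0.
Qed.

End Eigenfunctions.

(** * Pivotal vertices above the deepest level *)

Section Frozen.
Variables (V : choiceType) (N : V -> seq V) (j k : nat) (le : rel V) (dp : V -> nat).
Hypothesis tree : tree_order N le dp.
Hypotheses (sizeN : forall v, size (N v) = k) (jk : (0 < j <= k)%N).
Implicit Types (w : V -> bool) (v u x : V) (n : nat).
Local Notation blk := (blk N j).

Lemma eq_blk n v w w' :
  (forall x, le v x -> (dp x <= dp v + n)%N -> w x = w' x) -> blk n w v = blk n w' v.
Proof.
elim: n v => [|n IH] v H /=; first by apply: H; rewrite ?addn0 ?(tree_refl tree).
rewrite H ?(tree_refl tree) ?leq_addr //; congr (_ && ~~ (_ <= _)%N).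
apply: eq_in_count => u uv; rewrite (IH u) // => x ux dx; apply: H.
  exact: (tree_trans tree (tree_kid tree uv) ux).
by rewrite addnS -addSn -(tree_dp tree uv).
Qed.

Lemma blk_mono n v w w' : (forall x, w x -> w' x) -> blk n w v -> blk n w' v.
Proof.
move=> H; elim: n v => [|n IH] v /=; first exact: H.
case/andP => /H -> /=; apply: contra => /leq_trans; apply.
by apply: sub_count => u /=; apply: contra; exact: IH.
Qed.

Lemma blk_decr n v w : blk n.+1 w v -> blk n w v.
Proof.
elim: n v => [|n IH] v; first by case/andP.
move=> /= /andP[-> /=]; apply: contra => /leq_trans; apply.
by apply: sub_count => u; apply: contra; exact: IH.
Qed.

Lemma blk_occupied n v w : blk n w v -> w v.
Proof. by case: n => [|n] //= /andP[]. Qed.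

Lemma level_complete n v x : le v x -> dp x = (dp v + n)%N -> x \in level N n v.
Proof.
elim: n v => [|n IH] v.
  rewrite (tree_split tree) addn0 inE => /orP[//|/(below_dp tree)] /[swap] ->.
  by rewrite ltnn.
rewrite (tree_split tree) => /orP[/eqP -> /eqP|/hasP[u uv ux] d /=].
  by rewrite -{1}[dp v]addn0 eqn_add2l.
by apply/flatten_mapP; exists u => //; apply: IH; rewrite // d (tree_dp tree uv) addSnnS.
Qed.

(** A vertex above relative depth [n] undergoes at least one round; with [j] empty children it would
    be emptied whatever its state, and so could not be pivotal. By [pivotS] its ancestors up to [v]
    are occupied. *)
Lemma pivot_frozen n v x w : le v x -> (dp x < dp v + n)%N -> pivot N j n x v w ->
  (count (fun y => ~~ w y) (N x) < j)%N /\ (x = v \/ exists2 y, x \in N y & w y).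
Proof.
elim: n v => [|n IH] v vx; first by rewrite addn0 ltnNge (tree_dp_le tree vx).
move=> dx piv; move: vx; rewrite (tree_split tree) => /orP[/eqP xv|/hasP[u uv ux]].
  split; last by left.
  move: piv; rewrite xv => /andP[/= /andP[_ +] _]; rewrite -ltnNge; apply: leq_ltn_trans.
  rewrite (@eq_in_count _ _ (fun u => ~~ upd w v true u)) => [|u uv].
    by apply: sub_count => u; apply: contra; exact: blk_occupied.
  rewrite /upd; case: eqP => // E; have := tree_dp tree uv; rewrite E => /eqP.
  by rewrite -{1}[dp v]addn0 -addn1 eqn_add2l.
have /and3P[wv _ piv'] := pivotS tree sizeN jk uv ux piv.
have [|c [xu|]] := IH u ux _ piv'.
- by rewrite (tree_dp tree uv) addSnnS.
- by split=> //; right; exists v; rewrite // xu.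
- by split=> //; right.
Qed.

End Frozen.

(** * The generator applied to survival on the regular tree *)

Section RegularTree.
Variables (R : realType) (k j : nat) (p : R).
Hypotheses (jk : (0 < j <= k)%N) (p01 : 0 <= p <= 1).
Local Notation V := (bool * seq 'I_k)%type.
Implicit Types (w : V -> bool) (v x : V).

(** Children when the regular tree is oriented away from the edge joining the two copies; the parent
    of each root is the opposite root. *)
Definition half_kids (v : V) : seq V := [seq (v.1, s) | s <- kids v.2].
Definition half_le : rel V := fun v z => (v.1 == z.1) && suffix v.2 z.2.
Definition depth (v : V) : nat := size v.2.

Lemma half_tree : tree_order half_kids half_le depth.
Proof.
have tree := words_tree k.
split=> [[b s]|[b s] [b1 s1] [b2 s2]|[b s]|[b s] [b1 s1]|[b s] [b1 s1]|[b s] [b1 s1]|[b s] [b1 s1] [b2 s2]].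
- by rewrite /half_le eqxx (tree_refl tree).
- by move=> /andP[/eqP /= -> h] /andP[/eqP /= -> h']; rewrite /half_le eqxx (tree_trans tree h h').
- by rewrite map_inj_uniq ?(tree_uniq tree) // => s1 s2 [].
- by case/mapP => s2 /= h [_ ->]; exact: (tree_dp tree h).
- rewrite /half_le /= (tree_split tree) xpair_eqE andb_orr [b1 == b]eq_sym; congr (_ || _).
  rewrite /half_kids has_map /=; case: (eqVneq b b1) => [->|/negbTE bb] /=.
    by apply: eq_has => s2; rewrite /= eqxx.
  by apply/esym/hasP => -[s2 _]; rewrite /= bb.
- by case/andP => _; exact: (tree_dp_le tree).
- by move=> /andP[/eqP /= -> h] /andP[/eqP /= -> h'] /(tree_anc tree h h') ->.
Qed.

Lemma size_half_kids v : size (half_kids v) = k.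
Proof. by rewrite size_map size_kids. Qed.

Lemma parent_kid v x : x \in half_kids v -> parent x = v.
Proof. by case: v => b s /mapP[s1 /mapP[i _ ->] ->]. Qed.

Definition root b : V := (b, [::]).

Lemma root_le b x : half_le (root b) x = (b == x.1).
Proof. by rewrite /half_le /= suffix0s andbT. Qed.

(** With both roots required to survive, each root can be pivotal only when its parent, the other
    root, is occupied. *)
Definition survives n w : bool :=
  blk half_kids j n w (root true) && blk half_kids j n w (root false).

Lemma survivesE b n w : survives n w =
  blk half_kids j n w (root b) && blk half_kids j n w (root (~~ b)).
Proof. by case: b; rewrite // andbC. Qed.

Lemma survives_upd n x w b : survives n (upd w x b) =
  blk half_kids j n (upd w x b) (root x.1) && blk half_kids j n w (root (~~ x.1)).
Proof. by rewrite (survivesE x.1) [blk _ _ _ _ (root (~~ x.1))](blk_upd _ half_tree) // root_le; case: x.1. Qed.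

Lemma upd_id w x : upd w x (w x) = w.
Proof. by apply/funext => y; rewrite /upd; case: eqP => // ->. Qed.

Lemma survives_pivot n x w : survives n (upd w x true) != survives n (upd w x false) ->
  pivot half_kids j n x (root x.1) w /\ blk half_kids j n w (root (~~ x.1)).
Proof.
rewrite !survives_upd /pivot; case: (blk _ _ n w _); rewrite ?andbT ?andbF ?eqxx //.
have := @blk_mono _ half_kids j n (root x.1) (upd w x false) (upd w x true).
case: (blk _ _ n (upd w x false) _); case: (blk _ _ n (upd w x true) _) => // H _.
by suff : false by []; apply: H => // y; rewrite /upd; case: eqP.
Qed.

(* Above depth n a pivotal vertex has fewer than j empty children and an
   occupied parent, so it is not facilitated; below depth n there is none. *)
Lemma generator_term n x w :
  `|(facilitated (@nbrs k) j w x)%:R * (site_mean p x (fun w => (survives n w)%:R) w - (survives n w)%:R)|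
  <= (x \in level half_kids n (root x.1))%:R * (pivot half_kids j n x (root x.1) w)%:R :> R.
Proof.
have [E|neq] := eqVneq (survives n (upd w x true)) (survives n (upd w x false)).
  have Ew b : survives n (upd w x b) = survives n w by rewrite -{2}(upd_id w x); case: b; case: (w x).
  by rewrite /site_mean big_bool /= !Ew /bern -mulrDl addrCA subrr addr0 mul1r subrr mulr0 normr0 mulr_ge0.
have [piv oth] := survives_pivot neq.
have dn : (depth x <= n)%N.
  rewrite leqNgt; apply: contra neq => dx.
  by rewrite !survives_upd !(blk_upd_far _ half_tree).
case: ltngtP dn => // [dn|dn] _.
  have rx : half_le (root x.1) x by rewrite root_le.
  have [c xy] := pivot_frozen half_tree size_half_kids jk rx dn piv.
  rewrite (_ : facilitated _ _ _ _ = false) ?mul0r ?normr0 ?mulr_ge0 //.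
  apply/negbTE; rewrite /facilitated -ltnNge /=.
  suff -> : w (parent x) by rewrite add0n.
  case: xy => [xr|[y /parent_kid -> //]].
  by rewrite xr /=; exact: blk_occupied oth.
rewrite (level_complete half_tree) ?piv ?mulr1 ?root_le //.
case: facilitated; rewrite ?mul0r ?normr0 // ?mul1r.
rewrite -{2}(upd_id w x) /site_mean big_bool /= /bern; move: neq; rewrite ler_norml.
have -> : survives n (upd w x (w x)) =
  if w x then survives n (upd w x true) else survives n (upd w x false) by case: (w x).
move: (survives _ _) (survives _ _) (w x) p01 => {w piv oth} a b c /andP[p0 p1].
by case: a; case: b => // _; case: c; rewrite /= ?mulr1n ?mulr0n ?mulr1 ?mulr0; apply/andP; split; lra.
Qed.

Lemma sum_undup_le (I : eqType) (r : seq I) (F : I -> R) : (forall i, 0 <= F i) ->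
  \sum_(i <- undup r) F i <= \sum_(i <- r) F i.
Proof.
move=> F0; elim: r => [|i r IH] /=; first by rewrite !big_nil.
by case: ifP => _; rewrite !big_cons ?lerD2l // ler_wpDl.
Qed.

Local Notation survival n := (fun w : config V => (survives n w)%:R : R).

(** The finite support sum requires a list without repetition, which [undup] provides; for the
    bound, removing terms from a nonnegative sum is harmless. *)
Definition roots_level n : seq V :=
  undup (level half_kids n (root true) ++ level half_kids n (root false)).

Lemma generator_sum n w : local_generator (@nbrs k) j p (survival n) w =
  \sum_(x <- roots_level n)
    (facilitated (@nbrs k) j w x)%:R * (site_mean p x (survival n) w - (survives n w)%:R).
Proof.
rewrite fsbig_seq ?undup_uniq //; apply/esym/fsbig_widen => // x [_ /= /negP xr].
apply/eqP; rewrite -normr_eq0 eq_le normr_ge0 andbT (le_trans (generator_term _ _ _)) //.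
suff /negbTE -> : x \notin level half_kids n (root x.1) by rewrite mul0r.
by apply: contra xr; rewrite mem_undup mem_cat; case: x.1 => ->; rewrite ?orbT.
Qed.

Lemma generator_le n w : `|local_generator (@nbrs k) j p (survival n) w| <=
  pivots R half_kids j n (root true) w + pivots R half_kids j n (root false) w.
Proof.
rewrite generator_sum (le_trans (ler_norm_sum _ _ _)) //.
apply: (le_trans (ler_sum _ (fun x _ => generator_term n x w))).
rewrite (le_trans (sum_undup_le _ _)) => [//|x|]; first by rewrite mulr_ge0.
rewrite big_cat lerD //= /pivots big_seq [X in _ <= X]big_seq; apply: ler_sum => x xl;
  have [] := level_spec half_tree xl; rewrite root_le => /eqP <- _;
  by rewrite ler_piMl ?lern1 ?leq_b1.
Qed.

Definition ball n : seq V := [seq (b, val t) | b <- [:: true; false], t <- enum {bseq n of 'I_k}].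

Lemma mem_ball n v : (v \in ball n) = (depth v <= n)%N.
Proof.
apply/allpairsP/idP => [[[b t] [_ _ ->]]|vn]; first exact: size_bseq.
exists (v.1, Bseq vn); split; first by case: v.1.
  exact: mem_enum.
by case: v vn.
Qed.

Lemma survives_local n w w' : (forall v, (depth v <= n)%N -> w v = w' v) ->
  survives n w = survives n w'.
Proof.
by move=> H; rewrite /survives; congr (_ && _); apply: (eq_blk _ half_tree) => x _; exact: H.
Qed.

(** One level more than for [survives]: the constraints at depth [n] read the children. *)
Lemma generator_local n w w' : (forall v, (depth v <= n.+1)%N -> w v = w' v) ->
  local_generator (@nbrs k) j p (survival n) w = local_generator (@nbrs k) j p (survival n) w'.
Proof.
move=> H; have H' v : (depth v <= n)%N -> w v = w' v by move=> vn; apply: H; exact: leqW.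
rewrite !generator_sum; apply: eq_big_seq => x; rewrite mem_undup mem_cat => xl.
have dx : depth x = n by case/orP: xl => /(level_spec half_tree) [].
congr (_%:R * (_ - _%:R)).
- congr (_ <= _)%N; apply: eq_in_count => y; rewrite inE => /orP[/eqP ->|/(tree_dp half_tree) dy].
    rewrite H // -dx; case: (x) => b [|i s] //=; exact: leqW.
  by rewrite H // dy dx.
- rewrite /site_mean; apply: eq_bigr => b _; congr (_ * _%:R).
  by rewrite (@survives_local n _ (upd w' x b)) // => v vn; rewrite /upd; case: eqP => // _; exact: H'.
- by rewrite (@survives_local n _ w').
Qed.

Lemma inside_ball n i v : (depth v + i <= n)%N ->
  inside (fun v => v \in ball n) half_kids i v.
Proof.
elim: i v => [|i IH] v vn /=; first by rewrite mem_ball -[depth v]addn0.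
rewrite mem_ball (leq_trans (leq_addr _ _) vn); apply/allP => u uv; apply: IH.
by rewrite (tree_dp half_tree uv) addSnnS.
Qed.

End RegularTree.

(** * The event of surviving for ever as a second null vector *)

Section InfiniteVolume.
Variables (R : realType) (k j : nat) (p : R).
Hypotheses (jk : (0 < j <= k)%N) (p0 : 0 < p) (p1 : p < 1).
Local Notation V := (bool * seq 'I_k)%type.
Local Notation m := (k.+1 - j)%N.
Local Notation T n := (seq_sub (ball k n)).
Local Notation conf n := {ffun T n -> bool}.
Local Notation survival n := (fun w : config V => (survives j n w)%:R : R).
Variable mu : probability (config V) R.
Hypothesis mup : bernoulli_product p mu.

Let m0 : (0 < m)%N. Proof. by case/andP: jk; lia. Qed.

Lemma ball_local (A : Type) n (F : (V -> bool) -> A) :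
  (forall w w' : V -> bool, (forall v, (depth v <= n)%N -> w v = w' v) -> F w = F w') ->
  local_on (fun v => v \in ball k n) F.
Proof. by move=> H w w' ww'; apply: H => v vn; apply: ww'; rewrite [_ \in _]mem_ball. Qed.

Lemma survival_mass n :
  (\int[mu]_w (survival n w)%:E)%E = (lamb p k m n ^+ 2)%:E.
Proof.
have loc : local_on (fun v => v \in ball k n) (survival n).
  by apply: ball_local => w w' H; rewrite (survives_local j H).
rewrite (integral_local (T n) mup loc) //; congr (_%:E).
have pb b : Ex p (fun s : conf n => (blk (@half_kids k) j n (ext0 s) (root k b))%:R) = lamb p k m n.
  by apply: (pblk_inside (T n) p (half_tree k) (@size_half_kids k) jk); exact: inside_ball.
rewrite expr2 -{1}(pb true) -(pb false) -Ex_indepM.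
  by apply: eq_Ex => s; rewrite /survives -natrM mulnb.
move=> y; have [b|b] := boolP (val y).1.
  by right; apply: (indep_comp (fun a : bool => a%:R : R)); apply: (indep_blk j (half_tree k)); rewrite root_le b.
by left; apply: (indep_comp (fun a : bool => a%:R : R)); apply: (indep_blk j (half_tree k)); rewrite root_le; case: (val y).1 b.
Qed.

Lemma generator_mass n :
  (\int[mu]_w ((local_generator (@nbrs k) j p (survival n) w) ^+ 2)%:E <=
    (4 * sqr_pivots p j k n)%:E)%E.
Proof.
have loc : local_on (fun v => v \in ball k n.+1)
    (fun w : config V => (local_generator (@nbrs k) j p (survival n) w) ^+ 2).
  apply: ball_local => w w' H; congr (_ ^+ 2); apply: generator_local H => //.
  by rewrite !ltW.
rewrite (integral_local (T n.+1) mup loc) => [|w]; last exact: sqr_ge0.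
rewrite lee_fin; pose pv b (s : conf n.+1) := pivots R (@half_kids k) j n (root k b) (ext0 s).
have pv0 b s : 0 <= pv b s by exact: pivots_ge0.
have Epv b : Ex p (fun s => pv b s ^+ 2) <= sqr_pivots p j k n.
  apply: (Ex_pivots_sqr (T n.+1) p0 p1 (half_tree k) (@size_half_kids k) jk m0).
  exact: inside_ball.
(* The factor 4 comes from (a + b)^2 <= 2 (a^2 + b^2) and the two roots. *)
apply: (@le_trans _ _ (Ex p (fun s => 2 * (pv true s ^+ 2 + pv false s ^+ 2)))).
  apply: Ex_le => // s; have := @generator_le R k j p jk _ n (ext0 s).
  rewrite -/(pv true s) -/(pv false s) => /(_ _)/le_trans H.
  rewrite -real_normK ?num_real //; apply: (@le_trans _ _ ((pv true s + pv false s) ^+ 2)).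
    by apply: lerXn2r; rewrite ?nnegrE ?addr_ge0 // H // !ltW.
  by rewrite -subr_ge0 (_ : _ - _ = (pv true s - pv false s) ^+ 2) ?sqr_ge0 //; ring.
rewrite ExZ ExD; have := Epv true; have := Epv false; lra.
Qed.

Lemma mean_pivots_cvg0 (r : R) : r < 1 -> (slope p j k n @[n --> \oo] --> r)%classic ->
  (mean_pivots p j k n @[n --> \oo] --> (0 : R))%classic.
Proof.
move=> r1 sr; apply: (@contraction_cvg0 _ _ (slope p j k) (fun=> 0) r) => //.
- by move=> n; exact: mean_pivots_ge0.
- by move=> n; rewrite addr0.
- exact: cvg_cst.
Qed.

Lemma sqr_pivots_cvg0 (r : R) : r < 1 -> (slope p j k n @[n --> \oo] --> r)%classic ->
  (sqr_pivots p j k n @[n --> \oo] --> (0 : R))%classic.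
Proof.
move=> r1 sr; apply: (@contraction_cvg0 _ _ (slope p j k)
  (fun n => k%:R ^+ 2 * mean_pivots p j k n ^+ 2) r) => //.
- by move=> n; exact: sqr_pivots_ge0.
- have M := mean_pivots_cvg0 r1 sr.
  rewrite -[X in (_ --> X)%classic](mulr0 (k%:R ^+ 2)).
  apply: cvgMr; under eq_fun do rewrite expr2.
  have MM : (mean_pivots p j k n * mean_pivots p j k n @[n --> \oo] --> (0 * 0 : R))%classic by exact: cvgM.
  by rewrite mulr0 in MM; exact: MM.
Qed.

Definition forever : set (config V) := (\bigcap_n [set w : config V | survives j n w])%classic.

Lemma measurable_survives n : measurable [set w : config V | survives j n w]%classic.
Proof.
have loc : local_on (fun v => v \in ball k n) (survival n).
  by apply: ball_local => w w' H; rewrite (survives_local j H).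
have := measurable_local (T n) loc measurableT (measurable_set1 (1 : R)).
rewrite classical_sets.setTI; congr measurable; apply/seteqP; split=> w /=.
  by case: survives => // /esym/eqP; rewrite oner_eq0.
by move=> ->.
Qed.

Lemma measurable_forever : measurable forever.
Proof. by apply: bigcapT_measurable => n; exact: measurable_survives. Qed.

Lemma mu_survives n : mu [set w : config V | survives j n w]%classic = (lamb p k m n ^+ 2)%:E.
Proof.
rewrite -survival_mass -[X in mu X]classical_sets.setIT -integral_indic //; last exact: measurable_survives.
apply: eq_integral => x _; rewrite indicE; congr ((nat_of_bool _)%:R%:E).
by apply/idP/idP; rewrite in_setE.
Qed.

Variables (w r : R).
Hypothesis lw : (lamb p k m n @[n --> \oo] --> w)%classic.

Lemma mu_forever : mu forever = (w ^+ 2)%:E.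
Proof.
have h : (mu [set w : config V | survives j n w] @[n --> \oo] --> mu forever)%classic.
  apply: (@nonincreasing_cvg_mu _ _ _ mu (fun n => [set w : config V | survives j n w]%classic)).
  - by rewrite (le_lt_trans (probability_le1 _ (measurable_survives 0))) ?ltry.
  - exact: measurable_survives.
  - exact: measurable_forever.
  - apply/nonincreasing_seqP => n; apply/subsetPset => x /=.
    by rewrite /survives => /andP[/blk_decr -> /blk_decr ->].
have h' : (mu [set w : config V | survives j n w] @[n --> \oo] --> (w ^+ 2)%:E)%classic.
  under eq_fun do rewrite mu_survives; apply: cvg_EFin; first exact: nearW.
  by rewrite (_ : fine \o _ = fun n => lamb p k m n ^+ 2) //; under eq_fun do rewrite expr2; rewrite expr2; exact: cvgM.
exact: (cvg_unique _ h h').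
Qed.

Hypotheses (r1 : r < 1) (sr : (slope p j k n @[n --> \oo] --> r)%classic).

(** The limit event is not local, so membership goes through the closure of the graph: the local
    approximants [survival n] converge to the indicator, while their images under the generator tend
    to 0. *)
Lemma eigenspace_forever : Defs.eigenspace (@nbrs k) j p mu 0 (\1_forever).
Proof.
split; [by apply: Lfun_indic; exact: measurable_forever|by under eq_fun do rewrite mul0r; exact: Lfun_cst|].
exists (fun n => survival n); split=> [n||].
- exists (ball k n) => x x' H; congr (_%:R).
  by rewrite (@survives_local k j n _ x') // => v vn; apply: H; rewrite mem_ball.
- apply: (@L2dist_cvg0 _ _ _ _ _ (fun n => lamb p k m n ^+ 2 - w ^+ 2)) => [n|].
    (* The squared difference is the indicator of surviving [n] rounds but not for ever. *)
    rewrite (eq_integral (fun x => (\1_([set x : config V | survives j n x] `\` forever)%classic x : R)%:E)) => [|x _]; last first.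
      congr (_%:E); rewrite !indicE in_setD; have [xf|xf] := boolP (x \in forever).
        have : survives j n x by move: xf; rewrite in_setE; apply.
        by move=> ->; rewrite andbF subrr expr0n.
      rewrite subr0 andbT; have -> : (x \in [set x : config V | survives j n x]%classic) = survives j n x.
        by apply/idP/idP; rewrite in_setE.
      by case: survives; rewrite ?expr1n ?expr0n.
    have mD := measurableD (measurable_survives n) measurable_forever.
    rewrite integral_indic // classical_sets.setIT.
    have AF : ([set x : config V | survives j n x] `&` forever)%classic = forever.
      by apply/classical_sets.setIidr => x; apply.
    have E : mu ([set x : config V | survives j n x] `\` forever)%classic
        = (mu [set x : config V | survives j n x]%classic - mu forever)%E.
      rewrite -[X in (_ - mu X)%E]AF; apply: measureD.
      - exact: measurable_survives.
      - exact: measurable_forever.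
      - by rewrite (le_lt_trans (probability_le1 _ (measurable_survives n))) ?ltry.
    suff H : (mu ([set x : config V | survives j n x] `\` forever)%classic <= (lamb p k m n ^+ 2 - w ^+ 2)%:E)%E by exact: H.
    by rewrite E mu_survives mu_forever.
  rewrite -[X in (_ --> X)%classic](subrr (w ^+ 2)); apply: cvgB; last exact: cvg_cst.
  by under eq_fun do rewrite expr2; rewrite expr2; exact: cvgM.
- apply: (@L2dist_cvg0 _ _ _ _ _ (fun n => 4 * sqr_pivots p j k n)) => [n|].
    by under eq_integral do rewrite mul0r subr0; exact: generator_mass.
  rewrite -[X in (_ --> X)%classic](mulr0 4); apply: cvgMr; exact: sqr_pivots_cvg0 r1 sr.
Qed.

Lemma not_simple : 0 < w -> w < 1 -> ~ simple_eigenvalue (@nbrs k) j p mu 0.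
Proof.
move=> w0 w1 H; apply: (simple_eigenvalue_trivial measurable_forever H eigenspace_forever).
  by rewrite mu_forever lte_fin exprn_gt0.
by rewrite probability_setC ?mu_forever ?lte_fin ?subr_gt0 ?exprn_ilt1 ?(ltW w0) //; exact: measurable_forever.
Qed.

End InfiniteVolume.

(** * From simplicity of the eigenvalue to subcriticality and the mixing bounds *)

Lemma tail_at0 (R : realType) k m : tail (0 : R) k m.+1 = 0.
Proof. by elim: k m => [|k IH] m; rewrite ?tail_rec ?IH ?mul0r ?mulr0 ?addr0. Qed.

(** If the inequality fails at [a], then a < p tail a and the iterates stop at a fixed point w >= a
    > 0. The failure at p2 < p also forces slope < 1 at [w], which gives a second null vector. *)
Lemma simple_subcritical (R : realType) (k j : nat) (p p2 a : R)
    (mu : probability (config (bool * seq 'I_k)) R) :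
  (0 < j <= k)%N -> 0 < p2 -> p2 < p -> p < 1 -> 0 <= a <= 1 ->
  bernoulli_product p mu -> simple_eigenvalue (@nbrs k) j p mu 0 ->
  p2 * tail a k (k.+1 - j) <= a.
Proof.
move=> jk p20 pp p1 a01 mup simple; rewrite leNgt; apply/negP => H.
have p0 := lt_trans p20 pp.
case: k mu mup simple jk H => [|k] mu mup simple jk.
  by move: jk; rewrite leqn0; case: (j).
have /andP[j0 jk'] := jk; rewrite subSn // => H.
have [t0 t1] := andP (tail01 k.+1 (k.+1 - j).+1 a01).
have a0 : 0 < a.
  case/andP: a01; rewrite le_eqVlt => /predU1P[a0|//] _; move: H.
  by rewrite -a0 tail_at0 mulr0 ltxx.
have ap : a <= p by apply/ltW/(lt_le_trans H)/(le_trans _ (ltW pp)); rewrite ler_piMr // ltW.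
have [|w [aw wp wfix lw]] := @lamb_cvg R p a k.+1 (k.+1 - j).+1 a0 ap (ltW p1).
  by apply/ltW/(lt_le_trans H); rewrite ler_wpM2r // ltW.
have w1 := le_lt_trans wp p1.
have kj : (k.+1 - j <= k)%N by move: j0; case: (j) => // i _; rewrite subSS leq_subr.
have r1 := slope_lt1 a0 aw w1 p20 pp kj H wfix.
have sr : (slope p j k.+1 n @[n --> \oo] --> p * (k.+1%:R * bin_pmf w k (k.+1 - j)))%classic.
  rewrite /slope subSn //=; apply: cvgMr; apply: cvgMr.
  under eq_fun do rewrite -tail_pmf; rewrite -tail_pmf.
  by apply: cvgB; exact: (cvg_comp _ _ lw (@tail_continuous R _ _ _)).
move: lw; rewrite -subSn // => lw.
exact: (not_simple jk p0 p1 mup lw r1 sr (lt_le_trans a0 aw) w1 simple).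
Qed.

Lemma subcritical_below_pc (R : realType) (k j : nat) (p : R) :
  (0 < j <= k)%N -> 0 < p -> p < pc R k j ->
  p < 1 /\ exists2 p2, p < p2 &
    forall a, 0 <= a <= 1 -> p2 * tail a k (k.+1 - j) <= a.
Proof.
move=> jk p0; rewrite /pc /critical_density; set S := (X in sup X) => ps.
(* The supremum of the empty set is 0 by convention, which p > 0 excludes. *)
have S0 : (S !=set0)%classic.
  by apply: contrapT => /set0P/negP/negPn/eqP S0; move: ps; rewrite S0 sup0 ltNge ltW.
have [p3 [/andP[_ p31] [mu [mup simple]]] pp3] := sup_gt S0 ps.
split; first exact: lt_trans p31.
(* The midpoint leaves room on both sides: p < p2 for the geometric decay and p2 < p3 for
   [simple_subcritical] at density p3. *)
exists ((p + p3) / 2) => [|a a01]; first by lra.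
by apply: (simple_subcritical jk _ _ p31 a01 mup simple); lra.
Qed.

Theorem corollary1 (R : realType) (k j : nat) (p : R)
    (hk : (0 < k)%N) (hj : (0 < j)%N) (hjk : (j <= k)%N)
    (hp0 : 0 < p) (hpc : p < pc R k j) :
  exists c : R, 0 < c /\
    forall n : nat, (1 <= n)%N ->
      [/\ ((c^-1 * n%:R)%:E <= level_mixing_time k j p n 1)%E,
          (level_mixing_time k j p n 1 <= level_mixing_time k j p n 2)%E &
          (level_mixing_time k j p n 2 <= (c * n%:R)%:E)%E].
Proof.
have jk : (0 < j <= k)%N by rewrite hj.
have [p1 [p2 pp2 sub]] := subcritical_below_pc jk hp0 hpc.
have [C C0 gap] := uniform_gap hp0 p1 pp2 jk sub.
have [M HM] : exists M, p ^+ M <= 4^-1.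
  have pn : `|p| < 1 by rewrite ger0_norm // ltW.
  have /cvgr_le/(_ 4^-1) := cvg_expr pn; rewrite invr_gt0 ltr0n => /(_ isT)[M _ H].
  by exists M; apply: H => /=.
have b0 : 0 < 4 * k%:R + 8 * k%:R * M%:R + 6 :> R by rewrite ltr_wpDl // addr_ge0 // !mulr_ge0.
have t0 : 0 <= level_time p k C.
  by rewrite /level_time divr_ge0 ?mulr_ge0 ?exprn_ge0 ?(ltW C0) // le_min ltW //= subr_ge0 ltW.
(* The sum of the constants of the lower and upper bounds serves for both. *)
exists (4 * k%:R + 8 * k%:R * M%:R + 6 + level_time p k C); split; first by rewrite ltr_wpDr.
move=> n n1; rewrite -(prednK n1); move: n.-1 => {n1}n; rewrite /level_mixing_time succnK; split.
- apply: le_trans (mixing_time_lower jk hp0 p1 n HM).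
  by rewrite lee_fin ler_wpM2r // lef_pV2 ?posrE ?lerDl // ltr_wpDr.
- exact: mixing_time_12 hp0 p1 n.
- apply: le_trans (mixing_time_upper hp0 p1 C0 (gap _ _ _ _ _ _ (words_tree k) (@size_kids k))) _.
  by rewrite lee_fin ler_wpM2r // lerDr ltW.
Qed.
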